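(* For any $m\in\mathbb{N}$ (with $m\geq 1$) we have $\ker(1-L_{\mathcal{M}})^m=\ker(1-L_{\mathcal{M}})$. As a consequence, the unstable subspace $\mathcal{M}$ is spanned by the gauge mode, i.e., $\mathcal{M}=\langle\mathbf{g}\rangle$, and the algebraic multiplicity of the eigenvalue $1\in\sigma_p(L)$ is $1$.
   Context: All functions are complex-valued. Let $\tilde H_1=\{u\in C^2[0,1]:u(0)=u'(0)=0\}$ and $\tilde H_2=\{u\in C^1[0,1]:u(0)=0\}$ with inner products $(u|v)_1=\int_0^1 u'(\rho)\overline{v'(\rho)}\,\rho^{-2}d\rho$, $(u|v)_2=\int_0^1 u'(\rho)\overline{v'(\rho)}\,d\rho$ and induced norms $\|\cdot\|_j$. Let $H_j$ be the completion of $\tilde H_j$, $\tilde{\mathcal{H}}=\tilde H_1\times\tilde H_2$, and let $\mathcal{H}=H_1\times H_2$ be the Hilbert space with inner product $(\mathbf{u}|\mathbf{v})=(u_1|v_1)_1+(u_2|v_2)_2$ and norm $\|\cdot\|$. Define $\tilde L_0:\mathcal{D}(\tilde L_0)\subset\mathcal{H}\to\mathcal{H}$ by $\mathcal{D}(\tilde L_0)=\{u\in C^3[0,1]:u(0)=u'(0)=u''(0)=0\}\times\{u\in C^3[0,1]:u(0)=0\}$ and $$\tilde L_0\mathbf{u}(\rho)=\begin{pmatrix}-\rho u_1'(\rho)+u_1(\rho)+\rho u_2'(\rho)-u_2(\rho)\\ \frac1\rho u_1'(\rho)-\rho u_2'(\rho)\end{pmatrix}.$$ $\tilde L_0$ is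 closable; $L_0$ denotes its closure. Let $L':\mathcal{H}\to\mathcal{H}$ be the bounded operator extending $$L'\mathbf{u}(\rho)=\begin{pmatrix}-V_1(\rho)\int_0^\rho\rho'u_2(\rho')d\rho'\\0\end{pmatrix},\qquad V_1(\rho)=-\frac{16}{(1+\rho^2)^2},$$ from $\tilde{\mathcal{H}}$. Put $L=L_0+L'$, $\mathcal{D}(L)=\mathcal{D}(L_0)$. $\sigma_p(L)$ is the set of eigenvalues of $L$. The number $1$ is an eigenvalue of $L$ and an isolated point of $\sigma(L)$, with eigenfunction the gauge mode $\mathbf{g}(\rho)=\frac{1}{(1+\rho^2)^2}\begin{pmatrix}2\rho^3\\ \rho(3+\rho^2)\end{pmatrix}$. Let $P=\frac{1}{2\pi i}\int_\Gamma(\lambda-L)^{-1}d\lambda$ be the associated spectral (Riesz) projection, where $\Gamma$ is a positively oriented closed curve in the resolvent set of $L$ enclosing $1$ and no other point of $\sigma(L)$ (e.g. the circle of radius $\frac13$ centered at $1$). The unstable subspace is $\mathcal{M}=P\mathcal{H}$, and $L_{\mathcal{M}}$ is the restriction of $L$ to $\mathcal{D}(L_{\mathcal{M}})=\mathcal{D}(L)\cap\mathcal{M}$, viewed as an operator on $\mathcal{M}$. The algebraic multiplicity of the eigenvalue $1$ is $\dim\mathcal{M}$. *)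

(* Defs.v *)
From Stdlib Require Export Reals.
From Coquelicot Require Export Coquelicot.

#[global] Open Scope R_scope.

(** Throughout, functions on [0,1] are total functions [R -> C] whose values
    outside [0,1] are never used.  Linear structure over [C] uses
    [C_AbsRing]; derivatives and integrals of functions of a real variable use
    the real normed space [C_R_CompleteNormedModule] on the same carrier. *)

Section ProdComplete.
Context {K : AbsRing} (U V : CompleteNormedModule K).

Definition prod_lim (F : (U * V -> Prop) -> Prop) : U * V :=
  (lim (filtermap fst F), lim (filtermap snd F)).

Lemma prod_lim_cauchy (F : (U * V -> Prop) -> Prop) :
  ProperFilter F -> cauchy F -> forall eps : posreal, F (ball (prod_lim F) eps).
Proof.
intros HF Hc eps.
apply filter_and.
- apply (complete_cauchy (filtermap fst F) (filtermap_proper_filter _ _ fst F HF)).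
  intros e. destruct (Hc e) as [x Hx]. exists (fst x).
  revert Hx. unfold filtermap. apply filter_imp. intros y Hy. apply Hy.
- apply (complete_cauchy (filtermap snd F) (filtermap_proper_filter _ _ snd F HF)).
  intros e. destruct (Hc e) as [x Hx]. exists (snd x).
  revert Hx. unfold filtermap. apply filter_imp. intros y Hy. apply Hy.
Qed.

Lemma prod_lim_close (F1 F2 : (U * V -> Prop) -> Prop) :
  filter_le F1 F2 -> filter_le F2 F1 -> close (prod_lim F1) (prod_lim F2).
Proof.
intros H12 H21 eps. split.
- apply (close_lim (filtermap fst F1) (filtermap fst F2));
    intros P HP; [ apply H12 | apply H21 ]; exact HP.
- apply (close_lim (filtermap snd F1) (filtermap snd F2));
    intros P HP; [ apply H12 | apply H21 ]; exact HP.
Qed.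

Definition prod_CompleteSpace_mixin :=
  CompleteSpace.Mixin (prod_UniformSpace U V) prod_lim prod_lim_cauchy prod_lim_close.

Definition prod_CompleteNormedModule : CompleteNormedModule K :=
  CompleteNormedModule.Pack K (U * V)
    (CompleteNormedModule.Class K (U * V)
       (NormedModule.class K (prod_NormedModule K U V)) prod_CompleteSpace_mixin)
    (U * V).

End ProdComplete.

Canonical prod_CompleteNormedModule.

Section RestrictScalars.
Variable V : CompleteNormedModule C_AbsRing.

Definition rscal (a : R) (x : V) : V := scal (RtoC a : C_AbsRing) x.

Lemma rscal_assoc (x y : R_Ring) (u : V) : rscal x (rscal y u) = rscal (mult x y) u.
Proof.
unfold rscal. rewrite scal_assoc. f_equal.
exact (eq_sym (RtoC_mult x y)).
Qed.

Lemma rscal_one (u : V) : rscal one u = u.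
Proof. exact (scal_one u). Qed.

Lemma rscal_distr_l (x : R_Ring) (u v : V) :
  rscal x (plus u v) = plus (rscal x u) (rscal x v).
Proof. exact (scal_distr_l (RtoC x : C_AbsRing) u v). Qed.

Lemma rscal_distr_r (x y : R_Ring) (u : V) :
  rscal (plus x y) u = plus (rscal x u) (rscal y u).
Proof.
refine (eq_trans _ (scal_distr_r (RtoC x : C_AbsRing) (RtoC y) u)).
unfold rscal. f_equal. exact (RtoC_plus x y).
Qed.

Definition rscal_ModuleSpace_mixin :=
  ModuleSpace.Mixin R_Ring V rscal rscal_assoc rscal_one rscal_distr_l rscal_distr_r.

Definition rscal_NormedModuleAux : NormedModuleAux R_AbsRing :=
  NormedModuleAux.Pack R_AbsRing V
    (NormedModuleAux.Class R_AbsRing V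
       (ModuleSpace.Class R_Ring V (AbelianGroup.class V) rscal_ModuleSpace_mixin)
       (UniformSpace.class V)) V.

Lemma rscal_norm (a : R_AbsRing) (x : V) : norm (rscal a x) <= abs a * norm x.
Proof.
refine (Rle_trans _ _ _ (norm_scal (RtoC a : C_AbsRing) x) _).
apply Req_le. apply (f_equal (fun b => b * norm x)). exact (Cmod_R a).
Qed.

Definition rscal_NormedModule_mixin : NormedModule.mixin_of R_AbsRing rscal_NormedModuleAux :=
  NormedModule.Mixin R_AbsRing rscal_NormedModuleAux (@norm C_AbsRing V)
    (@norm_factor C_AbsRing V) (@norm_triangle C_AbsRing V) rscal_norm
    (@norm_compat1 C_AbsRing V) (@norm_compat2 C_AbsRing V) (@norm_eq_zero C_AbsRing V).

(** [V] as a real Banach space, needed to integrate [V]-valued functions of a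
    real variable with [RInt]. *)
Definition restrict_scalars : CompleteNormedModule R_AbsRing :=
  CompleteNormedModule.Pack R_AbsRing V
    (CompleteNormedModule.Class R_AbsRing V
       (NormedModule.Class R_AbsRing V
          (NormedModuleAux.class R_AbsRing rscal_NormedModuleAux)
          rscal_NormedModule_mixin)
       (CompleteSpace.class V)) V.

End RestrictScalars.

Section Operators.
Context {V : CompleteNormedModule C_AbsRing}.

Definition operator := V -> V -> Prop.

Definition op_closure (A : operator) : operator := fun x y =>
  forall eps : posreal, exists x' y', A x' y' /\ ball x eps x' /\ ball y eps y'.

(** [A + B] with domain that of [A], for an everywhere defined [B]. *)
Definition op_perturb (A : operator) (B : V -> V) : operator := fun x y =>
  exists z, A x z /\ y = plus z (B x).

Definition op_shift (lambda : C) (A : operator) : operator := fun x y =>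
  exists z, A x z /\ y = minus (scal (lambda : C_AbsRing) x) z.

Definition op_restrict (A : operator) (M : V -> Prop) : operator := fun x y =>
  M x /\ A x y.

Fixpoint op_pow (A : operator) (m : nat) : operator :=
  match m with
  | O => fun x y => x = y
  | S k => fun x y => exists z, A x z /\ op_pow A k z y
  end.

Definition op_ker (A : operator) : V -> Prop := fun x => A x zero.

Definition eigenvalue (A : operator) (lambda : C) : Prop :=
  exists x : V, x <> zero /\ A x (scal (lambda : C_AbsRing) x).

(** [is_linear] includes boundedness. *)
Definition resolvent_set (A : operator) (lambda : C) : Prop :=
  exists T : V -> V, is_linear T /\ forall x y, op_shift lambda A x y <-> x = T y.

(** Meaningful for [lambda] in the resolvent set. *)
Definition resolvent (A : operator) (lambda : C) (f : V) : V :=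
  iota (fun x => op_shift lambda A x f).

Definition circle_integral (F : C -> V) (c : C) (r : R) : V :=
  RInt (V := restrict_scalars V)
    (fun t => scal ((Ci * RtoC r * (cos t, sin t))%C : C_AbsRing)
                (F (c + RtoC r * (cos t, sin t))%C))
    0 (2 * PI).

Definition riesz_projection (A : operator) (c : C) (r : R) (f : V) : V :=
  scal ((/ (2 * RtoC PI * Ci))%C : C_AbsRing)
    (circle_integral (fun lambda => resolvent A lambda f) c r).

Definition range (T : V -> V) : V -> Prop := fun y => exists x, y = T x.

Definition span1 (g : V) : V -> Prop := fun x =>
  exists c : C, x = scal (c : C_AbsRing) g.

Definition has_dim (M : V -> Prop) (n : nat) : Prop :=
  exists b : nat -> V,
    (forall c : nat -> C,
       sum_n_m (fun i => scal (c i : C_AbsRing) (b i)) 1 n = zero ->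
       forall i, (1 <= i <= n)%nat -> c i = RtoC 0) /\
    (forall x, M x <->
       exists c : nat -> C, x = sum_n_m (fun i => scal (c i : C_AbsRing) (b i)) 1 n).

End Operators.

Arguments operator V : clear implicits.

Definition I01 (x : R) : Prop := 0 <= x <= 1.

(** One-sided at the end points. *)
Definition is_deriv01 (u : R -> C) (x : R) (l : C) : Prop :=
  filterdiff (K := R_AbsRing) (U := R_NormedModule) (V := C_R_NormedModule)
    u (within I01 (locally x))
    (fun h : R => scal (V := C_R_NormedModule) h (l : C_R_NormedModule)).

Definition deriv01 (u : R -> C) (x : R) : C :=
  iota (T := C_R_CompleteNormedModule) (is_deriv01 u x).

Fixpoint Ck01 (k : nat) (u : R -> C) : Prop :=
  match k with
  | O => continuous_on I01 u
  | S k => (forall x, I01 x -> exists l, is_deriv01 u x l) /\ Ck01 k (deriv01 u)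
  end.

Definition CRInt (f : R -> C) (a b : R) : C :=
  RInt (V := C_R_CompleteNormedModule) f a b.

Definition preH1 (u : R -> C) : Prop :=
  Ck01 2 u /\ u 0 = RtoC 0 /\ deriv01 u 0 = RtoC 0.

Definition preH2 (u : R -> C) : Prop := Ck01 1 u /\ u 0 = RtoC 0.

Definition ip1 (u v : R -> C) : C :=
  CRInt (fun rho => (deriv01 u rho * Cconj (deriv01 v rho) / RtoC (rho ^ 2))%C) 0 1.

Definition ip2 (u v : R -> C) : C :=
  CRInt (fun rho => (deriv01 u rho * Cconj (deriv01 v rho))%C) 0 1.

(** [H], with the embedding [i], is the completion of the space [D] for the norm
    induced by [ip].  The inner product of [H] is the one determined by the
    norm.  The values of [i] outside [D] are irrelevant. *)
Record is_completion (D : (R -> C) -> Prop) (ip : (R -> C) -> (R -> C) -> C)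
    (H : CompleteNormedModule C_AbsRing) (i : (R -> C) -> H) : Prop := {
  completion_plus : forall u v, D u -> D v ->
    i (fun rho => (u rho + v rho)%C) = plus (i u) (i v);
  completion_scal : forall (c : C) u, D u ->
    i (fun rho => (c * u rho)%C) = scal (c : C_AbsRing) (i u);
  completion_norm : forall u, D u -> norm (i u) = sqrt (Re (ip u u));
  completion_dense : forall (x : H) (eps : posreal),
    exists u, D u /\ ball x eps (i u)
}.

Arguments is_completion D ip {H} i.

Definition domL0_1 (u : R -> C) : Prop :=
  Ck01 3 u /\ u 0 = RtoC 0 /\ deriv01 u 0 = RtoC 0 /\
  deriv01 (deriv01 u) 0 = RtoC 0.

Definition domL0_2 (u : R -> C) : Prop := Ck01 3 u /\ u 0 = RtoC 0.

Definition L0_1 (u1 u2 : R -> C) (rho : R) : C :=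
  (- RtoC rho * deriv01 u1 rho + u1 rho + RtoC rho * deriv01 u2 rho - u2 rho)%C.

(** At [rho = 0] the first term is [0], since [deriv01 u1 0 = 0] on the domain;
    this is also its limit there. *)
Definition L0_2 (u1 u2 : R -> C) (rho : R) : C :=
  (/ RtoC rho * deriv01 u1 rho - RtoC rho * deriv01 u2 rho)%C.

Definition V1 (rho : R) : R := - 16 / (1 + rho ^ 2) ^ 2.

Definition Lprime_1 (u2 : R -> C) (rho : R) : C :=
  (- RtoC (V1 rho) * CRInt (fun s => RtoC s * u2 s) 0 rho)%C.

Definition g1 (rho : R) : C := RtoC (2 * rho ^ 3 / (1 + rho ^ 2) ^ 2).

Definition g2 (rho : R) : C := RtoC (rho * (3 + rho ^ 2) / (1 + rho ^ 2) ^ 2).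

Section WaveOperators.
Context {H1 H2 : CompleteNormedModule C_AbsRing}.
Variables (i1 : (R -> C) -> H1) (i2 : (R -> C) -> H2).

(** [H1 * H2] carries Coquelicot's product norm, which is the Hilbert one,
    [sqrt (norm x1 ^ 2 + norm x2 ^ 2)]. *)
Let HH : CompleteNormedModule C_AbsRing := prod_CompleteNormedModule H1 H2.

Definition embed (u1 u2 : R -> C) : HH := (i1 u1, i2 u2).

Definition L0_tilde : operator HH := fun x y =>
  exists u1 u2, domL0_1 u1 /\ domL0_2 u2 /\
    x = embed u1 u2 /\ y = embed (L0_1 u1 u2) (L0_2 u1 u2).

Definition L0 : operator HH := op_closure L0_tilde.

(** [L'] is the bounded extension to the completion of the given formula. *)
Definition is_Lprime (L' : HH -> HH) : Prop :=
  is_linear L' /\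
  forall u1 u2, preH1 u1 -> preH2 u2 ->
    L' (embed u1 u2) = embed (Lprime_1 u2) (fun _ => RtoC 0).

Definition L_op (L' : HH -> HH) : operator HH := op_perturb L0 L'.

Definition gauge_mode : HH := embed g1 g2.

End WaveOperators.

(* Main.v *)
Require Import Defs.
From Stdlib Require Import Lra Lia List ClassicalEpsilon.

(** In the variables [a = u1' / rho], [b = u2'] the norm of [H1 * H2] is that of [L^2(0,1)^2].
    Put [(f1, f2) = (1 - L) u] and [Psi = \int_0^rho s u2(s) ds].  Then
      [- (((1 - rho^2) / rho^2) Psi')' + V1 Psi / rho^2 = (f1 + rho^2 f2) / rho^2],
    a Sturm-Liouville equation solved, for [f = 0], by the function [rho^3 / (1 + rho^2)] that
    belongs to the gauge mode [g].  Two facts follow.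

    Solvability: the functional [l(f) = \int_0^1 (f1 + rho^2 f2) rho / (1 + rho^2) drho] vanishes
    on the range of [1 - L], while [l(g) > 0].

    Coercivity: reduction of order bounds [Psi] and [u2], after subtraction of a multiple of [g],
    by [f]; hence [L' u] is bounded by [f], and accretivity of [1 - L0] gives
    [||u|| <= K ||(1 - L) u||] on the kernel of [l].

    By the second fact the resolvent applied to [f] in the kernel of [l] stays bounded near [1],
    so its contour integral is the limit of integrals over shrinking circles, which is [0]; and
    [(lambda - L)^-1 g = (lambda - 1)^-1 g].  So the Riesz projection is [f |-> l(f) / l(g) g]. *)

(** * Linear combinations of vectors *)

(** The space [M] is not known in advance to be finite-dimensional, so excluding Jordan chains above
    [g] would not bound its dimension. The explicit projection settles chains, span and multiplicity
    together. With [Psi] as unknown the nonlocal term of [L'] becomes local, and [f1 + rho^2 f2] is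
    the combination of the two equations from which [u1] drops out. Its leading coefficient carries
    the factor [1 - rho^2], so the Wronskian identity has no boundary term at [rho = 1]; this
    produces the single solvability condition. The coefficients of [L] are real, so the estimates
    are made for real functions and applied to real and imaginary parts separately. Elements in the
    domain of the closure [L0] are available only as limits. Each fact is therefore proved on the
    core, either as a homogeneous norm inequality or as an equation for a bounded functional, and
    both forms survive limits. The equation [L g = g] also comes from a vanishing norm, because the
    embeddings into the completions are not assumed to respect equality on [0,1]. Circles of
    different radii are compared by the resolvent identity alone, without differentiating a
    vector-valued integral. *)

Section VectorReflection.
Context {V : ModuleSpace C_AbsRing}.

Inductive vexpr : Type :=
  | VZero | VVar (n : nat) | VAdd (a b : vexpr) | VOpp (a : vexpr) | VScal (k : C) (a : vexpr).

Fixpoint veval (l : list V) (e : vexpr) : V :=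
  match e with
  | VZero => zero
  | VVar n => nth n l zero
  | VAdd a b => plus (veval l a) (veval l b)
  | VOpp a => opp (veval l a)
  | VScal k a => scal (k : C_AbsRing) (veval l a)
  end.

Fixpoint vcoef (e : vexpr) (i : nat) : C :=
  match e with
  | VZero => RtoC 0
  | VVar n => if Nat.eqb n i then RtoC 1 else RtoC 0
  | VAdd a b => Cplus (vcoef a i) (vcoef b i)
  | VOpp a => Copp (vcoef a i)
  | VScal k a => Cmult k (vcoef a i)
  end.

Fixpoint lincomb (l : list V) (k : nat -> C) : V :=
  match l with
  | nil => zero
  | cons v l' => plus (scal (k O : C_AbsRing) v) (lincomb l' (fun i => k (S i)))
  end.

Lemma lincomb_ext l : forall k k', (forall i, k i = k' i) -> lincomb l k = lincomb l k'.
Proof.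
induction l as [|v l IH]; intros k k' H; simpl; [reflexivity|].
now rewrite (H O), (IH _ (fun i => k' (S i)) (fun i => H (S i))).
Qed.

Lemma lincomb_zero l : lincomb l (fun _ => RtoC 0) = zero.
Proof.
induction l as [|v l IH]; simpl; [reflexivity|].
rewrite IH, plus_zero_r. exact (scal_zero_l v).
Qed.

Lemma lincomb_plus l : forall k k',
  lincomb l (fun i => Cplus (k i) (k' i)) = plus (lincomb l k) (lincomb l k').
Proof.
induction l as [|v l IH]; intros k k'; simpl; [now rewrite plus_zero_l|].
rewrite (IH (fun i => k (S i)) (fun i => k' (S i))).
assert (E : scal (Cplus (k O) (k' O) : C_AbsRing) v
  = plus (scal (k O : C_AbsRing) v) (scal (k' O : C_AbsRing) v))
  by exact (scal_distr_r _ _ _).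
rewrite E, <- !plus_assoc.
f_equal. rewrite !plus_assoc. f_equal. apply plus_comm.
Qed.

Lemma lincomb_scal l : forall (c : C) k,
  lincomb l (fun i => Cmult c (k i)) = scal (c : C_AbsRing) (lincomb l k).
Proof.
induction l as [|v l IH]; intros c k; simpl; [now rewrite scal_zero_r|].
rewrite (IH c (fun i => k (S i))), scal_distr_l, scal_assoc. reflexivity.
Qed.

Lemma lincomb_var l : forall n,
  lincomb l (fun i => if Nat.eqb n i then RtoC 1 else RtoC 0) = nth n l zero.
Proof.
induction l as [|v l IH]; intros [|n]; simpl; try reflexivity.
- rewrite lincomb_zero, plus_zero_r. exact (scal_one v).
- rewrite IH. transitivity (plus zero (nth n l zero)); [|apply plus_zero_l].
  f_equal. exact (scal_zero_l v).
Qed.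

Lemma veval_lincomb l e : veval l e = lincomb l (vcoef e).
Proof.
induction e as [|n|a IHa b IHb|a IHa|k a IHa]; simpl.
- now rewrite lincomb_zero.
- now rewrite lincomb_var.
- now rewrite lincomb_plus, IHa, IHb.
- rewrite IHa, <- scal_opp_one.
  transitivity (lincomb l (fun i => Cmult (Copp (RtoC 1)) (vcoef a i))).
  + rewrite lincomb_scal. reflexivity.
  + apply lincomb_ext. intros i. ring.
- now rewrite lincomb_scal, IHa.
Qed.

Fixpoint coef_eq_upto (n : nat) (e e' : vexpr) : Prop :=
  match n with
  | O => True
  | S m => vcoef e m = vcoef e' m /\ coef_eq_upto m e e'
  end.

Lemma lincomb_ext_upto l : forall k k',
  (forall i, (i < length l)%nat -> k i = k' i) -> lincomb l k = lincomb l k'.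
Proof.
induction l as [|v l IH]; intros k k' H; simpl; [reflexivity|].
rewrite (H O), (IH _ (fun i => k' (S i))); [reflexivity| |simpl; lia].
intros i Hi. apply H. simpl. lia.
Qed.

(** Comparing coefficients below [length l] turns a vector identity into finitely many identities in
    [C]. These are left to [ring], or to [field] when inverse scalars occur. *)
Lemma veval_eq l e e' : coef_eq_upto (length l) e e' -> veval l e = veval l e'.
Proof.
intros H. rewrite !veval_lincomb. apply lincomb_ext_upto.
induction (length l) as [|n IH]; [lia|].
destruct H as [H0 H]. intros i Hi.
destruct (Nat.eq_dec i n) as [->|Hn]; [exact H0|]. apply IH; [exact H|lia].
Qed.

End VectorReflection.

Ltac vindex x l :=
  lazymatch l with
  | cons x _ => constr:(O)
  | cons _ ?l' => let n := vindex x l' in constr:(S n)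
  end.

Ltac vmem x l :=
  lazymatch l with
  | cons x _ => constr:(true)
  | cons _ ?l' => vmem x l'
  | nil => constr:(false)
  end.

Ltac vatoms e l :=
  lazymatch e with
  | zero => l
  | plus ?a ?b => let l1 := vatoms a l in vatoms b l1
  | minus ?a ?b => let l1 := vatoms a l in vatoms b l1
  | opp ?a => vatoms a l
  | scal _ ?a => vatoms a l
  | ?x => lazymatch vmem x l with true => l | false => constr:(cons x l) end
  end.

Ltac vreify e l :=
  lazymatch e with
  | zero => constr:(VZero)
  | plus ?a ?b => let p := vreify a l in let q := vreify b l in constr:(VAdd p q)
  | minus ?a ?b => let p := vreify a l in let q := vreify b l in constr:(VAdd p (VOpp q))
  | opp ?a => let p := vreify a l in constr:(VOpp p)
  | scal ?k ?a => let p := vreify a l in constr:(VScal k p)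
  | ?x => let n := vindex x l in constr:(VVar n)
  end.

Ltac vring_with V tac :=
  lazymatch goal with
  | |- ?a = ?b =>
      let l0 := constr:(@nil (ModuleSpace.sort _ (NormedModule.ModuleSpace C_AbsRing V))) in
      let l1 := vatoms a l0 in let l := vatoms b l1 in
      let p := vreify a l in let q := vreify b l in
      refine (@veval_eq (NormedModule.ModuleSpace C_AbsRing V) l p q _);
      cbn [length coef_eq_upto vcoef Nat.eqb]; repeat split; tac
  end.
Ltac vring V := vring_with V ltac:(ring).

(** * Resolvents and contour integrals *)

Section BanachNorm.
Context {V : CompleteNormedModule C_AbsRing}.
Implicit Types x y : V.

Lemma Cnorm_scal (k : C) x : norm (scal (k : C_AbsRing) x) <= Cmod k * norm x.
Proof. exact (norm_scal (k : C_AbsRing) x). Qed.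

Lemma norm_plus_le x y : norm (plus x y) <= norm x + norm y.
Proof. exact (norm_triangle x y). Qed.

Lemma norm_minus_le x y : norm (minus x y) <= norm x + norm y.
Proof.
refine (Rle_trans _ _ _ (norm_plus_le x (opp y)) _).
apply Rplus_le_compat_l, Req_le. exact (norm_opp y).
Qed.

End BanachNorm.

Section Resolvent.
Context {V : CompleteNormedModule C_AbsRing} (A : operator V).

Lemma resolvent_spec (z : C) : resolvent_set A z ->
  is_linear (resolvent A z) /\ forall x y, op_shift z A x y <-> x = resolvent A z y.
Proof.
intros [T [HT HA]].
assert (E : forall y, resolvent A z y = T y).
{ intros y. apply iota_unique.
  - intros x Hx. now apply HA.
  - now apply HA. }
split.
- split.
  + intros x y. rewrite !E. apply (linear_plus T HT).
  + intros k x. rewrite !E. apply (linear_scal T HT).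
  + destruct (linear_norm T HT) as [M [HM H]]. exists M. split; [exact HM|].
    intros x. rewrite E. apply H.
- intros x y. rewrite E. apply HA.
Qed.

Lemma resolvent_identity (z w : C) (f : V) : resolvent_set A z -> resolvent_set A w ->
  resolvent A w f =
    minus (resolvent A z f) (scal ((w - z)%C : C_AbsRing) (resolvent A w (resolvent A z f))).
Proof.
intros Hz Hw.
destruct (resolvent_spec z Hz) as [_ Sz]. destruct (resolvent_spec w Hw) as [Lw Sw].
set (x := resolvent A z f).
destruct (proj2 (Sz x f) eq_refl) as [y [Hy Ef]].
assert (E : x = resolvent A w (plus f (scal ((w - z)%C : C_AbsRing) x))).
{ apply Sw. exists y. split; [exact Hy|]. rewrite Ef. vring V. }
rewrite (linear_plus _ Lw), (linear_scal _ Lw) in E.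
rewrite E at 1. vring V.
Qed.

(** The resolvent identity bounds the norm of [resolvent A w f] by [M * norm f] plus at most half of
    itself once [Cmod (w - z) <= 1 / (2 M)]. The resulting bound is uniform in [w], although the
    operator norm at [w] is not controlled beforehand. *)
Lemma resolvent_locally_bounded (z : C) : resolvent_set A z ->
  exists K, 0 < K /\ forall w, resolvent_set A w -> Cmod (w - z)%C * K <= 1 ->
    forall f, norm (resolvent A w f) <= K * norm f.
Proof.
intros Hz. destruct (resolvent_spec z Hz) as [Lz _].
destruct (linear_norm _ Lz) as [M [HM HMb]].
exists (2 * M). split; [lra|]. intros w Hw Hd f.
pose proof (resolvent_identity w z f Hw Hz) as E.
assert (E' : resolvent A w f =
  plus (resolvent A z f) (scal ((z - w)%C : C_AbsRing) (resolvent A z (resolvent A w f)))).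
{ rewrite E. vring V. }
set (x := resolvent A w f) in *.
assert (H1 : norm x <= M * norm f + Cmod (z - w)%C * (M * norm x)).
{ rewrite E' at 1. eapply Rle_trans; [apply norm_plus_le|].
  apply Rplus_le_compat; [apply HMb|].
  eapply Rle_trans; [apply Cnorm_scal|].
  apply Rmult_le_compat_l; [apply Cmod_ge_0|apply HMb]. }
replace (Cmod (z - w)%C) with (Cmod (w - z)%C) in H1
  by (rewrite <- Cmod_opp; f_equal; ring).
pose proof (norm_ge_0 x). nra.
Qed.

End Resolvent.

(** * Circles in polar coordinates and integrals over a period *)

Definition circle_pt (c : C) (s t : R) : C := (c + RtoC s * (cos t, sin t))%C.

Lemma Cmod_unit (t : R) : Cmod (cos t, sin t) = 1.
Proof.
unfold Cmod; simpl. transitivity (sqrt 1); [f_equal|apply sqrt_1].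
pose proof (sin2_cos2 t). unfold Rsqr in *. nra.
Qed.

Lemma circle_pt_dist (c : C) (s t : R) : Cmod (circle_pt c s t - c)%C = Rabs s.
Proof.
unfold circle_pt. replace (c + RtoC s * (cos t, sin t) - c)%C
  with (RtoC s * (cos t, sin t))%C by ring.
now rewrite Cmod_mult, Cmod_unit, Cmod_R, Rmult_1_r.
Qed.

Lemma sin_1_lipschitz (t t' : R) : Rabs (sin t' - sin t) <= Rabs (t' - t).
Proof.
destruct (MVT_gen sin t t' cos) as [x [_ E]].
- intros x _. apply is_derive_Reals, derivable_pt_lim_sin.
- intros x _. apply continuity_sin.
- rewrite E, Rabs_mult. rewrite <- (Rmult_1_l (Rabs (t' - t))) at 2.
  apply Rmult_le_compat_r; [apply Rabs_pos|]. apply Rabs_le, COS_bound.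
Qed.

Lemma cos_1_lipschitz (t t' : R) : Rabs (cos t' - cos t) <= Rabs (t' - t).
Proof.
rewrite <- !sin_shift, (Rabs_minus_sym t').
replace (t - t') with ((PI / 2 - t') - (PI / 2 - t)) by ring.
apply sin_1_lipschitz.
Qed.

Lemma Cmod_le_Rabs (z : C) : Cmod z <= Rabs (fst z) + Rabs (snd z).
Proof.
destruct z as [a b].
assert (E0 : (a, b) = (RtoC a + RtoC b * Ci)%C)
  by (apply injective_projections; simpl; ring).
simpl fst. simpl snd. rewrite E0.
eapply Rle_trans; [apply Cmod_triangle|].
assert (E : Cmod Ci = 1).
{ unfold Cmod, Ci; simpl. transitivity (sqrt 1); [f_equal; ring|apply sqrt_1]. }
rewrite Cmod_mult, !Cmod_R, E. lra.
Qed.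

Lemma circle_pt_lipschitz (c : C) (s s' t t' : R) :
  Cmod (circle_pt c s' t' - circle_pt c s t)%C <= Rabs (s' - s) + 2 * Rabs s * Rabs (t' - t).
Proof.
unfold circle_pt.
replace (c + RtoC s' * (cos t', sin t') - (c + RtoC s * (cos t, sin t)))%C
  with (RtoC (s' - s) * (cos t', sin t') + RtoC s * ((cos t' - cos t)%R, (sin t' - sin t)%R))%C
  by (destruct c; apply injective_projections; simpl; ring).
eapply Rle_trans; [apply Cmod_triangle|]. rewrite !Cmod_mult, Cmod_unit, !Cmod_R.
pose proof (Cmod_le_Rabs (cos t' - cos t, sin t' - sin t)) as H. simpl in H.
pose proof (sin_1_lipschitz t t'). pose proof (cos_1_lipschitz t t').
pose proof (Rabs_pos s). nra.
Qed.

Lemma is_RInt_shift {W : NormedModule R_AbsRing} (h : R -> W) (a b theta : R) (l : W) :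
  is_RInt h (a + theta) (b + theta) l -> is_RInt (fun t => h (t + theta)) a b l.
Proof.
intros H. apply (is_RInt_ext (fun t => scal 1 (h (1 * t + theta)))).
- intros t _. rewrite Rmult_1_l. exact (scal_one (h (t + theta))).
- apply is_RInt_comp_lin. now rewrite !Rmult_1_l.
Qed.

Lemma is_RInt_periodic_shift {W : CompleteNormedModule R_AbsRing} (h : R -> W) (T theta : R) :
  (forall t, continuous h t) -> (forall t, h (t + T) = h t) ->
  is_RInt (fun t => h (t + theta)) 0 T (RInt h 0 T).
Proof.
intros Hc Hp.
assert (Hex : forall a b, ex_RInt h a b) by (intros; apply ex_RInt_continuous; auto).
apply is_RInt_shift. rewrite Rplus_0_l.
assert (E : RInt h T (T + theta) = RInt h 0 theta).
{ symmetry. apply is_RInt_unique. apply (is_RInt_ext (fun t => h (t + T))); [auto|].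
  apply is_RInt_shift. rewrite Rplus_0_l, (Rplus_comm theta). apply RInt_correct, Hex. }
assert (E' : RInt h theta (T + theta) = RInt h 0 T).
{ rewrite <- (RInt_Chasles h theta T (T + theta)) by apply Hex.
  rewrite E, plus_comm, RInt_Chasles by apply Hex. reflexivity. }
rewrite <- E'. apply RInt_correct, Hex.
Qed.

(** Over [N] equal steps the increments add up to at most [k (b - a)^2 / N], which tends to [0].
    This stands in for a vanishing derivative of [G]. *)
Lemma constant_of_quadratic_modulus {K : AbsRing} {W : NormedModule K} (G : R -> W) (a b k : R) :
  a <= b -> 0 <= k ->
  (forall x y, a <= x -> x <= y -> y <= b ->
     norm (minus (G y) (G x)) <= k * ((y - x) * (y - x))) ->
  G b = G a.
Proof.
intros Hab Hk H.
assert (Hn : forall n : nat, norm (minus (G b) (G a)) <= k * ((b - a) * (b - a)) * / INR (S n)).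
{ intros n. set (N := INR (S n)).
  assert (HN : 0 < N) by (apply lt_0_INR; lia).
  set (d := (b - a) / N).
  assert (Hd : 0 <= d) by (apply Rdiv_le_0_compat; lra).
  assert (Hm : forall m, (m <= S n)%nat ->
    norm (minus (G (a + INR m * d)) (G a)) <= INR m * (k * (d * d))).
  { induction m as [|m IH]; intros Hm.
    - simpl. rewrite !Rmult_0_l, Rplus_0_r.
      replace (minus (G a) (G a)) with (@zero W) by (symmetry; exact (plus_opp_r (G a))).
      apply Req_le. exact norm_zero.
    - assert (Hle : INR (S m) * d <= b - a).
      { replace (b - a) with (N * d) by (unfold d; field; lra).
        apply Rmult_le_compat_r; [exact Hd|]. now apply le_INR. }
      assert (Hm0 : 0 <= INR m * d) by (apply Rmult_le_pos; [apply pos_INR|lra]).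
      rewrite S_INR in *.
      replace (minus (G (a + (INR m + 1) * d)) (G a)) with
        (plus (minus (G (a + (INR m + 1) * d)) (G (a + INR m * d)))
              (minus (G (a + INR m * d)) (G a))).
      2:{ unfold minus. rewrite <- plus_assoc. f_equal. rewrite plus_assoc, plus_opp_l.
          apply plus_zero_l. }
      eapply Rle_trans; [apply norm_triangle|].
      replace ((INR m + 1) * (k * (d * d))) with (k * (d * d) + INR m * (k * (d * d))) by ring.
      apply Rplus_le_compat; [|apply IH; lia].
      eapply Rle_trans; [apply H; lra|]. apply Req_le. ring. }
  specialize (Hm (S n) (le_n _)). fold N in Hm.
  replace (a + N * d) with b in Hm by (unfold d; field; lra).
  eapply Rle_trans; [exact Hm|]. apply Req_le. unfold d. field. lra. }
assert (H0 : norm (minus (G b) (G a)) = 0).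
{ apply Rle_antisym; [|apply norm_ge_0].
  apply (is_lim_seq_le (fun _ => norm (minus (G b) (G a)))
    (fun n => k * ((b - a) * (b - a)) * / INR (S n)) (Finite _) (Finite 0) Hn).
  - apply is_lim_seq_const.
  - replace (Finite 0) with (Rbar_mult (k * ((b - a) * (b - a))) 0)
      by (simpl; f_equal; ring).
    apply is_lim_seq_scal_l.
    apply (is_lim_seq_incr_1 (fun n => / INR n)).
    apply (is_lim_seq_inv INR p_infty); [apply is_lim_seq_INR|discriminate]. }
apply norm_eq_zero in H0.
replace (G b) with (plus (minus (G b) (G a)) (G a)).
- rewrite H0. apply plus_zero_l.
- unfold minus. rewrite <- plus_assoc, plus_opp_l. apply plus_zero_r.
Qed.

(** Together with [cos_minus_1_le] this makes [exp (i x) - 1 - i x] of second order, which is all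
    that the comparison of circles requires. *)
Lemma sin_minus_id_le (x : R) : Rabs (sin x - x) <= x * x.
Proof.
destruct (MVT_gen (fun x => sin x - x) 0 x (fun x => cos x - 1)) as [y [Hy E]].
- intros y _. auto_derive; [exact I|ring].
- intros y _. apply continuity_pt_minus; [apply continuity_sin|apply continuity_pt_id].
- rewrite sin_0, Rminus_diag, !Rminus_0_r in E. rewrite E, Rabs_mult.
  pose proof (cos_1_lipschitz 0 y) as L. rewrite cos_0, Rminus_0_r in L.
  replace (x * x) with (Rabs x * Rabs x) by (rewrite <- Rabs_mult, Rabs_right; nra).
  apply Rmult_le_compat_r; [apply Rabs_pos|]. eapply Rle_trans; [exact L|].
  unfold Rmin, Rmax in Hy. destruct (Rle_dec 0 x).
  + rewrite !Rabs_right; lra.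
  + rewrite !Rabs_left1; lra.
Qed.

Lemma cos_minus_1_le (x : R) : Rabs (cos x - 1) <= x * x.
Proof.
destruct (MVT_gen cos 0 x (fun x => - sin x)) as [y [Hy E]].
- intros y _. auto_derive; [exact I|ring].
- intros y _. apply continuity_cos.
- rewrite cos_0, Rminus_0_r in E. rewrite E, Rabs_mult, Rabs_Ropp.
  pose proof (sin_1_lipschitz 0 y) as L. rewrite sin_0, !Rminus_0_r in L.
  replace (x * x) with (Rabs x * Rabs x) by (rewrite <- Rabs_mult, Rabs_right; nra).
  apply Rmult_le_compat_r; [apply Rabs_pos|]. eapply Rle_trans; [exact L|].
  unfold Rmin, Rmax in Hy. destruct (Rle_dec 0 x).
  + rewrite !Rabs_right; lra.
  + rewrite !Rabs_left1; lra.
Qed.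

Lemma is_RInt_linear {U W : NormedModule R_AbsRing} (l : U -> W) (h : R -> U) (a b : R) (I : U) :
  is_linear l -> is_RInt h a b I -> is_RInt (fun t => l (h t)) a b (l I).
Proof.
intros Hl Hh.
assert (E : forall ptd, Riemann_sum (fun t => l (h t)) ptd = l (Riemann_sum h ptd)).
{ intros ptd. apply (SF_cons_ind (fun s => Riemann_sum (fun t => l (h t)) s = l (Riemann_sum h s))).
  - intros x. symmetry. exact (linear_zero l Hl).
  - intros x s IH. rewrite !Riemann_sum_cons, (linear_plus l Hl), (linear_scal l Hl).
    now rewrite IH. }
unfold is_RInt in *.
apply (filterlim_ext (fun ptd => l (scal (sign (b - a)) (Riemann_sum h ptd)))).
- intros ptd. rewrite (linear_scal l Hl), E. reflexivity.
- eapply filterlim_comp; [exact Hh|]. exact (linear_cont l I Hl).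
Qed.

Lemma is_linear_Cscal (V : CompleteNormedModule C_AbsRing) (k : C) :
  is_linear (U := restrict_scalars V) (V := restrict_scalars V)
    (fun x : V => scal (k : C_AbsRing) x).
Proof.
split.
- intros x y. exact (scal_distr_l (k : C_AbsRing) (x : V) y).
- intros a x. change (scal (k : C_AbsRing) (scal (RtoC a : C_AbsRing) (x : V)) =
    scal (RtoC a : C_AbsRing) (scal (k : C_AbsRing) (x : V))).
  vring V.
- exists (Cmod k + 1). pose proof (Cmod_ge_0 k). split; [lra|]. intros x.
  refine (Rle_trans _ _ _ (Cnorm_scal (V := V) k x) _).
  apply Rmult_le_compat_r; [exact (norm_ge_0 (x : V))|lra].
Qed.

(** * The resolvent on a punctured disc *)

Section Annulus.
Context {V : CompleteNormedModule C_AbsRing} (A : operator V) (c : C) (r : R).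
Hypothesis Hres : forall z, Cmod (z - c)%C <= r -> z <> c -> resolvent_set A z.

Lemma circle_pt_resolvent (s t : R) : 0 < s <= r -> resolvent_set A (circle_pt c s t).
Proof.
intros Hs. apply Hres.
- rewrite circle_pt_dist, Rabs_right; lra.
- intros E. pose proof (circle_pt_dist c s t) as H. rewrite E in H.
  replace (c - c)%C with (RtoC 0) in H by ring. rewrite Cmod_0, Rabs_right in H; lra.
Qed.

(** The local bounds of [resolvent_locally_bounded] are made uniform by compactness of the rectangle
    of polar coordinates. *)
Lemma resolvent_bounded_annulus (s0 a b : R) : 0 < s0 ->
  exists K, 0 < K /\ forall s t, s0 <= s <= r -> a <= t <= b ->
    forall f, norm (resolvent A (circle_pt c s t) f) <= K * norm f.
Proof.
intros Hs0.
assert (HK : forall p : R * R, exists K : posreal, s0 <= fst p <= r ->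
   forall w, resolvent_set A w -> Cmod (w - circle_pt c (fst p) (snd p))%C * K <= 1 ->
    forall f, norm (resolvent A w f) <= K * norm f).
{ intros [s t]; simpl. destruct (Rle_dec s0 s) as [H1|H1]; [|exists (mkposreal 1 Rlt_0_1); lra].
  destruct (Rle_dec s r) as [H2|H2]; [|exists (mkposreal 1 Rlt_0_1); lra].
  destruct (resolvent_locally_bounded A (circle_pt c s t)) as [K [HK HKb]].
  { apply circle_pt_resolvent. lra. }
  exists (mkposreal K HK). intros _. exact HKb. }
set (K := fun p => proj1_sig (constructive_indefinite_description _ (HK p))).
pose proof (fun p => proj2_sig (constructive_indefinite_description _ (HK p))) as HKb.
simpl in HKb.
(* Moving both polar coordinates by less than this radius moves the point by at most [/ K (u, v)],
   according to [circle_pt_lipschitz]. *)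
assert (Hm : forall u v : R, 0 < / (K (u, v) * (1 + 2 * Rabs u))).
{ intros u v. apply Rinv_0_lt_compat, Rmult_lt_0_compat; [apply cond_pos|].
  pose proof (Rabs_pos u). lra. }
destruct (compactness_value_2d s0 r a b (fun u v => mkposreal _ (Hm u v))) as [d Hd].
exists (/ d). split; [apply Rinv_0_lt_compat, cond_pos|].
(* [compactness_value_2d] provides the covering point only under a double negation, which a proof by
   contradiction absorbs. *)
intros s t Hs Ht f. apply Rnot_lt_le. intros Hlt.
apply (Hd s t Hs Ht). intros (u & v & H1' & _ & H1 & H2 & H3).
simpl in H1, H2, H3.
pose proof (cond_pos (K (u, v))) as HKp. pose proof (Rabs_pos u) as Hup.
set (k := pos (K (u, v))) in *.
assert (Hkd : k <= / d).
{ apply Rle_trans with (k * (1 + 2 * Rabs u)); [nra|].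
  rewrite <- (Rinv_inv (k * (1 + 2 * Rabs u))). apply Rinv_le_contravar; [apply cond_pos|exact H3]. }
apply (Rlt_irrefl (/ d * norm f)). eapply Rlt_le_trans; [exact Hlt|].
apply Rle_trans with (k * norm f); [|apply Rmult_le_compat_r; [apply norm_ge_0|exact Hkd]].
apply (HKb (u, v)); simpl; [exact H1'|apply circle_pt_resolvent; lra|].
pose proof (circle_pt_lipschitz c u s v t) as HL.
fold k.
assert (Hinv : / (k * (1 + 2 * Rabs u)) * k * (1 + 2 * Rabs u) = 1) by (field; lra).
set (m := / (k * (1 + 2 * Rabs u))) in *.
apply Rle_trans with ((m + 2 * Rabs u * m) * k); [|nra].
apply Rmult_le_compat_r; [lra|].
pose proof (Rabs_pos (t - v)). nra.
Qed.

Section ContourInvariance.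
Variable f : V.

Let R_ z := resolvent A z.
(** On a circle around [c] one has [dz = i (z - c) dt], so [phi] is the contour integrand expressed
    in the angle. *)
Let phi (z : C) : V := scal ((Ci * (z - c))%C : C_AbsRing) (R_ z f).

Lemma weighted_resolvent_lipschitz (K : R) (z w : C) : 0 < K ->
  resolvent_set A z -> resolvent_set A w -> Cmod (w - c)%C <= r ->
  (forall g, norm (R_ z g) <= K * norm g) -> (forall g, norm (R_ w g) <= K * norm g) ->
  norm (minus (phi w) (phi z)) <= Cmod (w - z)%C * ((K + r * K * K) * norm f).
Proof.
intros HK Hz Hw Hr Bz Bw. unfold phi.
pose proof (resolvent_identity A z w f Hz Hw) as E. fold (R_ z) (R_ w) in E.
rewrite E.
replace (minus _ _) with
  (minus (scal ((Ci * (w - z))%C : C_AbsRing) (R_ z f))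
     (scal ((Ci * (w - c) * (w - z))%C : C_AbsRing) (R_ w (R_ z f)))) by vring V.
refine (Rle_trans _ _ _ (norm_minus_le _ _) _).
pose proof (Cnorm_scal (Ci * (w - z))%C (R_ z f)) as H1.
pose proof (Cnorm_scal (Ci * (w - c) * (w - z))%C (R_ w (R_ z f))) as H2.
rewrite Cmod_mult, Cmod_Ci, Rmult_1_l in H1.
rewrite 2!Cmod_mult, Cmod_Ci, Rmult_1_l in H2.
pose proof (Bz f). pose proof (Bw (R_ z f)).
pose proof (norm_ge_0 f). pose proof (norm_ge_0 (R_ z f)).
pose proof (norm_ge_0 (R_ w (R_ z f))).
pose proof (Cmod_ge_0 (w - z)%C). pose proof (Cmod_ge_0 (w - c)%C).
set (d := Cmod (w - z)%C) in *. set (e := Cmod (w - c)%C) in *.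
set (n0 := norm f) in *. set (n1 := norm (R_ z f)) in *. set (n2 := norm (R_ w (R_ z f))) in *.
assert (n2 <= K * K * n0) by nra.
assert (e * d * n2 <= r * d * (K * K * n0)).
{ apply Rmult_le_compat; try nra. }
nra.
Qed.

(* [w1] and [w2] are the radial and the angular neighbour of [z]: the derivative of
   the holomorphic function [phi] along the former is [-i] times that along the latter. *)
Lemma weighted_resolvent_second_order (K eta : R) (z w1 w2 : C) : 0 < K ->
  resolvent_set A z -> resolvent_set A w1 -> resolvent_set A w2 ->
  Cmod (z - c)%C <= r -> Cmod (w1 - c)%C <= r -> Cmod (w2 - c)%C <= r ->
  (forall g, norm (R_ z g) <= K * norm g) ->
  (forall g, norm (R_ w1 g) <= K * norm g) -> (forall g, norm (R_ w2 g) <= K * norm g) ->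
  Cmod (w1 - z)%C <= 2 * eta -> Cmod (w2 - z)%C <= 2 * eta ->
  forall q, Cmod (w1 - z + Ci * (w2 - z))%C <= q * (eta * eta) ->
  norm (plus (minus (phi w1) (phi z)) (scal (Ci : C_AbsRing) (minus (phi w2) (phi z))))
    <= eta * eta * ((q * (K + r * K * K) + 8 * ((r * K + 1) * (K * K))) * norm f).
Proof.
intros HK Hz Hw1 Hw2 Hr0 Hr1 Hr2 Bz B1 B2 D1 D2 q Hq. unfold phi.
set (x := R_ z f). set (y := R_ z x).
(* The resolvent identity, used twice, is the second-order Taylor formula at [z] with an exact
   remainder. *)
assert (E : forall w, resolvent_set A w -> R_ w f =
   plus (minus x (scal ((w - z)%C : C_AbsRing) y))
     (scal (((w - z) * (w - z))%C : C_AbsRing) (R_ w y))).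
{ intros w Hw. unfold R_ at 1. rewrite (resolvent_identity A z w f Hz Hw).
  fold (R_ z) (R_ w). fold x. unfold R_ at 1. rewrite (resolvent_identity A z w x Hz Hw).
  fold (R_ z) (R_ w). fold y. vring V. }
rewrite (E w1 Hw1), (E w2 Hw2).
set (d1 := (w1 - z)%C) in *. set (d2 := (w2 - z)%C) in *.
replace (plus (minus _ _) _) with
  (plus (scal ((d1 + Ci * d2)%C : C_AbsRing)
           (scal (Ci : C_AbsRing) (minus x (scal ((z - c)%C : C_AbsRing) y))))
     (plus (scal ((Ci * (d1 * d1))%C : C_AbsRing)
              (minus (scal ((w1 - c)%C : C_AbsRing) (R_ w1 y)) y))
        (scal ((Ci * Ci * (d2 * d2))%C : C_AbsRing)
              (minus (scal ((w2 - c)%C : C_AbsRing) (R_ w2 y)) y))))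
  by (unfold d1, d2; vring V).
refine (Rle_trans _ _ _ (norm_plus_le _ _) _).
pose proof (norm_ge_0 f) as Nf. set (n := norm f) in *.
assert (Nx : norm x <= K * n) by apply Bz.
assert (Ny : norm y <= K * K * n).
{ refine (Rle_trans _ _ _ (Bz x) _). rewrite Rmult_assoc. apply Rmult_le_compat_l; lra. }
assert (T : forall w, Cmod (w - c)%C <= r -> (forall g, norm (R_ w g) <= K * norm g) ->
  norm (minus (scal ((w - c)%C : C_AbsRing) (R_ w y)) y) <= (r * K + 1) * (K * K) * n).
{ intros w Hr Bw. refine (Rle_trans _ _ _ (norm_minus_le _ _) _).
  apply Rle_trans with (r * (K * (K * K * n)) + K * K * n); [|apply Req_le; ring].
  apply Rplus_le_compat; [|exact Ny].
  refine (Rle_trans _ _ _ (Cnorm_scal _ _) _).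
  apply Rmult_le_compat; [apply Cmod_ge_0|apply norm_ge_0|exact Hr|].
  refine (Rle_trans _ _ _ (Bw y) _). apply Rmult_le_compat_l; lra. }
assert (S : forall (k d : C) (u : V), Cmod k <= 1 -> Cmod d <= 2 * eta ->
  norm u <= (r * K + 1) * (K * K) * n ->
  norm (scal ((k * (d * d))%C : C_AbsRing) u)
    <= 4 * (eta * eta) * ((r * K + 1) * (K * K) * n)).
{ intros k d u Hk Hd Hu. refine (Rle_trans _ _ _ (Cnorm_scal _ _) _).
  apply Rmult_le_compat; [apply Cmod_ge_0|apply norm_ge_0| |exact Hu].
  rewrite !Cmod_mult. pose proof (Cmod_ge_0 k). pose proof (Cmod_ge_0 d).
  assert (Cmod d * Cmod d <= 4 * (eta * eta)) by nra. nra. }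
assert (HC : Cmod Ci <= 1) by (rewrite Cmod_Ci; lra).
apply Rle_trans with (q * (eta * eta) * (K * n + r * (K * K * n)) +
  (4 * (eta * eta) * ((r * K + 1) * (K * K) * n) +
   4 * (eta * eta) * ((r * K + 1) * (K * K) * n))); [|apply Req_le; ring].
apply Rplus_le_compat.
- refine (Rle_trans _ _ _ (Cnorm_scal _ _) _).
  apply Rmult_le_compat; [apply Cmod_ge_0|apply norm_ge_0|exact Hq|].
  refine (Rle_trans _ _ _ (Cnorm_scal _ _) _). rewrite Cmod_Ci, Rmult_1_l.
  refine (Rle_trans _ _ _ (norm_minus_le _ _) _). apply Rplus_le_compat; [exact Nx|].
  refine (Rle_trans _ _ _ (Cnorm_scal _ _) _).
  apply Rmult_le_compat; [apply Cmod_ge_0|apply norm_ge_0|exact Hr0|exact Ny].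
- refine (Rle_trans _ _ _ (norm_plus_le _ _) _). apply Rplus_le_compat.
  + apply S; [exact HC|exact D1|]. now apply T.
  + apply S; [rewrite Cmod_mult, Cmod_Ci; lra|exact D2|]. now apply T.
Qed.

Lemma weighted_resolvent_continuous (s t : R) : 0 < s <= r ->
  continuous (U := restrict_scalars V) (fun t' => phi (circle_pt c s t')) t.
Proof.
intros Hs.
destruct (resolvent_bounded_annulus s (t - 1) (t + 1) (proj1 Hs)) as [K [HK HB]].
set (k := 2 * s * ((K + r * K * K) * norm f)).
assert (Hk : 0 <= k).
{ unfold k. pose proof (norm_ge_0 f).
  assert (0 <= r * K * K) by (apply Rmult_le_pos; nra).
  apply Rmult_le_pos; [lra|]. apply Rmult_le_pos; lra. }
apply filterlim_locally. intros eps.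
assert (Hd : 0 < Rmin 1 (eps / (k + 1))).
{ apply Rmin_glb_lt; [lra|]. apply Rdiv_lt_0_compat; [apply cond_pos|lra]. }
exists (mkposreal _ Hd). intros t' Ht'.
change (Rabs (t' - t) < Rmin 1 (eps / (k + 1))) in Ht'.
pose proof (Rlt_le_trans _ _ _ Ht' (Rmin_l _ _)) as H1.
pose proof (Rlt_le_trans _ _ _ Ht' (Rmin_r _ _)) as H2.
apply Rabs_def2 in H1.
refine (norm_compat1 (V := V) _ _ _ _).
refine (Rle_lt_trans _ _ _ (weighted_resolvent_lipschitz K _ _ HK _ _ _ _ _) _).
- now apply circle_pt_resolvent.
- now apply circle_pt_resolvent.
- rewrite circle_pt_dist, Rabs_right; lra.
- apply HB; lra.
- apply HB; lra.
- apply Rle_lt_trans with (k * Rabs (t' - t)).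
  + pose proof (circle_pt_lipschitz c s s t t') as L.
    rewrite Rminus_diag, Rabs_R0, Rplus_0_l, (Rabs_right s) in L by lra.
    unfold k.
    replace (2 * s * ((K + r * K * K) * norm f) * Rabs (t' - t)) with
      (2 * s * Rabs (t' - t) * ((K + r * K * K) * norm f)) by ring.
    apply Rmult_le_compat_r; [|exact L].
    apply Rmult_le_pos; [|apply norm_ge_0].
    assert (0 <= r * K * K) by (apply Rmult_le_pos; nra). lra.
  + apply Rle_lt_trans with (k * (eps / (k + 1))).
    * apply Rmult_le_compat_l; lra.
    * pose proof (cond_pos eps).
      replace (k * (eps / (k + 1))) with (eps - eps / (k + 1)) by (field; lra).
      assert (0 < eps / (k + 1)) by (apply Rdiv_lt_0_compat; lra). lra.
Qed.

Let G (s : R) : restrict_scalars V :=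
  RInt (V := restrict_scalars V) (fun t => phi (circle_pt c s t)) 0 (2 * PI).

(** A radial step [eta] from radius [x] is matched with a rotation by [theta = eta / x]. To first
    order the radial increment of [phi] is [- i] times the angular one, and the angular increment
    integrates to zero over a period. Hence [G] changes by [O (eta^2)] only. *)
Lemma weighted_resolvent_circle_mean (s : R) : 0 < s <= r -> G s = G r.
Proof.
intros Hs. symmetry.
assert (HPI := PI_RGT_0).
(* The rotated angle [t + theta] exceeds [2 * PI] by at most [r / s]. *)
destruct (resolvent_bounded_annulus s 0 (2 * PI + r / s) (proj1 Hs)) as [K [HK HB]].
assert (Hrs : 0 <= r / s) by (apply Rdiv_le_0_compat; lra).
set (k := (2 / s * (K + r * K * K) + 8 * ((r * K + 1) * (K * K))) * norm f).
assert (Hk : 0 <= k).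
{ unfold k. assert (0 <= 2 / s) by (apply Rdiv_le_0_compat; lra).
  assert (0 <= r * K) by (apply Rmult_le_pos; lra).
  assert (0 <= r * K * K) by (apply Rmult_le_pos; lra).
  assert (0 <= K * K) by (apply Rmult_le_pos; lra).
  apply Rmult_le_pos; [|apply norm_ge_0].
  apply Rplus_le_le_0_compat; [apply Rmult_le_pos; lra|].
  apply Rmult_le_pos; [lra|]. apply Rmult_le_pos; lra. }
apply (constant_of_quadratic_modulus G s r (2 * PI * k)); [lra|apply Rmult_le_pos; lra|].
intros x y Hx Hxy Hy.
set (eta := y - x). set (theta := eta / x).
assert (Hth : 0 <= theta <= r / s).
{ unfold theta. split; [apply Rdiv_le_0_compat; unfold eta; lra|].
  apply Rle_trans with (r / x).
  - apply Rmult_le_compat_r; [|unfold eta; lra]. left. apply Rinv_0_lt_compat. lra.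
  - apply Rmult_le_compat_l; [lra|]. apply Rinv_le_contravar; lra. }
assert (Hex : forall x, 0 < x <= r ->
  is_RInt (V := restrict_scalars V) (fun t => phi (circle_pt c x t)) 0 (2 * PI) (G x)).
{ intros u Hu. apply RInt_correct. apply ex_RInt_continuous. intros t _.
  now apply weighted_resolvent_continuous. }
assert (Hsh : is_RInt (V := restrict_scalars V)
  (fun t => phi (circle_pt c x (t + theta))) 0 (2 * PI) (G x)).
{ apply (is_RInt_periodic_shift (W := restrict_scalars V) (fun t => phi (circle_pt c x t))).
  - intros t. apply weighted_resolvent_continuous. lra.
  - intros t. unfold circle_pt. now rewrite cos_plus, sin_plus, cos_2PI, sin_2PI,
      !Rmult_1_r, !Rmult_0_r, Rminus_0_r, Rplus_0_r. }
(* By periodicity the rotated and unrotated integrals are both [G x], so the term with [Ci]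
   contributes nothing and [G y - G x] remains. *)
assert (HI : is_RInt (V := restrict_scalars V)
  (fun t => plus (minus (phi (circle_pt c y t)) (phi (circle_pt c x t)))
     (scal (Ci : C_AbsRing)
        (minus (phi (circle_pt c x (t + theta))) (phi (circle_pt c x t)))))
  0 (2 * PI) (plus (minus (G y) (G x)) (scal (Ci : C_AbsRing) (minus (G x) (G x) : V)))).
{ refine (is_RInt_plus (V := restrict_scalars V) _ _ _ _ _ _ _ _).
  - apply (is_RInt_minus (V := restrict_scalars V)); apply Hex; lra.
  - apply (is_RInt_linear (U := restrict_scalars V) (W := restrict_scalars V)
      (fun v : V => scal (Ci : C_AbsRing) v)); [apply is_linear_Cscal|].
    apply (is_RInt_minus (V := restrict_scalars V)); [exact Hsh|apply Hex; lra]. }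
replace (plus (minus (G y) (G x)) (scal (Ci : C_AbsRing) (minus (G x) (G x) : V)))
  with (minus (G y) (G x)) in HI.
2:{ change (minus (G y : V) (G x) =
     plus (minus (G y : V) (G x)) (scal (Ci : C_AbsRing) (minus (G x : V) (G x)))). vring V. }
replace (2 * PI * k * (eta * eta)) with ((2 * PI - 0) * (eta * eta * k)) by ring.
refine (norm_RInt_le_const _ _ _ _ _ _ _ HI); [lra|].
intros t Ht.
assert (Heta : 0 <= eta) by (unfold eta; lra).
assert (Hxt : x * theta = eta) by (unfold theta; field; lra).
unfold k. apply (weighted_resolvent_second_order K).
- exact HK.
- apply circle_pt_resolvent; lra.
- apply circle_pt_resolvent; lra.
- apply circle_pt_resolvent; lra.
- rewrite circle_pt_dist, Rabs_right; lra.
- rewrite circle_pt_dist, Rabs_right; lra.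
- rewrite circle_pt_dist, Rabs_right; lra.
- apply HB; lra.
- apply HB; lra.
- apply HB; lra.
- pose proof (circle_pt_lipschitz c x y t t) as L.
  fold eta in L. rewrite Rminus_diag, Rabs_R0, (Rabs_right eta) in L; lra.
- pose proof (circle_pt_lipschitz c x x t (t + theta)) as L.
  replace (t + theta - t) with theta in L by ring.
  rewrite Rminus_diag, Rabs_R0, (Rabs_right x), (Rabs_right theta) in L; lra.
(* The left side is [exp (i t) x (theta + i (exp (i theta) - 1))], in which the terms linear in
   [theta] cancel. *)
- replace (circle_pt c y t - circle_pt c x t + Ci * (circle_pt c x (t + theta) - circle_pt c x t))%C
    with ((cos t, sin t) * (RtoC x * (- (sin theta - theta), cos theta - 1)%R))%C.
  2:{ unfold circle_pt. rewrite cos_plus, sin_plus.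
      replace y with (x + x * theta) by (rewrite Hxt; unfold eta; ring).
      apply injective_projections; simpl; ring. }
  rewrite !Cmod_mult, Cmod_unit, Cmod_R, Rmult_1_l, Rabs_right by lra.
  pose proof (Cmod_le_Rabs (- (sin theta - theta), cos theta - 1)) as L. simpl in L.
  rewrite Rabs_Ropp in L.
  pose proof (sin_minus_id_le theta). pose proof (cos_minus_1_le theta).
  apply Rle_trans with (x * (2 * (theta * theta))); [apply Rmult_le_compat_l; lra|].
  replace (x * (2 * (theta * theta))) with (2 / x * (eta * eta))
    by (rewrite <- Hxt; field; lra).
  apply Rmult_le_compat_r; [nra|]. apply Rmult_le_compat_l; [lra|].
  apply Rinv_le_contravar; lra.
Qed.

(** A removable singularity: the factor [z - c] makes [phi] at most [s * B] on the circle of radius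
    [s], while the integral does not depend on [s]. *)
Lemma weighted_resolvent_circle_zero (rho B : R) : 0 < r -> 0 < rho ->
  (forall z, resolvent_set A z -> z <> c -> Cmod (z - c)%C <= rho -> norm (resolvent A z f) <= B) ->
  is_RInt (V := restrict_scalars V) (fun t => phi (circle_pt c r t)) 0 (2 * PI) zero.
Proof.
intros Hr Hrho HB. assert (HPI := PI_RGT_0).
assert (Hex : forall x, 0 < x <= r ->
  is_RInt (V := restrict_scalars V) (fun t => phi (circle_pt c x t)) 0 (2 * PI) (G x)).
{ intros u Hu. apply RInt_correct. apply ex_RInt_continuous. intros t _.
  now apply weighted_resolvent_continuous. }
assert (Hb : forall s, 0 < s -> s <= r -> s <= rho -> norm (G r) <= (2 * PI - 0) * (s * B)).
{ intros s H0 H1 H2. rewrite <- (weighted_resolvent_circle_mean s) by lra.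
  refine (norm_RInt_le_const _ _ _ _ _ _ _ (Hex s _)); [lra| |lra].
  intros t _. unfold phi.
  refine (Rle_trans _ _ _ (Cnorm_scal (V := V) _ _) _).
  rewrite Cmod_mult, Cmod_Ci, Rmult_1_l, circle_pt_dist, Rabs_right by lra.
  apply Rmult_le_compat_l; [lra|].
  assert (Hd := circle_pt_dist c s t). rewrite Rabs_right in Hd by lra.
  apply HB; [apply circle_pt_resolvent; lra| |lra].
  intros E. rewrite E in Hd. replace (c - c)%C with (RtoC 0) in Hd by ring.
  rewrite Cmod_0 in Hd. lra. }
enough (E : G r = zero).
{ pose proof (Hex r (conj Hr (Rle_refl r))) as H. rewrite E in H. exact H. }
apply (norm_eq_zero (G r)). apply Rle_antisym; [|apply norm_ge_0].
apply le_epsilon. intros eps Heps. rewrite Rplus_0_l.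
set (s := Rmin (Rmin r rho) (eps / (2 * PI * (Rabs B + 1)))).
pose proof (Rabs_pos B).
assert (Hden : 0 < 2 * PI * (Rabs B + 1)) by (apply Rmult_lt_0_compat; lra).
assert (Hs : 0 < s).
{ unfold s. repeat apply Rmin_glb_lt; try lra. now apply Rdiv_lt_0_compat. }
assert (s <= r) by (unfold s; eapply Rle_trans; apply Rmin_l).
assert (s <= rho) by (unfold s; eapply Rle_trans; [apply Rmin_l|apply Rmin_r]).
assert (Hse : s <= eps / (2 * PI * (Rabs B + 1))) by apply Rmin_r.
eapply Rle_trans; [apply (Hb s); assumption|].
apply Rle_trans with (2 * PI * (Rabs B + 1) * s).
- pose proof (Rle_abs B).
  replace ((2 * PI - 0) * (s * B)) with (2 * PI * s * B) by ring.
  replace (2 * PI * (Rabs B + 1) * s) with (2 * PI * s * (Rabs B + 1)) by ring.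
  apply Rmult_le_compat_l; [apply Rmult_le_pos; lra|lra].
- apply Rle_trans with (2 * PI * (Rabs B + 1) * (eps / (2 * PI * (Rabs B + 1)))).
  + apply Rmult_le_compat_l; lra.
  + apply Req_le. field. split; lra.
Qed.

End ContourInvariance.

Lemma resolvent_eigenvector (g : V) (z : C) : A g (scal (c : C_AbsRing) g) ->
  resolvent_set A z -> z <> c -> resolvent A z g = scal ((/ (z - c))%C : C_AbsRing) g.
Proof.
intros Hg Hz Hzc. destruct (resolvent_spec A z Hz) as [Lz Sz].
assert (Hnz : (z - c)%C <> RtoC 0).
{ intros E. apply Hzc. replace z with (z - c + c)%C by ring. rewrite E. ring. }
assert (E : g = resolvent A z (scal ((z - c)%C : C_AbsRing) g)).
{ apply Sz. eexists. split; [exact Hg|]. vring V. }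
rewrite (linear_scal _ Lz) in E. rewrite E at 2.
vring_with V ltac:(field; exact Hnz).
Qed.

(** Decompose [f = f0 + k g] with [l f0 = 0]. The resolvent leaves the kernel of [l] invariant,
    because [(z - c) * l x = l f0] for [x = resolvent A z f0]. The estimate on that kernel then
    makes the singularity at [c] removable for [f0], and only the explicit resolvent of [g]
    contributes. *)
Lemma riesz_projection_rank_one (l : V -> C) (g : V) (K : R) : 0 < r ->
  is_linear (V := C_NormedModule) l -> l g <> RtoC 0 -> A g (scal (c : C_AbsRing) g) ->
  (forall x y, A x y -> l y = (c * l x)%C) ->
  (forall x y, A x y -> l x = RtoC 0 -> norm x <= K * norm (minus (scal (c : C_AbsRing) x) y)) ->
  forall f, riesz_projection A c r f = scal ((l f / l g)%C : C_AbsRing) g.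
Proof.
intros Hr Hl Hlg Hg HA HK f.
set (k := (l f / l g)%C). set (f0 := minus f (scal (k : C_AbsRing) g)).
assert (Hf0 : l f0 = RtoC 0).
{ unfold f0. transitivity (l f - k * l g)%C.
  - unfold minus. transitivity (l f + l (scal ((- k)%C : C_AbsRing) g))%C.
    + rewrite <- (linear_plus l Hl). f_equal. vring V.
    + rewrite (linear_scal l Hl). change (l f + (- k) * l g = l f - k * l g)%C. ring.
  - unfold k. field. exact Hlg. }
assert (Hz0 : forall z, resolvent_set A z -> z <> c -> l (resolvent A z f0) = RtoC 0).
{ intros z Hz Hzc. destruct (resolvent_spec A z Hz) as [_ Sz].
  destruct (proj2 (Sz _ f0) eq_refl) as [y [Hy Ef]].
  set (x := resolvent A z f0) in *.
  assert (E : ((z - c) * l x)%C = RtoC 0).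
  { rewrite <- Hf0, Ef. transitivity (z * l x - l y)%C.
    - rewrite (HA x y Hy). ring.
    - transitivity (l (plus (scal (z : C_AbsRing) x) (scal ((-(1))%C : C_AbsRing) y))).
      + rewrite (linear_plus l Hl), !(linear_scal l Hl).
        change (z * l x - l y = z * l x + (-(1)) * l y)%C. ring.
      + f_equal. vring V. }
  destruct (Ceq_dec (l x) (RtoC 0)) as [|Hn]; [assumption|exfalso].
  revert E. apply Cmult_neq_0; [|exact Hn].
  intros E. apply Hzc. replace z with (z - c + c)%C by ring. rewrite E. ring. }
assert (HI0 := fun rho B => weighted_resolvent_circle_zero f0 rho B Hr).
pose proof (Rabs_pos K) as HKp. pose proof (Rle_abs K) as HKa.
(* Nothing is assumed about the sign of [K]. Within distance [/ (2 * K1)] of [c], half of [norm x]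
   is absorbed, since [(c - A) x = f0 - (z - c) x]. *)
set (K1 := Rabs K + 1) in *.
specialize (HI0 (/ (2 * K1)) (2 * K1 * norm f0)).
assert (HK1 : 0 < K1) by (unfold K1; lra).
assert (HI : is_RInt (V := restrict_scalars V)
  (fun t => scal ((Ci * (circle_pt c r t - c))%C : C_AbsRing) (resolvent A (circle_pt c r t) f0))
  0 (2 * PI) zero).
{ apply HI0; [apply Rinv_0_lt_compat; lra|].
  intros z Hz Hzc Hd. destruct (resolvent_spec A z Hz) as [_ Sz].
  destruct (proj2 (Sz _ f0) eq_refl) as [y [Hy Ef]].
  specialize (Hz0 z Hz Hzc). set (x := resolvent A z f0) in *.
  pose proof (HK x y Hy Hz0) as H1.
  replace (minus (scal (c : C_AbsRing) x) y) with
    (minus f0 (scal ((z - c)%C : C_AbsRing) x)) in H1 by (rewrite Ef; vring V).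
  pose proof (norm_minus_le f0 (scal ((z - c)%C : C_AbsRing) x)) as H2.
  pose proof (Cnorm_scal (z - c)%C x) as H3.
  set (N := norm (minus f0 _)) in *.
  assert (HN : 0 <= N) by apply norm_ge_0.
  pose proof (norm_ge_0 x) as Hx.
  assert (H4 : Cmod (z - c)%C * norm x <= / (2 * K1) * norm x)
    by (apply Rmult_le_compat_r; assumption).
  assert (H5 : K1 * (/ (2 * K1) * norm x) = norm x / 2) by (field; lra).
  assert (H6 : norm x <= K1 * N).
  { eapply Rle_trans; [exact H1|]. apply Rmult_le_compat_r; unfold K1; lra. }
  assert (H7 : K1 * N <= K1 * (norm f0 + / (2 * K1) * norm x))
    by (apply Rmult_le_compat_l; lra).
  rewrite Rmult_plus_distr_l in H7. lra. }
unfold riesz_projection, circle_integral.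
(* The part along [g] has the constant integrand [i k g], as [z - c] cancels its inverse. *)
rewrite (is_RInt_unique (V := restrict_scalars V) _ 0 (2 * PI)
  (plus (zero : V) (scal (RtoC (2 * PI - 0) : C_AbsRing)
     (scal ((Ci * k)%C : C_AbsRing) g)))).
- assert (HPI : RtoC PI <> RtoC 0).
  { intros E. apply PI_neq0. now injection E. }
  rewrite Rminus_0_r, RtoC_mult. vring_with V ltac:(field; split; [exact Ci_nz|exact HPI]).
- apply (is_RInt_ext (V := restrict_scalars V) (fun t => plus
    (scal ((Ci * (circle_pt c r t - c))%C : C_AbsRing) (resolvent A (circle_pt c r t) f0) : V)
    (scal ((Ci * k)%C : C_AbsRing) g : V))).
  + intros t _. fold (circle_pt c r t).
    set (z := circle_pt c r t).
    assert (Hz : resolvent_set A z) by (apply circle_pt_resolvent; lra).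
    assert (Hzc : (z - c)%C <> RtoC 0).
    { intros E. pose proof (circle_pt_dist c r t) as Hd. fold z in Hd.
      rewrite E, Cmod_0, Rabs_right in Hd; lra. }
    assert (Hzc' : z <> c) by (intros ->; apply Hzc; ring).
    assert (Ef : f = plus f0 (scal (k : C_AbsRing) g)) by (unfold f0; vring V).
    rewrite Ef at 1. destruct (resolvent_spec A z Hz) as [Lz _].
    rewrite (linear_plus _ Lz), (linear_scal _ Lz), (resolvent_eigenvector g z Hg Hz Hzc').
    replace (Ci * RtoC r * (cos t, sin t))%C with (Ci * (z - c))%C
      by (unfold z, circle_pt; ring).
    change (plus (scal ((Ci * (z - c))%C : C_AbsRing) (resolvent A z f0) : V)
      (scal ((Ci * k)%C : C_AbsRing) g : V) = scal ((Ci * (z - c))%C : C_AbsRing)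
      (plus (resolvent A z f0) (scal (k : C_AbsRing) (scal ((/ (z - c))%C : C_AbsRing) g)))).
    vring_with V ltac:(field; exact Hzc).
  + apply (is_RInt_plus (V := restrict_scalars V)); [exact HI|].
    apply (is_RInt_const (V := restrict_scalars V)).
Qed.

End Annulus.

(** * The a priori estimate *)

Section RealContinuity.
Implicit Types (f g : R -> R) (x k : R).

Lemma Rcontinuous_const k x : continuous (fun _ : R => k) x.
Proof. apply continuous_const. Qed.
Lemma Rcontinuous_id x : continuous (fun y : R => y) x.
Proof. apply continuous_id. Qed.
Lemma Rcontinuous_plus f g x : continuous f x -> continuous g x -> continuous (fun y => f y + g y) x.
Proof. exact (continuous_plus f g x). Qed.
Lemma Rcontinuous_minus f g x : continuous f x -> continuous g x -> continuous (fun y => f y - g y) x.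
Proof. exact (continuous_minus f g x). Qed.
Lemma Rcontinuous_opp f x : continuous f x -> continuous (fun y => - f y) x.
Proof. exact (continuous_opp f x). Qed.
Lemma Rcontinuous_mult f g x : continuous f x -> continuous g x -> continuous (fun y => f y * g y) x.
Proof. exact (continuous_mult f g x). Qed.
Lemma Rcontinuous_inv f x : continuous f x -> f x <> 0 -> continuous (fun y => / f y) x.
Proof. intros Hf Hx. apply (continuous_comp f Rinv); [exact Hf|]. now apply continuous_Rinv. Qed.
Lemma Rcontinuous_div f g x :
  continuous f x -> continuous g x -> g x <> 0 -> continuous (fun y => f y / g y) x.
Proof. intros Hf Hg Hx. apply Rcontinuous_mult; [exact Hf|]. now apply Rcontinuous_inv. Qed.
Lemma Rcontinuous_pow f n x : continuous f x -> continuous (fun y => f y ^ n) x.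
Proof.
intros Hf. induction n as [|n IH]; simpl; [apply Rcontinuous_const|].
now apply Rcontinuous_mult.
Qed.
Lemma is_derive_continuous f x k : is_derive f x k -> continuous f x.
Proof. intros H. apply (@ex_derive_continuous R_AbsRing R_NormedModule). now exists k. Qed.

End RealContinuity.

Lemma one_plus_sq_pos (x : R) : 0 < 1 + x ^ 2.
Proof. nra. Qed.

Lemma one_plus_sq_neq (x : R) : 1 + x ^ 2 <> 0.
Proof. pose proof (one_plus_sq_pos x). lra. Qed.

Lemma one_plus_sq_pow_neq (x : R) n : (1 + x ^ 2) ^ n <> 0.
Proof. apply pow_nonzero. pose proof (one_plus_sq_pos x). lra. Qed.

Ltac rcont_leaf :=
  match goal with
  | H : forall x, continuous ?f x |- continuous ?f _ => exact (H _)
  | H : forall x, is_derive ?f x _ |- continuous ?f _ => exact (is_derive_continuous _ _ _ (H _))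
  | H : forall x, continuous ?f x |- continuous (fun y => ?f y) _ => exact (H _)
  | H : forall x, is_derive ?f x _ |- continuous (fun y => ?f y) _ =>
      exact (is_derive_continuous _ _ _ (H _))
  end.

Ltac rcont :=
  lazymatch goal with
  | |- continuous (fun _ => ?k) ?x => exact (Rcontinuous_const k x)
  | |- continuous (fun y => y) ?x => exact (Rcontinuous_id x)
  | |- continuous (fun y => @?f y + @?g y) ?x => refine (Rcontinuous_plus f g x _ _); rcont
  | |- continuous (fun y => @?f y - @?g y) ?x => refine (Rcontinuous_minus f g x _ _); rcont
  | |- continuous (fun y => @?f y * @?g y) ?x => refine (Rcontinuous_mult f g x _ _); rcont
  | |- continuous (fun y => - @?f y) ?x => refine (Rcontinuous_opp f x _); rcont
  | |- continuous (fun y => @?f y / (1 + y ^ 2) ^ ?n) ?x =>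
      refine (Rcontinuous_div f (fun y => (1 + y ^ 2) ^ n) x _ _ (one_plus_sq_pow_neq x n)); rcont
  | |- continuous (fun y => @?f y / (1 + y ^ 2)) ?x =>
      refine (Rcontinuous_div f (fun y => 1 + y ^ 2) x _ _ (one_plus_sq_neq x)); rcont
  | |- continuous (fun y => @?f y / ?k) ?x =>
      refine (Rcontinuous_mult f (fun _ => / k) x _ _); rcont
  | |- continuous (fun y => @?f y ^ ?n) ?x => refine (Rcontinuous_pow f n x _); rcont
  | |- _ => rcont_leaf
  end.

Lemma ex_RInt_of_continuous (f : R -> R) (a b : R) : (forall x, continuous f x) -> ex_RInt f a b.
Proof. intros H. apply (ex_RInt_continuous (V := R_CompleteNormedModule)). auto. Qed.

Lemma nondecreasing_of_derive (f df : R -> R) (a b : R) : a <= b ->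
  (forall x, a <= x <= b -> is_derive f x (df x)) ->
  (forall x, a < x < b -> 0 <= df x) -> f a <= f b.
Proof.
intros Hab Hd Hp. destruct (Rle_lt_or_eq_dec a b Hab) as [Hlt| ->]; [|apply Rle_refl].
destruct (MVT_cor2 f df a b Hlt) as [c [E Hc]].
- intros x Hx. now apply is_derive_Reals, Hd.
- specialize (Hp c Hc). assert (0 <= df c * (b - a)) by (apply Rmult_le_pos; lra). lra.
Qed.

(** Cauchy-Schwarz through Young's inequality [B |h| <= B h^2 / (2 M) + B M / 2], whose two terms
    each integrate to at most [B M / 2]. It needs some positive upper bound [M] of the norm of [h]
    instead of the norm itself. *)
Lemma primitive_sq_bound (H h w : R -> R) (B M rho : R) : 0 < M -> 0 <= rho <= 1 ->
  (forall x, is_derive H x (w x * h x)) ->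
  (forall x, continuous w x) -> (forall x, continuous h x) -> H 0 = 0 ->
  (forall x, 0 <= x <= rho -> Rabs (w x) <= B) ->
  RInt (fun x => h x ^ 2) 0 1 <= M ^ 2 -> Rabs (H rho) <= B * M.
Proof.
intros HM Hrho HH Hw Hh H0 HB HI.
assert (B0 : 0 <= B) by (eapply Rle_trans; [apply Rabs_pos|apply (HB 0); lra]).
assert (E : is_RInt (fun x => w x * h x) 0 rho (minus (H rho) (H 0))).
{ apply (is_RInt_derive (V := R_CompleteNormedModule) H (fun x => w x * h x));
    intros x _; [apply HH|]. rcont. }
assert (Hex : forall a b, ex_RInt (fun x => h x ^ 2) a b)
  by (intros; apply ex_RInt_of_continuous; intros; rcont).
rewrite H0 in E. replace (minus (H rho) 0) with (H rho) in E by exact (eq_sym (Rminus_0_r _)).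
set (I := RInt (fun x => h x ^ 2) 0 rho).
assert (HIr : I <= M ^ 2).
{ eapply Rle_trans; [|exact HI]. unfold I.
  rewrite <- (RInt_Chasles (fun x => h x ^ 2) 0 rho 1) by apply Hex.
  assert (0 <= RInt (fun x => h x ^ 2) rho 1).
  { apply RInt_ge_0; [lra|apply Hex|]. intros; apply pow2_ge_0. }
  change (I <= I + RInt (fun x => h x ^ 2) rho 1). lra. }
assert (HG : is_RInt (fun x => B / (2 * M) * h x ^ 2 + B * M / 2) 0 rho
   (B / (2 * M) * I + (rho - 0) * (B * M / 2))).
{ apply (is_RInt_plus (V := R_NormedModule)).
  - apply (is_RInt_scal (V := R_NormedModule)). apply (RInt_correct (V := R_CompleteNormedModule)), Hex.
  - apply (is_RInt_const (V := R_NormedModule)). }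
eapply Rle_trans.
- refine (norm_RInt_le _ _ _ _ _ _ (proj1 Hrho) _ E HG).
  intros x Hx. change (Rabs (w x * h x) <= B / (2 * M) * h x ^ 2 + B * M / 2).
  rewrite Rabs_mult. apply Rle_trans with (B * Rabs (h x)).
  + apply Rmult_le_compat_r; [apply Rabs_pos|now apply HB].
  + rewrite <- (pow2_abs (h x)). set (y := Rabs (h x)).
    replace (B / (2 * M) * y ^ 2 + B * M / 2)
      with (B * y + B / (2 * M) * (y - M) ^ 2) by (field; lra).
    assert (0 <= B / (2 * M)) by (apply Rdiv_le_0_compat; lra).
    pose proof (pow2_ge_0 (y - M)). nra.
- apply Rle_trans with (B / (2 * M) * M ^ 2 + 1 * (B * M / 2)).
  + apply Rplus_le_compat.
    * apply Rmult_le_compat_l; [apply Rdiv_le_0_compat; lra|exact HIr].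
    * apply Rmult_le_compat_r; [|lra]. apply Rdiv_le_0_compat; [|lra]. apply Rmult_le_pos; lra.
  + apply Req_le. field. lra.
Qed.

(* [a = u1' / rho] and [b = u2'] are the coordinates in which the norm of [H1 * H2] is the
   norm of [L^2(0,1)^2]; [Psi] is the integral of [rho u2]. *)
Record wave_data (a da b db u Psi : R -> R) : Prop := {
  wd_a : forall x, is_derive a x (da x);
  wd_da : forall x, continuous da x;
  wd_b : forall x, is_derive b x (db x);
  wd_db : forall x, continuous db x;
  wd_u : forall x, is_derive u x (b x);
  wd_Psi : forall x, is_derive Psi x (x * u x);
  wd_a0 : a 0 = 0;
  wd_u0 : u 0 = 0;
  wd_Psi0 : Psi 0 = 0 }.

(* [source_1, source_2] are the entries of [(1 - L) u]; [x * source_a x]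
   and [source_b] are their derivatives. *)
Definition pert (u Psi : R -> R) (x : R) : R :=
  64 * Psi x / (1 + x ^ 2) ^ 3 - 16 * u x / (1 + x ^ 2) ^ 2.
Definition source_a (a da db u Psi : R -> R) (x : R) : R :=
  2 * a x + x * da x - db x + pert u Psi x.
Definition source_b (da b db : R -> R) (x : R) : R := 2 * b x - da x + x * db x.
Definition source_1 (a b u Psi : R -> R) (x : R) : R :=
  x ^ 2 * a x - x * b x + u x - 16 * Psi x / (1 + x ^ 2) ^ 2.
Definition source_2 (a b u : R -> R) (x : R) : R := u x - a x + x * b x.

(* The Wronskian of [x^3 / (1 + x^2)] (the integral of [x g2]) and [Psi], divided by [x^2]. *)
Definition wronsk (u Psi : R -> R) (x : R) : R :=
  x ^ 2 * u x / (1 + x ^ 2) - (3 + x ^ 2) * Psi x / (1 + x ^ 2) ^ 2.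

Section WaveEstimate.
Context {a da b db u Psi : R -> R}.
Hypothesis H : wave_data a da b db u Psi.

Let Ha := wd_a _ _ _ _ _ _ H.
Let Hda := wd_da _ _ _ _ _ _ H.
Let Hb := wd_b _ _ _ _ _ _ H.
Let Hdb := wd_db _ _ _ _ _ _ H.
Let Hu := wd_u _ _ _ _ _ _ H.
Let HPsi := wd_Psi _ _ _ _ _ _ H.

Ltac wderive :=
  match goal with |- is_derive _ ?x _ =>
    auto_derive;
    [ repeat lazymatch goal with
        | |- _ /\ _ => split
        | |- True => exact I
        | |- ex_derive (fun y => a y) _ => exact (ex_intro _ _ (Ha x))
        | |- ex_derive (fun y => b y) _ => exact (ex_intro _ _ (Hb x))
        | |- ex_derive (fun y => u y) _ => exact (ex_intro _ _ (Hu x))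
        | |- ex_derive (fun y => Psi y) _ => exact (ex_intro _ _ (HPsi x))
        end
    | rewrite ?(is_derive_unique (fun y : R => a y) x _ (Ha x)), ?(is_derive_unique (fun y : R => b y) x _ (Hb x)),
       ?(is_derive_unique (fun y : R => u y) x _ (Hu x)), ?(is_derive_unique (fun y : R => Psi y) x _ (HPsi x)) ]
  end.

Lemma continuous_pert x : continuous (pert u Psi) x.
Proof. unfold pert. rcont. Qed.

Lemma continuous_source_a x : continuous (source_a a da db u Psi) x.
Proof. pose proof continuous_pert. unfold source_a. rcont. Qed.

Lemma continuous_source_b x : continuous (source_b da b db) x.
Proof. unfold source_b. rcont. Qed.

Lemma is_derive_source_1 x : is_derive (source_1 a b u Psi) x (x * source_a a da db u Psi x).
Proof.
unfold source_1. wderive.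
- exact (one_plus_sq_pow_neq x 2).
- unfold source_a, pert. field. exact (one_plus_sq_neq x).
Qed.

Lemma is_derive_source_2 x : is_derive (source_2 a b u) x (source_b da b db x).
Proof. unfold source_2. wderive. unfold source_b. ring. Qed.

(** Lagrange's identity for the Sturm-Liouville equation and its homogeneous solution: [a] cancels
    in [source_1 + x^2 source_2], and the factor [x / (1 + x^2)] is [x^3 / (1 + x^2)] divided by the
    weight [x^2]. *)
Lemma is_derive_wronsk x :
  is_derive (fun x => (1 - x ^ 2) * wronsk u Psi x) x
    (- (source_1 a b u Psi x + x ^ 2 * source_2 a b u x) * (x / (1 + x ^ 2))).
Proof.
unfold wronsk. wderive.
- exact (one_plus_sq_neq x).
- exact (one_plus_sq_pow_neq x 2).
- unfold source_1, source_2. field. exact (one_plus_sq_neq x).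
Qed.

(** Reduction of order: the derivative of [Psi / phi], where [phi = x^3 / (1 + x^2)], is the
    Wronskian over [phi^2]. *)
Lemma is_derive_quotient x : x <> 0 ->
  is_derive (fun x => Psi x * (1 + x ^ 2) / x ^ 3) x (wronsk u Psi x * (1 + x ^ 2) ^ 2 / x ^ 4).
Proof.
intros Hx. wderive.
- exact (pow_nonzero x 3 Hx).
- unfold wronsk. field. split; [exact (one_plus_sq_neq x)|exact Hx].
Qed.

(** Integrated Lagrange identity: the boundary term vanishes at [1] by the factor [1 - x^2], and at
    [0] because [u] and [Psi] do. *)
Lemma solvability : RInt (fun x => (source_1 a b u Psi x + x ^ 2 * source_2 a b u x) * (x / (1 + x ^ 2))) 0 1 = 0.
Proof.
apply is_RInt_unique.
apply (is_RInt_ext (fun x => - (- (source_1 a b u Psi x + x ^ 2 * source_2 a b u x) * (x / (1 + x ^ 2))))).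
{ intros x _. change (- (- (source_1 a b u Psi x + x ^ 2 * source_2 a b u x) * (x / (1 + x ^ 2))) =
    (source_1 a b u Psi x + x ^ 2 * source_2 a b u x) * (x / (1 + x ^ 2))). ring. }
replace 0 with (opp (minus ((1 - 1 ^ 2) * wronsk u Psi 1) ((1 - 0 ^ 2) * wronsk u Psi 0))) at 2.
2:{ change (- ((1 - 1 ^ 2) * wronsk u Psi 1 - (1 - 0 ^ 2) * wronsk u Psi 0) = 0).
    unfold wronsk. rewrite (wd_u0 _ _ _ _ _ _ H), (wd_Psi0 _ _ _ _ _ _ H). field. }
apply (is_RInt_opp (V := R_NormedModule)).
apply (is_RInt_derive (V := R_CompleteNormedModule) (fun x => (1 - x ^ 2) * wronsk u Psi x)).
- intros x _. apply is_derive_wronsk.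
- intros x _. pose proof is_derive_source_1. pose proof is_derive_source_2.
  rcont.
Qed.

Variable M : R.
Hypothesis HM : 0 < M.
Hypothesis HN : RInt (fun x => source_a a da db u Psi x ^ 2 + source_b da b db x ^ 2) 0 1 <= M ^ 2.

Lemma RInt_source_sq :
  RInt (fun x => source_a a da db u Psi x ^ 2) 0 1 <= M ^ 2 /\
  RInt (fun x => source_b da b db x ^ 2) 0 1 <= M ^ 2.
Proof.
pose proof continuous_source_a. pose proof continuous_source_b.
split; (eapply Rle_trans; [|exact HN]); apply RInt_le; try lra;
  try (apply ex_RInt_of_continuous; intros; rcont);
  intros x _; pose proof (pow2_ge_0 (source_a a da db u Psi x)); pose proof (pow2_ge_0 (source_b da b db x)); lra.
Qed.

(** The factor [x] comes from the weight in the derivative of [source_1], and from [x^2 <= x] in the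
    other term. It compensates for the singularity of the equation at [0]. *)
Lemma source_bound x : 0 <= x <= 1 ->
  Rabs (source_1 a b u Psi x + x ^ 2 * source_2 a b u x) <= 2 * x * M.
Proof.
intros Hx. destruct RInt_source_sq as [Na Nb].
assert (B1 : Rabs (source_1 a b u Psi x) <= x * M).
{ apply (primitive_sq_bound _ (source_a a da db u Psi) (fun y => y)); auto.
  - exact is_derive_source_1.
  - intros; rcont.
  - exact continuous_source_a.
  - unfold source_1. rewrite (wd_u0 _ _ _ _ _ _ H), (wd_Psi0 _ _ _ _ _ _ H). field.
  - intros y Hy. rewrite Rabs_right; lra. }
assert (B2 : Rabs (source_2 a b u x) <= 1 * M).
{ apply (primitive_sq_bound _ (source_b da b db) (fun y => 1)); auto.
  - intros y. rewrite Rmult_1_l. apply is_derive_source_2.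
  - intros; rcont.
  - exact continuous_source_b.
  - unfold source_2. rewrite (wd_u0 _ _ _ _ _ _ H), (wd_a0 _ _ _ _ _ _ H). ring.
  - intros y Hy. rewrite Rabs_right; lra. }
apply Rabs_le_between in B1. apply Rabs_le_between in B2.
assert (x ^ 2 <= x) by nra. assert (0 <= x ^ 2) by nra.
apply Rabs_le. split; nra.
Qed.

(** The function [W = (1 - x^2) wronsk] vanishes at both ends and [|W'| <= 2 M x^2]. Integration
    from [0] gives the decay [x^3], integration from [1] gives the factor [1 - x] needed to divide
    by [1 - x^2]. The two are merged at [x = 1/2], where [x^3 = 1/8] turns [2] into [16]. *)
Lemma wronsk_bound x : 0 < x < 1 -> Rabs (wronsk u Psi x) <= 16 * M * x ^ 3.
Proof.
intros Hx.
assert (S : forall y, 0 <= y <= 1 ->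
  Rabs (- (source_1 a b u Psi y + y ^ 2 * source_2 a b u y) * (y / (1 + y ^ 2))) <= 2 * M * y ^ 2).
{ intros y Hy. rewrite Rabs_mult, Rabs_Ropp. pose proof (source_bound y Hy) as Hs.
  pose proof (one_plus_sq_pos y).
  assert (0 <= y / (1 + y ^ 2) <= y).
  { split; [apply Rdiv_le_0_compat; lra|]. apply Rle_div_l; [lra|]. nra. }
  rewrite (Rabs_right (y / _)) by lra.
  replace (2 * M * y ^ 2) with (2 * y * M * y) by ring.
  apply Rmult_le_compat; [apply Rabs_pos|lra|exact Hs|lra]. }
set (W := fun x => (1 - x ^ 2) * wronsk u Psi x).
set (dW := fun y => - (source_1 a b u Psi y + y ^ 2 * source_2 a b u y) * (y / (1 + y ^ 2))) in *.
assert (HW : forall y, is_derive W y (dW y)) by (intros; apply is_derive_wronsk).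
assert (W0 : W 0 = 0).
{ unfold W, wronsk. rewrite (wd_u0 _ _ _ _ _ _ H), (wd_Psi0 _ _ _ _ _ _ H). field. }
assert (W1 : W 1 = 0) by (unfold W; ring).
assert (T : forall (q dq : R -> R) y z, 0 <= y -> y <= z -> z <= 1 ->
   (forall t, is_derive q t (dq t)) ->
   (forall t, 0 <= t <= 1 -> 2 * M * t ^ 2 <= dq t) -> Rabs (W z - W y) <= q z - q y).
{ intros q dq y z H0 Hyz H1 Hq Hdq. apply Rabs_le. split.
  - assert (W y + q y <= W z + q z); [|lra].
    apply (nondecreasing_of_derive (fun t => W t + q t) (fun t => dW t + dq t)); [exact Hyz| |].
    + intros t _. apply (is_derive_plus (V := R_NormedModule)); auto.
    + intros t Ht. specialize (Hdq t ltac:(lra)). specialize (S t ltac:(lra)).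
      apply Rabs_le_between in S. unfold dW. lra.
  - assert (q y - W y <= q z - W z); [|lra].
    apply (nondecreasing_of_derive (fun t => q t - W t) (fun t => dq t - dW t)); [exact Hyz| |].
    + intros t _. apply (is_derive_minus (V := R_NormedModule)); auto.
    + intros t Ht. specialize (Hdq t ltac:(lra)). specialize (S t ltac:(lra)).
      apply Rabs_le_between in S. unfold dW. lra. }
assert (T1 : Rabs (W x - W 0) <= 2 * M / 3 * x ^ 3 - 2 * M / 3 * 0 ^ 3).
{ apply (T (fun t => 2 * M / 3 * t ^ 3) (fun t => 2 * M * t ^ 2)); try lra.
  - intros t. auto_derive; [exact I|field].
  - intros t _. lra. }
assert (T2 : Rabs (W 1 - W x) <= 2 * M * 1 - 2 * M * x).
{ apply (T (fun t => 2 * M * t) (fun t => 2 * M)); try lra.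
  - intros t. auto_derive; [exact I|ring].
  - intros t Ht. assert (t ^ 2 <= 1) by nra. nra. }
rewrite W0, Rminus_0_r in T1. rewrite W1, <- Rabs_Ropp in T2.
replace (- (0 - W x)) with (W x) in T2 by ring.
assert (Hx3 : 0 < x ^ 3) by (apply pow_lt; lra).
assert (HWx : Rabs (W x) <= 16 * M * x ^ 3 * (1 - x)).
{ destruct (Rle_dec x (1 / 2)).
  - assert (0 <= M * x ^ 3) by (apply Rmult_le_pos; lra). nra.
  - assert (1 / 8 <= x ^ 3) by nra. assert (0 <= M * (1 - x)) by nra.
    assert (1 / 8 * (M * (1 - x)) <= x ^ 3 * (M * (1 - x))) by (apply Rmult_le_compat_r; lra). lra. }
unfold W in HWx. rewrite Rabs_mult, Rabs_right in HWx by nra.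
apply Rmult_le_reg_l with (1 - x ^ 2); [nra|].
eapply Rle_trans; [exact HWx|].
assert (0 <= M * x ^ 3) by (apply Rmult_le_pos; lra).
assert (0 <= M * x ^ 3 * (x * (1 - x))) by (apply Rmult_le_pos; nra). lra.
Qed.

Hypothesis HPsi1 : Psi 1 = 0.

(** The quotient [chi] of [Psi] by [x^3 / (1 + x^2)] is integrated back from [1], where the
    hypothesis on [Psi 1] makes it vanish. *)
Lemma Psi_bound x : 0 < x < 1 -> Rabs (Psi x) <= 64 * M * x ^ 2.
Proof.
intros Hx. set (chi := fun x => Psi x * (1 + x ^ 2) / x ^ 3).
set (dchi := fun x => wronsk u Psi x * (1 + x ^ 2) ^ 2 / x ^ 4).
(* Here [64 = 16 * 4], with [(1 + y^2)^2 <= 4]. The available bound [64 M / y] is weakened to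
   [64 M / y^2], whose primitive is rational and whose loss is harmless. *)
assert (S : forall y, 0 < y < 1 -> Rabs (dchi y) <= 64 * M / y ^ 2).
{ intros y Hy. pose proof (wronsk_bound y Hy) as Hw. unfold dchi.
  assert (Hy4 : 0 < y ^ 4) by (apply pow_lt; lra).
  assert (Hy2 : 0 < y ^ 2) by (apply pow_lt; lra).
  assert (Hy2' : y ^ 2 < 1) by nra.
  assert (Hq : 0 <= (1 + y ^ 2) ^ 2 <= 4) by (set (z := y ^ 2) in *; nra).
  rewrite Rabs_div, Rabs_mult, (Rabs_right (y ^ 4)), (Rabs_right ((1 + y ^ 2) ^ 2)) by lra.
  apply Rle_div_l; [exact Hy4|].
  replace (64 * M / y ^ 2 * y ^ 4) with (16 * M * y ^ 2 * 4) by (field; lra).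
  apply Rmult_le_compat; [apply Rabs_pos|lra| |lra].
  eapply Rle_trans; [exact Hw|]. apply Rmult_le_compat_l; [lra|].
  replace (y ^ 3) with (y ^ 2 * y) by ring. nra. }
assert (Hchi : forall y, x <= y <= 1 -> is_derive chi y (dchi y)).
{ intros y Hy. apply is_derive_quotient. lra. }
assert (Hinv : forall y, x <= y <= 1 ->
  is_derive (fun y => 64 * M / y) y (- (64 * M / y ^ 2))).
{ intros y Hy. auto_derive; [lra|]. field. lra. }
assert (C1 : chi 1 = 0) by (unfold chi; rewrite HPsi1; field).
assert (T1 : chi x - 64 * M / x <= chi 1 - 64 * M / 1).
{ apply (nondecreasing_of_derive (fun t => chi t - 64 * M / t)
    (fun t => dchi t - - (64 * M / t ^ 2))); [lra| |].
  - intros t Ht. apply (is_derive_minus (V := R_NormedModule)); auto.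
  - intros t Ht. specialize (S t ltac:(lra)). apply Rabs_le_between in S. lra. }
assert (T2 : - (64 * M / x) - chi x <= - (64 * M / 1) - chi 1).
{ apply (nondecreasing_of_derive (fun t => - (64 * M / t) - chi t)
    (fun t => - - (64 * M / t ^ 2) - dchi t)); [lra| |].
  - intros t Ht. apply (is_derive_minus (V := R_NormedModule)); auto.
    apply (is_derive_opp (V := R_NormedModule)). auto.
  - intros t Ht. specialize (S t ltac:(lra)). apply Rabs_le_between in S. lra. }
assert (Hc : Rabs (chi x) <= 64 * M / x) by (apply Rabs_le; lra).
assert (Hx3 : 0 < x ^ 3) by (apply pow_lt; lra).
unfold chi in Hc.
rewrite Rabs_div, Rabs_mult, (Rabs_right (x ^ 3)), (Rabs_right (1 + x ^ 2)) in Hc by nra.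
apply (Rmult_le_compat_r (x ^ 3)) in Hc; [|lra].
replace (Rabs (Psi x) * (1 + x ^ 2) / x ^ 3 * x ^ 3) with (Rabs (Psi x) * (1 + x ^ 2))
  in Hc by (field; lra).
replace (64 * M / x * x ^ 3) with (64 * M * x ^ 2) in Hc by (field; lra).
pose proof (Rabs_pos (Psi x)). nra.
Qed.

(** [u] is recovered algebraically from the Wronskian and [Psi]; then
    [8704 = 64 * 64 + 16 * 288]. *)
Lemma pert_bound x : 0 < x < 1 -> Rabs (pert u Psi x) <= 8704 * M.
Proof.
intros Hx. pose proof (Psi_bound x Hx) as HP. pose proof (wronsk_bound x Hx) as Hw.
assert (Hx2 : 0 < x ^ 2 < 1) by nra.
assert (HU : Rabs (u x) <= 288 * M).
{ assert (E : x ^ 2 * u x = (1 + x ^ 2) * wronsk u Psi x + (3 + x ^ 2) / (1 + x ^ 2) * Psi x)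
    by (unfold wronsk; field; lra).
  assert (Hq : 0 <= (3 + x ^ 2) / (1 + x ^ 2) <= 3).
  { split; [apply Rdiv_le_0_compat; lra|]. apply Rle_div_l; lra. }
  apply Rmult_le_reg_l with (x ^ 2); [lra|].
  rewrite <- (Rabs_right (x ^ 2)) at 1 by lra. rewrite <- Rabs_mult, E.
  eapply Rle_trans; [apply Rabs_triang|].
  rewrite !Rabs_mult, (Rabs_right (1 + x ^ 2)), (Rabs_right (_ / _)) by lra.
  apply Rle_trans with (2 * (16 * M * x ^ 3) + 3 * (64 * M * x ^ 2)).
  - apply Rplus_le_compat; (apply Rmult_le_compat; [lra|apply Rabs_pos|lra|assumption]).
  - replace (x ^ 3) with (x ^ 2 * x) by ring. assert (0 < M * x ^ 2) by nra. nra. }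
assert (Hi : forall n, 0 <= / (1 + x ^ 2) ^ n <= 1).
{ intros n. split; [left; apply Rinv_0_lt_compat, pow_lt; lra|].
  rewrite <- Rinv_1. apply Rinv_le_contravar; [lra|]. apply pow_R1_Rle. lra. }
unfold pert, Rminus, Rdiv.
eapply Rle_trans; [apply Rabs_triang|].
rewrite Rabs_Ropp, !Rabs_mult, (Rabs_right 64), (Rabs_right 16) by lra.
rewrite !(Rabs_right (/ _)) by apply Rle_ge, Hi.
pose proof (Hi 3%nat) as H3. pose proof (Hi 2%nat) as H2.
pose proof (Rabs_pos (u x)). pose proof (Rabs_pos (Psi x)).
assert (Rabs (Psi x) <= 64 * M) by nra.
apply Rle_trans with (64 * (64 * M) * 1 + 16 * (288 * M) * 1); [|lra].
apply Rplus_le_compat; (apply Rmult_le_compat; [lra|lra|lra|lra]).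
Qed.

(* [1 - L0] is accretive: integrating [a (source_a - pert) + b source_b] by parts
   gives 3/2 of the squared norm and a non-negative boundary term. *)
Lemma energy_estimate : RInt (fun x => a x ^ 2 + b x ^ 2) 0 1 <= (8705 * M) ^ 2.
Proof.
set (N := RInt (fun x => a x ^ 2 + b x ^ 2) 0 1).
set (G := fun x => x * (a x ^ 2 + b x ^ 2) / 2 - a x * b x).
set (dG := fun x => (a x ^ 2 + b x ^ 2) / 2 + x * (a x * da x + b x * db x)
   - da x * b x - a x * db x).
pose proof continuous_source_a as Cfa. pose proof continuous_source_b as Cfb. pose proof continuous_pert as Cp.
assert (HG : is_RInt dG 0 1 (minus (G 1) (G 0))).
{ apply (is_RInt_derive (V := R_CompleteNormedModule)).
  - intros x _. unfold G. wderive. unfold dG. field.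
  - intros x _. unfold dG. rcont. }
assert (G0 : G 0 = 0) by (unfold G; rewrite (wd_a0 _ _ _ _ _ _ H); field).
(* [G 1] is the square [(a 1 - b 1)^2 / 2]. *)
assert (G1 : 0 <= G 1).
{ unfold G. pose proof (pow2_ge_0 (a 1 - b 1)). lra. }
assert (HNi : is_RInt (fun x => a x ^ 2 + b x ^ 2) 0 1 N).
{ apply (RInt_correct (V := R_CompleteNormedModule)). apply ex_RInt_of_continuous. intros; rcont. }
set (F := RInt (fun x => source_a a da db u Psi x ^ 2 + source_b da b db x ^ 2) 0 1) in *.
assert (HF : is_RInt (fun x => source_a a da db u Psi x ^ 2 + source_b da b db x ^ 2) 0 1 F).
{ apply (RInt_correct (V := R_CompleteNormedModule)). apply ex_RInt_of_continuous. intros; rcont. }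
assert (HL : is_RInt (fun x => dG x + (a x ^ 2 + b x ^ 2)) 0 1 (minus (G 1) (G 0) + N)).
{ apply (is_RInt_plus (V := R_NormedModule)); assumption. }
assert (HR : is_RInt (fun x => (source_a a da db u Psi x ^ 2 + source_b da b db x ^ 2) + (8704 * M) ^ 2)
   0 1 (F + (1 - 0) * (8704 * M) ^ 2)).
{ apply (is_RInt_plus (V := R_NormedModule)); [exact HF|].
  apply (is_RInt_const (V := R_NormedModule)). }
(* One unit of the coercive [3/2] is kept as [N]; the remaining half absorbs the products by Young's
   inequality. The final constant comes from [1 + 8704^2 <= 8705^2]. *)
assert (Hle : minus (G 1) (G 0) + N <= F + (1 - 0) * (8704 * M) ^ 2).
{ refine (is_RInt_le _ _ 0 1 _ _ Rle_0_1 HL HR _).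
  intros x Hx. pose proof (pert_bound x Hx) as Hp. apply Rabs_le_between in Hp.
  assert (Hp2 : pert u Psi x ^ 2 <= (8704 * M) ^ 2) by nra.
  assert (E : dG x = a x * (source_a a da db u Psi x - pert u Psi x) + b x * source_b da b db x
    - 3 / 2 * (a x ^ 2 + b x ^ 2)) by (unfold dG, source_a, source_b; field).
  rewrite E.
  set (A := a x). set (B := b x). set (p := source_a a da db u Psi x) in *.
  set (q := source_b da b db x). set (l := pert u Psi x) in *.
  pose proof (pow2_ge_0 (A - (p - l))). pose proof (pow2_ge_0 (B - q)).
  pose proof (pow2_ge_0 (p + l)). pose proof (pow2_ge_0 q). nra. }
rewrite G0 in Hle. replace (minus (G 1) 0) with (G 1) in Hle
  by exact (eq_sym (Rminus_0_r _)).
assert (0 < M ^ 2) by nra. nra.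
Qed.

End WaveEstimate.

(** * Functions on the unit interval and their real components *)

Definition components (u : R -> C) (p q : R -> R) : Prop :=
  forall x, 0 <= x <= 1 -> u x = (p x, q x).

Lemma norm_C_R (z : C) : norm (V := C_R_NormedModule) z = Cmod z.
Proof.
change (sqrt (Rabs (fst z) ^ 2 + Rabs (snd z) ^ 2) = sqrt (fst z ^ 2 + snd z ^ 2)).
now rewrite !pow2_abs.
Qed.

Lemma Cmod_pair_le (a b : R) : Cmod (a, b) <= Rabs a + Rabs b.
Proof. exact (Cmod_le_Rabs (a, b)). Qed.

Lemma Rabs_fst_le_Cmod (z : C) : Rabs (fst z) <= Cmod z.
Proof. eapply Rle_trans; [apply Rmax_l|apply Rmax_Cmod]. Qed.

Lemma Rabs_snd_le_Cmod (z : C) : Rabs (snd z) <= Cmod z.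
Proof. eapply Rle_trans; [apply Rmax_r|apply Rmax_Cmod]. Qed.

Lemma is_deriv01_eps (u : R -> C) (x : R) (l : C) : I01 x ->
  is_deriv01 u x l <->
  forall eps, 0 < eps -> exists d, 0 < d /\ forall y, I01 y -> Rabs (y - x) < d ->
    Cmod (u y - u x - RtoC (y - x) * l)%C <= eps * Rabs (y - x).
Proof.
intros Hx.
assert (E : forall y, norm (V := C_R_NormedModule)
    (minus (minus (u y) (u x)) (scal (V := C_R_NormedModule) (minus y x : R) (l : C_R_NormedModule)))
  = Cmod (u y - u x - RtoC (y - x) * l)%C).
{ intros y. rewrite norm_C_R. f_equal. destruct (u y), (u x), l.
  apply injective_projections; cbn; unfold plus, opp, scal, mult; cbn; unfold mult; cbn; ring. }
split.
- intros [_ H] eps Heps.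
  assert (Hl : is_filter_lim (within I01 (locally x)) x).
  { intros P HP. now apply filter_le_within. }
  destruct (H x Hl (mkposreal eps Heps)) as [d Hd].
  exists d. split; [apply cond_pos|]. intros y Hy Hyx.
  refine (Rle_trans _ _ _ (Req_le _ _ (eq_sym (E y))) _). exact (Hd y Hyx Hy).
- intros H. split; [apply is_linear_scal_l|].
  intros x' Hx' eps.
  assert (Ex : x' = x).
  { apply NNPP. intros Hne.
    assert (Hp : 0 < Rabs (x - x')) by (apply Rabs_pos_lt; lra).
    destruct (Hx' (fun y => Rabs (y - x') < Rabs (x - x')) (locally_ball x' (mkposreal _ Hp)))
      as [d Hd].
    specialize (Hd x (ball_center x d) Hx). lra. }
  subst x'. destruct (H eps (cond_pos eps)) as [d [Hd0 Hd]].
  exists (mkposreal d Hd0). intros y Hy HyI.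
  refine (Rle_trans _ _ _ (Req_le _ _ (E y)) _). exact (Hd y HyI Hy).
Qed.

Lemma is_deriv01_unique (u : R -> C) (x : R) (l l' : C) : I01 x ->
  is_deriv01 u x l -> is_deriv01 u x l' -> l = l'.
Proof.
intros Hx H H'. rewrite is_deriv01_eps in H, H' by exact Hx.
assert (E : Cmod (l' - l)%C = 0).
{ apply Rle_antisym; [|apply Cmod_ge_0]. apply le_epsilon. intros eps Heps.
  destruct (H (eps / 2) ltac:(lra)) as [d [Hd Hd']].
  destruct (H' (eps / 2) ltac:(lra)) as [e [He He']].
  assert (Hy : exists y, I01 y /\ 0 < Rabs (y - x) < Rmin d e).
  { set (h := Rmin (Rmin d e) 1 / 2).
    assert (0 < h) by (unfold h; apply Rdiv_lt_0_compat; [repeat apply Rmin_glb_lt; lra|lra]).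
    assert (h < Rmin d e) by (unfold h; pose proof (Rmin_l (Rmin d e) 1);
      assert (0 < Rmin d e) by (apply Rmin_glb_lt; lra); lra).
    assert (h <= 1 / 2) by (unfold h; pose proof (Rmin_r (Rmin d e) 1); lra).
    unfold I01 in *. destruct (Rle_dec x (1 / 2)).
    - exists (x + h). replace (x + h - x) with h by ring. rewrite Rabs_right; lra.
    - exists (x - h). replace (x - h - x) with (- h) by ring. rewrite Rabs_Ropp, Rabs_right; lra. }
  destruct Hy as (y & HyI & Hy0 & Hy).
  specialize (Hd' y HyI (Rlt_le_trans _ _ _ Hy (Rmin_l _ _))).
  specialize (He' y HyI (Rlt_le_trans _ _ _ Hy (Rmin_r _ _))).
  apply Rmult_le_reg_l with (Rabs (y - x)); [exact Hy0|].
  rewrite <- (Cmod_R (y - x)), <- Cmod_mult.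
  replace (RtoC (y - x) * (l' - l))%C with
    ((u y - u x - RtoC (y - x) * l) + - (u y - u x - RtoC (y - x) * l'))%C by ring.
  eapply Rle_trans; [apply Cmod_triangle|]. rewrite Cmod_opp, Cmod_R. lra. }
apply Cmod_eq_0 in E. replace l' with (l' - l + l)%C by ring. rewrite E. ring.
Qed.

Lemma deriv01_eq (u : R -> C) (x : R) (l : C) : I01 x -> is_deriv01 u x l -> deriv01 u x = l.
Proof.
intros Hx H. apply (iota_unique (V := C_R_CompleteNormedModule)); [|exact H].
intros y Hy. now apply (is_deriv01_unique u x).
Qed.

Lemma is_derive_eps (f : R -> R) (x l : R) : is_derive f x l <->
  forall eps, 0 < eps -> exists d, 0 < d /\ forall y, Rabs (y - x) < d ->
    Rabs (f y - f x - (y - x) * l) <= eps * Rabs (y - x).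
Proof.
split.
- intros [_ H] eps Heps.
  destruct (H x (fun P HP => HP) (mkposreal eps Heps)) as [d Hd].
  exists d. split; [apply cond_pos|exact Hd].
- intros H. split; [apply is_linear_scal_l|].
  intros x' Hx' eps.
  pose proof (is_filter_lim_locally_unique (V := R_NormedModule) x x' Hx') as Ex. subst x'.
  destruct (H eps (cond_pos eps)) as [d [Hd0 Hd]].
  exists (mkposreal d Hd0). exact Hd.
Qed.

Lemma components_is_deriv01 (u : R -> C) (p q : R -> R) (x p' q' : R) : components u p q ->
  I01 x -> is_derive p x p' -> is_derive q x q' -> is_deriv01 u x (p', q').
Proof.
intros Hu Hx Hp Hq. apply is_deriv01_eps; [exact Hx|]. intros eps Heps.
rewrite is_derive_eps in Hp, Hq.
destruct (Hp (eps / 2) ltac:(lra)) as [d [Hd Hd']].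
destruct (Hq (eps / 2) ltac:(lra)) as [e [He He']].
exists (Rmin d e). split; [now apply Rmin_glb_lt|]. intros y Hy Hyx.
specialize (Hd' y (Rlt_le_trans _ _ _ Hyx (Rmin_l _ _))).
specialize (He' y (Rlt_le_trans _ _ _ Hyx (Rmin_r _ _))).
rewrite (Hu y Hy), (Hu x Hx).
replace ((p y, q y) - (p x, q x) - RtoC (y - x) * (p', q'))%C
  with ((p y - p x - (y - x) * p')%R, (q y - q x - (y - x) * q')%R)
  by (apply injective_projections; simpl; ring).
eapply Rle_trans; [apply Cmod_pair_le|]. lra.
Qed.

Lemma components_deriv01 (u : R -> C) (p q p' q' : R -> R) : components u p q ->
  (forall x, is_derive p x (p' x)) -> (forall x, is_derive q x (q' x)) ->
  components (deriv01 u) p' q'.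
Proof.
intros Hu Hp Hq x Hx. apply deriv01_eq; [exact Hx|].
now apply (components_is_deriv01 u p q).
Qed.

Lemma Ck01_0_intro (u : R -> C) (p q : R -> R) : components u p q ->
  (forall x, continuous p x) -> (forall x, continuous q x) -> Ck01 0 u.
Proof.
intros Hu Hp Hq x Hx. apply filterlim_locally. intros eps.
destruct (proj1 (filterlim_locally _ _) (Hp x) eps) as [d Hd].
destruct (proj1 (filterlim_locally _ _) (Hq x) eps) as [e He].
assert (Hm : 0 < Rmin d e) by (apply Rmin_glb_lt; apply cond_pos).
exists (mkposreal _ Hm). intros y Hy HyI.
rewrite (Hu y HyI), (Hu x Hx). split; simpl.
- apply Hd. exact (Rlt_le_trans _ _ _ Hy (Rmin_l _ _)).
- apply He. exact (Rlt_le_trans _ _ _ Hy (Rmin_r _ _)).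
Qed.

Lemma Ck01_S_intro (k : nat) (u : R -> C) (p q p' q' : R -> R) : components u p q ->
  (forall x, is_derive p x (p' x)) -> (forall x, is_derive q x (q' x)) ->
  Ck01 k (deriv01 u) -> Ck01 (S k) u.
Proof.
intros Hu Hp Hq Hk. split; [|exact Hk]. intros x Hx.
exists (p' x, q' x). now apply (components_is_deriv01 u p q).
Qed.

(** Composition with [clamp] extends a function from [0,1] to the line by constants. This keeps
    continuity, but in general not differentiability at the end points. *)
Definition clamp (x : R) : R := Rmax 0 (Rmin 1 x).

Lemma clamp_I01 x : I01 (clamp x).
Proof.
unfold I01, clamp. split; [apply Rmax_l|]. apply Rmax_lub; [lra|apply Rmin_l].
Qed.

Lemma clamp_id x : 0 <= x <= 1 -> clamp x = x.
Proof. intros Hx. unfold clamp. rewrite Rmin_right, Rmax_right; lra. Qed.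

Lemma clamp_lipschitz x y : Rabs (clamp y - clamp x) <= Rabs (y - x).
Proof.
unfold clamp, Rmax, Rmin.
repeat destruct Rle_dec; unfold Rabs; repeat destruct Rcase_abs; lra.
Qed.

Lemma continuous_on_clamp (u : R -> C) : continuous_on I01 u ->
  (forall x, continuous (fun x => fst (u (clamp x))) x) /\
  (forall x, continuous (fun x => snd (u (clamp x))) x).
Proof.
intros Hu.
assert (H : forall x (eps : posreal), exists d : posreal, forall y, Rabs (y - x) < d ->
  ball (u (clamp x)) eps (u (clamp y))).
{ intros x eps. destruct (proj1 (filterlim_locally _ _) (Hu _ (clamp_I01 x)) eps) as [d Hd].
  exists d. intros y Hy. apply Hd; [|apply clamp_I01].
  exact (Rle_lt_trans _ _ _ (clamp_lipschitz x y) Hy). }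
split; intros x; apply filterlim_locally; intros eps; destruct (H x eps) as [d Hd];
  exists d; intros y Hy; apply (Hd y Hy).
Qed.

Lemma Ck01_0_elim (u : R -> C) : Ck01 0 u -> exists p q,
  components u p q /\ (forall x, continuous p x) /\ (forall x, continuous q x).
Proof.
intros Hu. destruct (continuous_on_clamp u Hu) as [Hp Hq].
exists (fun x => fst (u (clamp x))), (fun x => snd (u (clamp x))).
split; [|now split]. intros x Hx. rewrite clamp_id by exact Hx. now destruct (u x).
Qed.

Lemma is_derive_primitive (h : R -> R) (k x : R) : (forall x, continuous h x) ->
  is_derive (fun x => k + RInt h 0 x) x (h x).
Proof.
intros Hh. replace (h x) with (plus 0 (h x)) by exact (Rplus_0_l _).
apply (is_derive_plus (V := R_NormedModule) (fun _ => k) (fun x => RInt h 0 x)).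
- exact (is_derive_const (V := R_NormedModule) k x).
- apply (is_derive_RInt h _ 0); [|apply Hh]. apply filter_forall. intros y.
  apply (RInt_correct (V := R_CompleteNormedModule)). now apply ex_RInt_of_continuous.
Qed.

Lemma eq_on_I01_of_derive (f g df : R -> R) : (forall x, continuous f x) ->
  (forall x, continuous g x) -> (forall x, 0 < x < 1 -> is_derive f x (df x)) ->
  (forall x, 0 < x < 1 -> is_derive g x (df x)) -> f 0 = g 0 ->
  forall x, 0 <= x <= 1 -> f x = g x.
Proof.
intros Cf Cg Df Dg H0 x Hx.
destruct (MVT_gen (fun t => f t - g t) 0 x (fun _ => 0)) as [c [_ E]].
- rewrite Rmin_left, Rmax_right by lra. intros y Hy.
  pose proof (is_derive_minus (V := R_NormedModule) f g y _ _
    (Df y ltac:(lra)) (Dg y ltac:(lra))) as D.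
  exact (eq_rect _ (fun l : R => is_derive (fun t => f t - g t) y l) D 0 (Rminus_diag (df y))).
- intros y _. apply continuity_pt_filterlim. apply Rcontinuous_minus; [apply Cf|apply Cg].
- lra.
Qed.

Lemma is_deriv01_continuous (u : R -> C) : (forall x, I01 x -> exists l, is_deriv01 u x l) ->
  continuous_on I01 u.
Proof.
intros H x Hx. destruct (H x Hx) as [l Hl]. rewrite is_deriv01_eps in Hl by exact Hx.
destruct (Hl 1 Rlt_0_1) as [d [Hd Hd']].
apply filterlim_locally. intros eps.
set (k := 1 + Cmod l). assert (Hk : 0 < k) by (unfold k; pose proof (Cmod_ge_0 l); lra).
assert (Hm : 0 < Rmin d (eps / k)).
{ apply Rmin_glb_lt; [exact Hd|]. apply Rdiv_lt_0_compat; [apply cond_pos|exact Hk]. }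
exists (mkposreal _ Hm). intros y Hy HyI. change (Rabs (y - x) < Rmin d (eps / k)) in Hy.
specialize (Hd' y HyI (Rlt_le_trans _ _ _ Hy (Rmin_l _ _))).
pose proof (Rlt_le_trans _ _ _ Hy (Rmin_r _ _)) as Hy2.
assert (B : Cmod (u y - u x)%C < eps).
{ replace (u y - u x)%C with ((u y - u x - RtoC (y - x) * l) + RtoC (y - x) * l)%C by ring.
  eapply Rle_lt_trans; [apply Cmod_triangle|]. rewrite Cmod_mult, Cmod_R.
  apply Rle_lt_trans with (k * Rabs (y - x)); [unfold k; lra|].
  apply Rlt_le_trans with (k * (eps / k)); [apply Rmult_lt_compat_l; lra|].
  apply Req_le. field. lra. }
split.
- eapply Rle_lt_trans; [exact (Rabs_fst_le_Cmod (u y - u x)%C)|exact B].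
- eapply Rle_lt_trans; [exact (Rabs_snd_le_Cmod (u y - u x)%C)|exact B].
Qed.

Lemma is_deriv01_interior (u : R -> C) (x : R) (l : C) : 0 < x < 1 -> is_deriv01 u x l ->
  is_derive (fun x => fst (u (clamp x))) x (fst l) /\
  is_derive (fun x => snd (u (clamp x))) x (snd l).
Proof.
intros Hx Hl. rewrite is_deriv01_eps in Hl by (unfold I01; lra).
split; apply is_derive_eps; intros eps Heps; destruct (Hl eps Heps) as [d [Hd Hd']];
  (exists (Rmin d (Rmin x (1 - x)));
   split; [repeat apply Rmin_glb_lt; lra|]; intros y Hy;
   pose proof (Rlt_le_trans _ _ _ Hy (Rmin_l _ _)) as Hy1;
   pose proof (Rlt_le_trans _ _ _ Hy (Rmin_r _ _)) as Hy2;
   pose proof (Rmin_l x (1 - x)); pose proof (Rmin_r x (1 - x));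
   assert (HyI : 0 <= y <= 1) by (apply Rabs_def2 in Hy2; lra);
   specialize (Hd' y HyI Hy1);
   rewrite (clamp_id y HyI), (clamp_id x) by lra).
- eapply Rle_trans; [|exact Hd']. eapply Rle_trans; [|apply Rabs_fst_le_Cmod].
  apply Req_le. f_equal. simpl. ring.
- eapply Rle_trans; [|exact Hd']. eapply Rle_trans; [|apply Rabs_snd_le_Cmod].
  apply Req_le. f_equal. simpl. ring.
Qed.

(** One-sided derivatives become ordinary ones: [p] and [q] are primitives of the already extended
    derivatives. They agree with [u] on [0,1] because the derivatives agree inside and the values
    agree at [0]. *)
Lemma Ck01_S_elim (k : nat) (u : R -> C) (p' q' : R -> R) : Ck01 (S k) u ->
  components (deriv01 u) p' q' -> (forall x, continuous p' x) -> (forall x, continuous q' x) ->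
  exists p q, components u p q /\
    (forall x, is_derive p x (p' x)) /\ (forall x, is_derive q x (q' x)).
Proof.
intros [Hex _] Hd Hp Hq.
exists (fun x => fst (u 0) + RInt p' 0 x), (fun x => snd (u 0) + RInt q' 0 x).
split; [|split; intros x; now apply is_derive_primitive].
destruct (continuous_on_clamp u (is_deriv01_continuous u Hex)) as [Cp Cq].
assert (H : forall x, 0 < x < 1 ->
  is_derive (fun x => fst (u (clamp x))) x (p' x) /\
  is_derive (fun x => snd (u (clamp x))) x (q' x)).
{ intros x Hx. assert (HxI : I01 x) by (unfold I01; lra).
  destruct (Hex x HxI) as [l Hl]. pose proof (deriv01_eq u x l HxI Hl) as E.
  rewrite (Hd x HxI) in E. subst l. exact (is_deriv01_interior u x _ Hx Hl). }
assert (R0 : forall h, RInt h 0 0 = 0) by (intros h; exact (RInt_point 0 h)).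
intros x Hx. rewrite <- (clamp_id x Hx) at 1. apply injective_projections; simpl.
- apply (eq_on_I01_of_derive (fun x => fst (u (clamp x))) (fun x => fst (u 0) + RInt p' 0 x) p');
    [exact Cp| |now intros; apply H|now intros; apply is_derive_primitive| |exact Hx].
  + intros y. exact (is_derive_continuous _ _ _ (is_derive_primitive p' (fst (u 0)) y Hp)).
  + rewrite clamp_id, R0 by lra. ring.
- apply (eq_on_I01_of_derive (fun x => snd (u (clamp x))) (fun x => snd (u 0) + RInt q' 0 x) q');
    [exact Cq| |now intros; apply H|now intros; apply is_derive_primitive| |exact Hx].
  + intros y. exact (is_derive_continuous _ _ _ (is_derive_primitive q' (snd (u 0)) y Hq)).
  + rewrite clamp_id, R0 by lra. ring.
Qed.

(** * Division by the variable, and membership in the pre-Hilbert spaces *)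

Lemma hadamard_C0 (v v1 : R -> R) : (forall x, is_derive v x (v1 x)) -> v 0 = 0 ->
  exists a, (forall x, continuous a x) /\ (forall x, v x = x * a x) /\ a 0 = v1 0.
Proof.
intros Hv H0.
set (a := fun x => if Req_EM_T x 0 then v1 0 else v x / x).
assert (Ha : forall x, v x = x * a x).
{ intros x. unfold a. destruct (Req_EM_T x 0) as [->|Hx]; [lra|field; exact Hx]. }
assert (Ha0 : a 0 = v1 0) by (unfold a; destruct (Req_EM_T 0 0); [reflexivity|lra]).
exists a. split; [|split; assumption].
intros x. destruct (Req_EM_T x 0) as [->|Hx].
- apply filterlim_locally. intros eps. rewrite Ha0.
  destruct (proj1 (is_derive_eps v 0 (v1 0)) (Hv 0) (eps / 2)) as [d [Hd Hd']].
  { pose proof (cond_pos eps). lra. }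
  exists (mkposreal d Hd). intros y Hy. change (Rabs (a y - v1 0) < eps).
  specialize (Hd' y Hy). rewrite H0, !Rminus_0_r, (Ha y) in Hd'.
  destruct (Req_EM_T y 0) as [->|Hy0].
  + rewrite Ha0, Rminus_diag, Rabs_R0. apply cond_pos.
  + assert (Hp : 0 < Rabs y) by (now apply Rabs_pos_lt).
    rewrite <- Rmult_minus_distr_l, Rabs_mult in Hd'. pose proof (cond_pos eps). nra.
- apply (continuous_ext_loc a (fun y => v y / y) x).
  + exists (mkposreal _ (Rabs_pos_lt x Hx)). intros y Hy. change (Rabs (y - x) < Rabs x) in Hy.
    unfold a. destruct (Req_EM_T y 0) as [->|Hy0]; [|reflexivity].
    rewrite Rminus_0_l, Rabs_Ropp in Hy. lra.
  + apply Rcontinuous_div; [|apply Rcontinuous_id|exact Hx].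
    exact (is_derive_continuous _ _ _ (Hv x)).
Qed.

(** Division by [x] costs one derivative. Applied to [u1'], which is of class C^2 on the domain of
    [L0_tilde], it makes the coordinate [a = u1' / rho] of class C^1. *)
Lemma hadamard_C1 (v v1 v2 : R -> R) : (forall x, is_derive v x (v1 x)) ->
  (forall x, is_derive v1 x (v2 x)) -> (forall x, continuous v2 x) -> v 0 = 0 ->
  exists a a1, (forall x, is_derive a x (a1 x)) /\ (forall x, continuous a1 x) /\
    (forall x, v x = x * a x) /\ a 0 = v1 0.
Proof.
intros Hv Hv1 Hc H0. destruct (hadamard_C0 v v1 Hv H0) as (a & Ca & Ha & Ha0).
set (a1 := fun x => if Req_EM_T x 0 then v2 0 / 2 else (v1 x - a x) / x).
exists a, a1.
(* Taylor remainders at [0] in little-o form, since [v2] is only continuous. The mean value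
   inequality passes from [v2] to [v1] and again from [v1] to [v]. *)
assert (T : forall eps, 0 < eps -> exists d, 0 < d /\ forall x, Rabs x < d ->
  Rabs (v1 x - v1 0 - v2 0 * x) <= eps * Rabs x /\
  Rabs (v x - v1 0 * x - v2 0 / 2 * x ^ 2) <= eps * Rabs x * Rabs x).
{ intros eps Heps.
  destruct (proj1 (filterlim_locally _ _) (Hc 0) (mkposreal eps Heps)) as [d Hd].
  assert (T1 : forall x, Rabs x < d -> Rabs (v1 x - v1 0 - v2 0 * x) <= eps * Rabs x).
  { intros x Hx.
    pose proof (bounded_variation (fun x => v1 x - v1 0 - v2 0 * x) (fun x => v2 x - v2 0)
      eps 0 x) as B.
    cbv beta in B. rewrite Rmult_0_r, !Rminus_0_r, Rminus_diag, Rminus_0_r in B. apply B.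
    intros t Ht. rewrite Rminus_0_r in Ht. split.
    - auto_derive; [exact (ex_intro _ _ (Hv1 t))|].
      rewrite (is_derive_unique (fun y : R => v1 y) t _ (Hv1 t)). ring.
    - left. apply (Hd t). change (Rabs (t - 0) < d). rewrite Rminus_0_r. lra. }
  exists d. split; [apply cond_pos|]. intros x Hx. split; [now apply T1|].
  pose proof (bounded_variation (fun x => v x - v1 0 * x - v2 0 / 2 * x ^ 2)
     (fun x => v1 x - v1 0 - v2 0 * x) (eps * Rabs x) 0 x) as B.
  cbv beta in B. rewrite H0 in B.
  replace (0 - v1 0 * 0 - v2 0 / 2 * 0 ^ 2) with 0 in B by field.
  rewrite !Rminus_0_r in B. apply B.
  intros t Ht. rewrite Rminus_0_r in Ht. split.
  - auto_derive; [exact (ex_intro _ _ (Hv t))|].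
    rewrite (is_derive_unique (fun y : R => v y) t _ (Hv t)). field.
  - eapply Rle_trans; [apply T1; lra|]. apply Rmult_le_compat_l; lra. }
assert (A : forall x, is_derive a x (a1 x)).
{ intros x. unfold a1. destruct (Req_EM_T x 0) as [->|Hx].
  - apply is_derive_eps. intros eps Heps. destruct (T eps Heps) as [d [Hd Hd']].
    exists d. split; [exact Hd|]. intros y Hy. rewrite Rminus_0_r in Hy |- *.
    destruct (Hd' y Hy) as [_ B]. rewrite (Ha y) in B.
    replace (y * a y - v1 0 * y - v2 0 / 2 * y ^ 2) with (y * (a y - a 0 - y * (v2 0 / 2)))
      in B by (rewrite Ha0; field).
    rewrite Rabs_mult in B. destruct (Req_EM_T y 0) as [->|Hy0].
    + rewrite Rmult_0_l, Rminus_diag, Rminus_0_r, Rabs_R0. lra.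
    + assert (Hp : 0 < Rabs y) by (now apply Rabs_pos_lt). nra.
  - apply (is_derive_ext_loc (fun y => v y / y)).
    + exists (mkposreal _ (Rabs_pos_lt x Hx)). intros y Hy. change (Rabs (y - x) < Rabs x) in Hy.
      change (@eq R (v y / y) (a y)). rewrite Ha. field. intros ->. rewrite Rminus_0_l, Rabs_Ropp in Hy. lra.
    + auto_derive; [repeat split; [exact (ex_intro _ _ (Hv x))|exact Hx]|].
      rewrite (is_derive_unique (fun y : R => v y) x _ (Hv x)), (Ha x). field. exact Hx. }
split; [exact A|]. split; [|split; assumption].
intros x. destruct (Req_EM_T x 0) as [->|Hx].
- apply filterlim_locally. intros eps.
  destruct (T (eps / 3)) as [d [Hd Hd']]; [pose proof (cond_pos eps); lra|].
  exists (mkposreal d Hd). intros y Hy. change (Rabs (y - 0) < d) in Hy. rewrite Rminus_0_r in Hy.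
  change (Rabs (a1 y - a1 0) < eps). unfold a1.
  destruct (Req_EM_T 0 0) as [_|]; [|lra].
  destruct (Req_EM_T y 0) as [->|Hy0].
  + rewrite Rminus_diag, Rabs_R0. apply cond_pos.
  + destruct (Hd' y Hy) as [B1 B2]. assert (Hp : 0 < Rabs y) by (now apply Rabs_pos_lt).
    set (g1 := v1 y - v1 0 - v2 0 * y) in *.
    set (g := v y - v1 0 * y - v2 0 / 2 * y ^ 2) in *.
    assert (E : y * y * ((v1 y - a y) / y - v2 0 / 2) = y * g1 - g).
    { unfold g1, g. rewrite (Ha y). field. exact Hy0. }
    pose proof (Rabs_triang (y * g1) (- g)) as Tr.
    replace (y * g1 + - g) with (y * g1 - g) in Tr by ring.
    rewrite <- E, Rabs_Ropp, !Rabs_mult in Tr.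
    set (z := Rabs ((v1 y - a y) / y - v2 0 / 2)) in *.
    assert (Rabs y * Rabs g1 <= Rabs y * (eps / 3 * Rabs y)) by (apply Rmult_le_compat_l; lra).
    assert (Rabs y * Rabs y * z <= Rabs y * Rabs y * (2 * (eps / 3))) by lra.
    apply Rmult_le_reg_l in H1; [|nra]. pose proof (cond_pos eps). lra.
- apply (continuous_ext_loc a1 (fun y => (v1 y - a y) / y) x).
  + exists (mkposreal _ (Rabs_pos_lt x Hx)). intros y Hy. change (Rabs (y - x) < Rabs x) in Hy.
    unfold a1. destruct (Req_EM_T y 0) as [->|Hy0]; [|reflexivity].
    rewrite Rminus_0_l, Rabs_Ropp in Hy. lra.
  + apply Rcontinuous_div; [|apply Rcontinuous_id|exact Hx].
    apply Rcontinuous_minus; [|apply Ca]. exact (is_derive_continuous _ _ _ (Hv1 x)).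
Qed.

Lemma CRInt_pair (h : R -> C) (p q : R -> R) (a b I J : R) : a <= b ->
  (forall t, a < t < b -> h t = (p t, q t)) -> is_RInt p a b I -> is_RInt q a b J ->
  CRInt h a b = (I, J).
Proof.
intros Hab Hh Hp Hq. apply (is_RInt_unique (V := C_R_CompleteNormedModule)).
apply (is_RInt_ext (V := C_R_NormedModule) (fun t => (p t, q t))).
- rewrite Rmin_left, Rmax_right by exact Hab. intros t Ht. symmetry. now apply Hh.
- apply (is_RInt_fct_extend_pair (U := R_NormedModule) (V := R_NormedModule)
    (fun t => (p t, q t))); assumption.
Qed.

Lemma is_RInt_of_continuous (f : R -> R) (a b : R) : (forall x, continuous f x) ->
  is_RInt f a b (RInt f a b).
Proof.
intros H. apply (RInt_correct (V := R_CompleteNormedModule)). now apply ex_RInt_of_continuous.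
Qed.

Lemma preH1_intro (u : R -> C) (p q a b p2 q2 : R -> R) : components u p q ->
  (forall x, is_derive p x (x * a x)) -> (forall x, is_derive q x (x * b x)) ->
  (forall x, is_derive (fun x => x * a x) x (p2 x)) ->
  (forall x, is_derive (fun x => x * b x) x (q2 x)) ->
  (forall x, continuous p2 x) -> (forall x, continuous q2 x) -> p 0 = 0 -> q 0 = 0 -> preH1 u.
Proof.
intros Hu Hp Hq Hp1 Hq1 Cp Cq p0 q0.
pose proof (components_deriv01 u p q _ _ Hu Hp Hq) as D1.
pose proof (components_deriv01 _ _ _ _ _ D1 Hp1 Hq1) as D2.
split; [|split].
- apply (Ck01_S_intro 1 u p q _ _ Hu Hp Hq).
  apply (Ck01_S_intro 0 _ _ _ _ _ D1 Hp1 Hq1). now apply (Ck01_0_intro _ p2 q2).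
- rewrite Hu, p0, q0 by lra. reflexivity.
- rewrite D1, !Rmult_0_l by lra. reflexivity.
Qed.

Lemma preH1_elim (u : R -> C) : preH1 u -> exists p q a b p2 q2, components u p q /\
  (forall x, is_derive p x (x * a x)) /\ (forall x, is_derive q x (x * b x)) /\
  (forall x, is_derive (fun x => x * a x) x (p2 x)) /\
  (forall x, is_derive (fun x => x * b x) x (q2 x)) /\
  (forall x, continuous p2 x) /\ (forall x, continuous q2 x) /\
  (forall x, continuous a x) /\ (forall x, continuous b x) /\ p 0 = 0 /\ q 0 = 0.
Proof.
intros [Hk [u0 u1]].
destruct (Ck01_0_elim _ (proj2 (proj2 Hk))) as (p2 & q2 & D2 & Cp & Cq).
destruct (Ck01_S_elim 0 _ _ _ (proj2 Hk) D2 Cp Cq) as (p1 & q1 & D1 & Hp1 & Hq1).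
destruct (Ck01_S_elim 1 u p1 q1 Hk D1) as (p & q & Hu & Hp & Hq).
{ intros x. exact (is_derive_continuous _ _ _ (Hp1 x)). }
{ intros x. exact (is_derive_continuous _ _ _ (Hq1 x)). }
rewrite Hu in u0 by lra. rewrite D1 in u1 by lra.
injection u0 as p0 q0. injection u1 as p10 q10.
destruct (hadamard_C0 p1 p2 Hp1 p10) as (a & Ca & Ea & _).
destruct (hadamard_C0 q1 q2 Hq1 q10) as (b & Cb & Eb & _).
exists p, q, a, b, p2, q2. split; [exact Hu|].
split; [intros x; rewrite <- Ea; apply Hp|]. split; [intros x; rewrite <- Eb; apply Hq|].
split; [intros x; apply (is_derive_ext p1); [exact Ea|apply Hp1]|].
split; [intros x; apply (is_derive_ext q1); [exact Eb|apply Hq1]|].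
tauto.
Qed.

Lemma preH2_intro (u : R -> C) (p q a b : R -> R) : components u p q ->
  (forall x, is_derive p x (a x)) -> (forall x, is_derive q x (b x)) ->
  (forall x, continuous a x) -> (forall x, continuous b x) -> p 0 = 0 -> q 0 = 0 -> preH2 u.
Proof.
intros Hu Hp Hq Cp Cq p0 q0.
pose proof (components_deriv01 u p q _ _ Hu Hp Hq) as D1. split.
- apply (Ck01_S_intro 0 u p q _ _ Hu Hp Hq). now apply (Ck01_0_intro _ a b).
- rewrite Hu, p0, q0 by lra. reflexivity.
Qed.

Lemma preH2_elim (u : R -> C) : preH2 u -> exists p q a b, components u p q /\
  (forall x, is_derive p x (a x)) /\ (forall x, is_derive q x (b x)) /\
  (forall x, continuous a x) /\ (forall x, continuous b x) /\ p 0 = 0 /\ q 0 = 0.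
Proof.
intros [Hk u0].
destruct (Ck01_0_elim _ (proj2 Hk)) as (a & b & D1 & Ca & Cb).
destruct (Ck01_S_elim 0 u a b Hk D1 Ca Cb) as (p & q & Hu & Hp & Hq).
rewrite Hu in u0 by lra. injection u0 as p0 q0.
exists p, q, a, b. tauto.
Qed.

Lemma components_plus (u v : R -> C) (p q p' q' : R -> R) : components u p q ->
  components v p' q' ->
  components (fun x => (u x + v x)%C) (fun x => p x + p' x) (fun x => q x + q' x).
Proof. intros Hu Hv x Hx. now rewrite (Hu x Hx), (Hv x Hx). Qed.

Lemma components_scal (k : C) (u : R -> C) (p q : R -> R) : components u p q ->
  components (fun x => (k * u x)%C)
    (fun x => fst k * p x - snd k * q x) (fun x => fst k * q x + snd k * p x).
Proof. intros Hu x Hx. rewrite (Hu x Hx). reflexivity. Qed.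

Lemma is_derive_Rplus (f g : R -> R) (x l m : R) : is_derive f x l -> is_derive g x m ->
  is_derive (fun x => f x + g x) x (l + m).
Proof. exact (is_derive_plus (V := R_NormedModule) f g x l m). Qed.

Lemma is_derive_lincomb (f g : R -> R) (k k' x l m : R) : is_derive f x l -> is_derive g x m ->
  is_derive (fun x => k * f x + k' * g x) x (k * l + k' * m).
Proof. intros Hf Hg. apply is_derive_Rplus; now apply is_derive_scal. Qed.

Lemma is_derive_value (f : R -> R) (x l m : R) : is_derive f x l -> l = m -> is_derive f x m.
Proof. now intros H <-. Qed.

Lemma preH1_plus (u v : R -> C) : preH1 u -> preH1 v -> preH1 (fun x => (u x + v x)%C).
Proof.
intros Hu Hv.
destruct (preH1_elim u Hu) as (p & q & a & b & p2 & q2 & E & H1 & H2 & H3 & H4 & H5 & H6 & _ & _ & H7 & H8).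
destruct (preH1_elim v Hv) as (p' & q' & a' & b' & p2' & q2' & E' & H1' & H2' & H3' & H4' & H5' & H6' & _ & _ & H7' & H8').
apply (preH1_intro _ (fun x => p x + p' x) (fun x => q x + q' x) (fun x => a x + a' x)
  (fun x => b x + b' x) (fun x => p2 x + p2' x) (fun x => q2 x + q2' x)).
- now apply components_plus.
- intros x. rewrite Rmult_plus_distr_l. now apply is_derive_Rplus.
- intros x. rewrite Rmult_plus_distr_l. now apply is_derive_Rplus.
- intros x. apply (is_derive_ext (fun x => x * a x + x * a' x)).
  + intros t. symmetry. apply Rmult_plus_distr_l.
  + now apply is_derive_Rplus.
- intros x. apply (is_derive_ext (fun x => x * b x + x * b' x)).
  + intros t. symmetry. apply Rmult_plus_distr_l.
  + now apply is_derive_Rplus.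
- intros x. rcont.
- intros x. rcont.
- lra.
- lra.
Qed.

Lemma preH1_scal (k : C) (u : R -> C) : preH1 u -> preH1 (fun x => (k * u x)%C).
Proof.
intros Hu.
destruct (preH1_elim u Hu) as (p & q & a & b & p2 & q2 & E & H1 & H2 & H3 & H4 & H5 & H6 & _ & _ & H7 & H8).
assert (D : forall (f g f1 g1 : R -> R) (k k' : R), (forall x, is_derive f x (f1 x)) ->
  (forall x, is_derive g x (g1 x)) ->
  forall x, is_derive (fun x => k * f x + k' * g x) x (k * f1 x + k' * g1 x))
  by (intros; now apply is_derive_lincomb).
assert (T : forall a b k k', forall x, x * (k * a x + k' * b x) = k * (x * a x) + k' * (x * b x))
  by (intros; ring).
apply (preH1_intro _ (fun x => fst k * p x + - snd k * q x) (fun x => fst k * q x + snd k * p x)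
  (fun x => fst k * a x + - snd k * b x) (fun x => fst k * b x + snd k * a x)
  (fun x => fst k * p2 x + - snd k * q2 x) (fun x => fst k * q2 x + snd k * p2 x)).
- intros x Hx. rewrite (components_scal k u p q E x Hx). f_equal; ring.
- intros x. rewrite T. exact (D p q _ _ _ _ H1 H2 x).
- intros x. rewrite T. exact (D q p _ _ _ _ H2 H1 x).
- intros x. apply (is_derive_ext (fun x => fst k * (x * a x) + - snd k * (x * b x))).
  + intros t. symmetry. apply T.
  + exact (D _ _ _ _ _ _ H3 H4 x).
- intros x. apply (is_derive_ext (fun x => fst k * (x * b x) + snd k * (x * a x))).
  + intros t. symmetry. apply T.
  + exact (D _ _ _ _ _ _ H4 H3 x).
- intros x. rcont.
- intros x. rcont.
- rewrite H7, H8. ring.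
- rewrite H7, H8. ring.
Qed.

Lemma preH2_plus (u v : R -> C) : preH2 u -> preH2 v -> preH2 (fun x => (u x + v x)%C).
Proof.
intros Hu Hv.
destruct (preH2_elim u Hu) as (p & q & a & b & E & H1 & H2 & H3 & H4 & H5 & H6).
destruct (preH2_elim v Hv) as (p' & q' & a' & b' & E' & H1' & H2' & H3' & H4' & H5' & H6').
apply (preH2_intro _ (fun x => p x + p' x) (fun x => q x + q' x) (fun x => a x + a' x)
  (fun x => b x + b' x)).
- now apply components_plus.
- intros x. now apply is_derive_Rplus.
- intros x. now apply is_derive_Rplus.
- intros x. rcont.
- intros x. rcont.
- lra.
- lra.
Qed.

Lemma preH2_scal (k : C) (u : R -> C) : preH2 u -> preH2 (fun x => (k * u x)%C).
Proof.
intros Hu.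
destruct (preH2_elim u Hu) as (p & q & a & b & E & H1 & H2 & H3 & H4 & H5 & H6).
apply (preH2_intro _ (fun x => fst k * p x + - snd k * q x) (fun x => fst k * q x + snd k * p x)
  (fun x => fst k * a x + - snd k * b x) (fun x => fst k * b x + snd k * a x)).
- intros x Hx. rewrite (components_scal k u p q E x Hx). f_equal; ring.
- intros x. now apply is_derive_lincomb.
- intros x. now apply is_derive_lincomb.
- intros x. rcont.
- intros x. rcont.
- rewrite H5, H6. ring.
- rewrite H5, H6. ring.
Qed.

(** * Norms in the completions *)

Section Completions.
Context {H1 H2 : CompleteNormedModule C_AbsRing} (i1 : (R -> C) -> H1) (i2 : (R -> C) -> H2).
Hypothesis hH1 : is_completion preH1 ip1 i1.
Hypothesis hH2 : is_completion preH2 ip2 i2.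

Lemma norm_i1 (u : R -> C) (p q a b : R -> R) : preH1 u -> components u p q ->
  (forall x, is_derive p x (x * a x)) -> (forall x, is_derive q x (x * b x)) ->
  (forall x, continuous a x) -> (forall x, continuous b x) ->
  norm (i1 u) = sqrt (RInt (fun x => a x ^ 2) 0 1 + RInt (fun x => b x ^ 2) 0 1).
Proof.
intros Hu E Hp Hq Ca Cb. rewrite (completion_norm _ _ _ _ hH1 u Hu). f_equal.
pose proof (components_deriv01 u p q _ _ E Hp Hq) as D.
unfold ip1. erewrite (CRInt_pair _ (fun x => a x ^ 2 + b x ^ 2) (fun _ => 0)).
- reflexivity.
- lra.
- intros t Ht. rewrite (D t) by lra.
  assert (Ht2 : RtoC (t ^ 2) <> RtoC 0).
  { intros Et. injection Et as Et. nra. }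
  replace (a t ^ 2 + b t ^ 2, 0) with (RtoC (t ^ 2) * RtoC (a t ^ 2 + b t ^ 2) / RtoC (t ^ 2))%C
    by (field_simplify; [reflexivity|exact Ht2]).
  unfold Cdiv. f_equal. apply injective_projections; simpl; ring.
- apply (is_RInt_plus (V := R_NormedModule)); apply is_RInt_of_continuous; intros; rcont.
- apply (is_RInt_const (V := R_NormedModule)).
Qed.

Lemma norm_i2 (u : R -> C) (p q a b : R -> R) : preH2 u -> components u p q ->
  (forall x, is_derive p x (a x)) -> (forall x, is_derive q x (b x)) ->
  (forall x, continuous a x) -> (forall x, continuous b x) ->
  norm (i2 u) = sqrt (RInt (fun x => a x ^ 2) 0 1 + RInt (fun x => b x ^ 2) 0 1).
Proof.
intros Hu E Hp Hq Ca Cb. rewrite (completion_norm _ _ _ _ hH2 u Hu). f_equal.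
pose proof (components_deriv01 u p q _ _ E Hp Hq) as D.
unfold ip2. erewrite (CRInt_pair _ (fun x => a x ^ 2 + b x ^ 2) (fun _ => 0)).
- reflexivity.
- lra.
- intros t Ht. rewrite (D t) by lra. apply injective_projections; simpl; ring.
- apply (is_RInt_plus (V := R_NormedModule)); apply is_RInt_of_continuous; intros; rcont.
- apply (is_RInt_const (V := R_NormedModule)).
Qed.

Lemma RInt_sq_ge_0 (h : R -> R) : (forall x, continuous h x) -> 0 <= RInt (fun x => h x ^ 2) 0 1.
Proof.
intros Hc. apply RInt_ge_0; [lra| |intros; apply pow2_ge_0].
apply ex_RInt_of_continuous. intros. rcont.
Qed.

(** The four squares are grouped by real and imaginary part, not by entry, because the energy
    estimate concerns the pair [(a, b)] of one real component. *)
Lemma norm_embed (u1 u2 : R -> C) (p1 q1 a1 b1 p2 q2 a2 b2 : R -> R) : preH1 u1 -> preH2 u2 ->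
  components u1 p1 q1 -> (forall x, is_derive p1 x (x * a1 x)) ->
  (forall x, is_derive q1 x (x * b1 x)) ->
  (forall x, continuous a1 x) -> (forall x, continuous b1 x) ->
  components u2 p2 q2 -> (forall x, is_derive p2 x (a2 x)) ->
  (forall x, is_derive q2 x (b2 x)) ->
  (forall x, continuous a2 x) -> (forall x, continuous b2 x) ->
  norm (embed i1 i2 u1 u2) ^ 2 =
    RInt (fun x => a1 x ^ 2 + a2 x ^ 2) 0 1 + RInt (fun x => b1 x ^ 2 + b2 x ^ 2) 0 1.
Proof.
intros Hu1 Hu2 E1 Hp1 Hq1 Ca1 Cb1 E2 Hp2 Hq2 Ca2 Cb2.
change (sqrt (norm (i1 u1) ^ 2 + norm (i2 u2) ^ 2) ^ 2 =
  RInt (fun x => a1 x ^ 2 + a2 x ^ 2) 0 1 + RInt (fun x => b1 x ^ 2 + b2 x ^ 2) 0 1).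
rewrite (norm_i1 u1 p1 q1 a1 b1), (norm_i2 u2 p2 q2 a2 b2) by assumption.
pose proof (RInt_sq_ge_0 a1 Ca1). pose proof (RInt_sq_ge_0 b1 Cb1).
pose proof (RInt_sq_ge_0 a2 Ca2). pose proof (RInt_sq_ge_0 b2 Cb2).
rewrite !pow2_sqrt; try lra.
2:{ rewrite !pow2_sqrt; lra. }
assert (S : forall f g : R -> R, (forall x, continuous f x) -> (forall x, continuous g x) ->
  RInt (fun x => f x ^ 2 + g x ^ 2) 0 1 = RInt (fun x => f x ^ 2) 0 1 + RInt (fun x => g x ^ 2) 0 1).
{ intros f g Cf Cg. apply is_RInt_unique.
  apply (is_RInt_plus (V := R_NormedModule)); apply is_RInt_of_continuous; intros; rcont. }
rewrite !S by assumption. ring.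
Qed.

Lemma embed_plus (u1 u2 v1 v2 : R -> C) : preH1 u1 -> preH2 u2 -> preH1 v1 -> preH2 v2 ->
  embed i1 i2 (fun x => (u1 x + v1 x)%C) (fun x => (u2 x + v2 x)%C) =
    plus (embed i1 i2 u1 u2) (embed i1 i2 v1 v2).
Proof.
intros. unfold embed.
rewrite (completion_plus _ _ _ _ hH1), (completion_plus _ _ _ _ hH2) by assumption.
reflexivity.
Qed.

Lemma embed_scal (k : C) (u1 u2 : R -> C) : preH1 u1 -> preH2 u2 ->
  embed i1 i2 (fun x => (k * u1 x)%C) (fun x => (k * u2 x)%C) =
    scal (k : C_AbsRing) (embed i1 i2 u1 u2).
Proof.
intros. unfold embed.
rewrite (completion_scal _ _ _ _ hH1), (completion_scal _ _ _ _ hH2) by assumption.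
reflexivity.
Qed.

End Completions.

(** * The gauge mode and the core of [L0] *)

(** The coordinates [a = g1' / rho] and [b = g2'] of the gauge mode, with their derivatives up to
    order two; [gPsi] is the primitive of [rho g2]. *)
Definition ga (x : R) : R := (6 * x - 2 * x ^ 3) / (1 + x ^ 2) ^ 3.
Definition dga (x : R) : R := (6 - 36 * x ^ 2 + 6 * x ^ 4) / (1 + x ^ 2) ^ 4.
Definition d2ga (x : R) : R := (- 120 * x + 240 * x ^ 3 - 24 * x ^ 5) / (1 + x ^ 2) ^ 5.
Definition gb (x : R) : R := (3 - 6 * x ^ 2 - x ^ 4) / (1 + x ^ 2) ^ 3.
Definition dgb (x : R) : R := (- 30 * x + 20 * x ^ 3 + 2 * x ^ 5) / (1 + x ^ 2) ^ 4.
Definition d2gb (x : R) : R :=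
  (- 30 + 270 * x ^ 2 - 90 * x ^ 4 - 6 * x ^ 6) / (1 + x ^ 2) ^ 5.
Definition gu1 (x : R) : R := 2 * x ^ 3 / (1 + x ^ 2) ^ 2.
Definition gu (x : R) : R := x * (3 + x ^ 2) / (1 + x ^ 2) ^ 2.
Definition gPsi (x : R) : R := x ^ 3 / (1 + x ^ 2).

Ltac rational_derive x n :=
  auto_derive; [exact (one_plus_sq_pow_neq x n)|field; exact (one_plus_sq_neq x)].

Lemma is_derive_ga x : is_derive ga x (dga x).
Proof. unfold ga, dga. rational_derive x 3%nat. Qed.
Lemma is_derive_dga x : is_derive dga x (d2ga x).
Proof. unfold dga, d2ga. rational_derive x 4%nat. Qed.
Lemma is_derive_gb x : is_derive gb x (dgb x).
Proof. unfold gb, dgb. rational_derive x 3%nat. Qed.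
Lemma is_derive_dgb x : is_derive dgb x (d2gb x).
Proof. unfold dgb, d2gb. rational_derive x 4%nat. Qed.
Lemma is_derive_gu1 x : is_derive gu1 x (x * ga x).
Proof. unfold gu1, ga. rational_derive x 2%nat. Qed.
Lemma is_derive_gu x : is_derive gu x (gb x).
Proof. unfold gu, gb. rational_derive x 2%nat. Qed.
Lemma is_derive_gPsi x : is_derive gPsi x (x * gu x).
Proof.
unfold gPsi, gu. auto_derive; [exact (one_plus_sq_neq x)|field; exact (one_plus_sq_neq x)].
Qed.

Lemma wave_data_gauge : wave_data ga dga gb dgb gu gPsi.
Proof.
constructor.
- exact is_derive_ga.
- intros x. exact (is_derive_continuous _ _ _ (is_derive_dga x)).
- exact is_derive_gb.
- intros x. exact (is_derive_continuous _ _ _ (is_derive_dgb x)).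
- exact is_derive_gu.
- exact is_derive_gPsi.
- unfold ga. field.
- unfold gu. field.
- unfold gPsi. field.
Qed.

Lemma source_a_gauge x : source_a ga dga dgb gu gPsi x = 0.
Proof.
unfold source_a, pert, ga, dga, dgb, gu, gPsi. field. exact (one_plus_sq_neq x).
Qed.

Lemma source_b_gauge x : source_b dga gb dgb x = 0.
Proof. unfold source_b, ga, dga, gb, dgb. field. exact (one_plus_sq_neq x). Qed.

Lemma wave_data_sub_gauge (a da b db u Psi : R -> R) (k : R) : wave_data a da b db u Psi ->
  wave_data (fun x => 1 * a x + - k * ga x) (fun x => 1 * da x + - k * dga x)
    (fun x => 1 * b x + - k * gb x) (fun x => 1 * db x + - k * dgb x)
    (fun x => 1 * u x + - k * gu x) (fun x => 1 * Psi x + - k * gPsi x).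
Proof.
intros [H1 H2 H3 H4 H5 H6 H7 H8 H9].
destruct wave_data_gauge as [G1 G2 G3 G4 G5 G6 G7 G8 G9].
constructor; try (intros x; now apply is_derive_lincomb).
- intros x. rcont.
- intros x. rcont.
- intros x. replace (x * (1 * u x + - k * gu x)) with (1 * (x * u x) + - k * (x * gu x)) by ring.
  now apply is_derive_lincomb.
- rewrite H7, G7. ring.
- rewrite H8, G8. ring.
- rewrite H9, G9. ring.
Qed.

(* The multiple of the gauge mode is chosen so that the remainder has [Psi 1 = 0]. *)
Lemma energy_estimate_mod_gauge (a da b db u Psi : R -> R) (M : R) : wave_data a da b db u Psi ->
  0 < M -> RInt (fun x => source_a a da db u Psi x ^ 2 + source_b da b db x ^ 2) 0 1 <= M ^ 2 ->
  RInt (fun x => (1 * a x + - (2 * Psi 1) * ga x) ^ 2 + (1 * b x + - (2 * Psi 1) * gb x) ^ 2) 0 1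
    <= (8705 * M) ^ 2.
Proof.
intros H HM HN. set (k := 2 * Psi 1).
assert (Efa : forall x : R, source_a (fun x => 1 * a x + - k * ga x) (fun x => 1 * da x + - k * dga x)
    (fun x => 1 * db x + - k * dgb x) (fun x => 1 * u x + - k * gu x)
    (fun x => 1 * Psi x + - k * gPsi x) x = source_a a da db u Psi x).
{ intros x. transitivity (source_a a da db u Psi x - k * source_a ga dga dgb gu gPsi x).
  - unfold source_a, pert. field. exact (one_plus_sq_neq x).
  - rewrite source_a_gauge. ring. }
assert (Efb : forall x : R, source_b (fun x => 1 * da x + - k * dga x)
    (fun x => 1 * b x + - k * gb x) (fun x => 1 * db x + - k * dgb x) x = source_b da b db x).
{ intros x. transitivity (source_b da b db x - k * source_b dga gb dgb x).
  - unfold source_b. ring.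
  - rewrite source_b_gauge. ring. }
apply (energy_estimate (wave_data_sub_gauge _ _ _ _ _ _ k H) M HM).
- rewrite (RInt_ext _ (fun x => source_a a da db u Psi x ^ 2 + source_b da b db x ^ 2)); [exact HN|].
  intros x _. now rewrite Efa, Efb.
- unfold k, gPsi. field.
Qed.

(* One real component of an element of the domain of [L0]; [P] and [u] are the components of
   its two entries. *)
Record core_data (P a da d2P b db d2b u Psi : R -> R) : Prop := {
  cd_wave : wave_data a da b db u Psi;
  cd_P : forall x, is_derive P x (x * a x);
  cd_d2P : forall x, is_derive (fun x => a x + x * da x) x (d2P x);
  cd_d2P_cont : forall x, continuous d2P x;
  cd_d2b : forall x, is_derive db x (d2b x);
  cd_d2b_cont : forall x, continuous d2b x;
  cd_P0 : P 0 = 0 }.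

Lemma core_data_gauge (k : R) :
  core_data (fun x => k * gu1 x) (fun x => k * ga x) (fun x => k * dga x)
    (fun x => k * (2 * dga x + x * d2ga x)) (fun x => k * gb x) (fun x => k * dgb x)
    (fun x => k * d2gb x) (fun x => k * gu x) (fun x => k * gPsi x).
Proof.
destruct wave_data_gauge as [G1 G2 G3 G4 G5 G6 G7 G8 G9].
assert (S : forall (f source_1 : R -> R), (forall x, is_derive f x (source_1 x)) ->
  forall x, is_derive (fun x => k * f x) x (k * source_1 x)) by (intros; now apply is_derive_scal).
constructor; [constructor|..].
- now apply S.
- intros x. rcont.
- now apply S.
- intros x. rcont.
- now apply S.
- intros x. replace (x * (k * gu x)) with (k * (x * gu x)) by ring. exact (S _ _ G6 x).
- rewrite G7. ring.
- rewrite G8. ring.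
- rewrite G9. ring.
- intros x. replace (x * (k * ga x)) with (k * (x * ga x)) by ring.
  exact (S _ _ is_derive_gu1 x).
- intros x. auto_derive.
  + repeat split; [exact (ex_intro _ _ (G1 x))|exact (ex_intro _ _ (is_derive_dga x))].
  + rewrite (is_derive_unique (fun y : R => ga y) x _ (G1 x)),
      (is_derive_unique (fun y : R => dga y) x _ (is_derive_dga x)). ring.
- intros x. unfold d2ga. rcont.
- apply S. exact is_derive_dgb.
- intros x. unfold d2gb. rcont.
- unfold gu1. field.
Qed.

Section Core.
Context {P a da d2P b db d2b u Psi : R -> R}.
Hypothesis H : core_data P a da d2P b db d2b u Psi.

Let Hw := cd_wave _ _ _ _ _ _ _ _ _ H.
Let Ha := wd_a _ _ _ _ _ _ Hw.
Let Hda := wd_da _ _ _ _ _ _ Hw.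
Let Hb := wd_b _ _ _ _ _ _ Hw.
Let Hdb := wd_db _ _ _ _ _ _ Hw.
Let Hu := wd_u _ _ _ _ _ _ Hw.
Let HPsi := wd_Psi _ _ _ _ _ _ Hw.
Let HP := cd_P _ _ _ _ _ _ _ _ _ H.
Let Hd2P := cd_d2P _ _ _ _ _ _ _ _ _ H.
Let Cd2P := cd_d2P_cont _ _ _ _ _ _ _ _ _ H.
Let Hd2b := cd_d2b _ _ _ _ _ _ _ _ _ H.
Let Cd2b := cd_d2b_cont _ _ _ _ _ _ _ _ _ H.

Ltac cderive x :=
    auto_derive;
    [ repeat lazymatch goal with
        | |- _ /\ _ => split
        | |- True => exact I
        | |- ex_derive (fun y => a y) _ => exact (ex_intro _ _ (Ha x))
        | |- ex_derive (fun y => b y) _ => exact (ex_intro _ _ (Hb x))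
        | |- ex_derive (fun y => u y) _ => exact (ex_intro _ _ (Hu x))
        | |- ex_derive (fun y => Psi y) _ => exact (ex_intro _ _ (HPsi x))
        | |- ex_derive (fun y => P y) _ => exact (ex_intro _ _ (HP x))
        | |- ex_derive (fun y => db y) _ => exact (ex_intro _ _ (Hd2b x))
        end
    | rewrite ?(is_derive_unique (fun y : R => a y) x _ (Ha x)),
       ?(is_derive_unique (fun y : R => b y) x _ (Hb x)),
       ?(is_derive_unique (fun y : R => u y) x _ (Hu x)),
       ?(is_derive_unique (fun y : R => Psi y) x _ (HPsi x)),
       ?(is_derive_unique (fun y : R => P y) x _ (HP x)),
       ?(is_derive_unique (fun y : R => db y) x _ (Hd2b x)) ].

Lemma core_dP x : is_derive (fun x => x * a x) x (a x + x * da x).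
Proof. cderive x. ring. Qed.

Lemma core_dP_cont x : continuous (fun x => a x + x * da x) x.
Proof. rcont. Qed.

Lemma core_L0_1 x : is_derive (fun x => P x - x ^ 2 * a x + x * b x - u x) x
  (x * (db x - (a x + x * da x))).
Proof. cderive x. ring. Qed.

Lemma core_L0_1' x : is_derive (fun x => x * (db x - (a x + x * da x))) x
  (db x - (a x + x * da x) + x * (d2b x - d2P x)).
Proof.
pose proof (Derive.is_derive_mult (fun x => x) (fun x => db x - (a x + x * da x)) x _ _
  (is_derive_id x) (is_derive_minus (V := R_NormedModule) _ _ x _ _ (Hd2b x) (Hd2P x))) as E.
apply (is_derive_value _ x _ _ E).
change (1 * (db x - (a x + x * da x)) + x * (d2b x - d2P x) =
  db x - (a x + x * da x) + x * (d2b x - d2P x)). ring.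
Qed.

Lemma core_L0_1_cont x : continuous (fun x => db x - (a x + x * da x) + x * (d2b x - d2P x)) x.
Proof. rcont. Qed.

Lemma core_L0_2 x : is_derive (fun x => a x - x * b x) x (da x - b x - x * db x).
Proof. cderive x. ring. Qed.

(** Thus [- pert] is the [a]-coordinate of [L' u], which is why a bound on [pert] controls
    [L' u]. *)
Lemma core_Lprime x :
  is_derive (fun x => 16 * Psi x / (1 + x ^ 2) ^ 2) x (x * - pert u Psi x).
Proof.
cderive x; [exact (one_plus_sq_pow_neq x 2)|]. unfold pert. field. exact (one_plus_sq_neq x).
Qed.

Definition dpert x : R :=
  128 * (x * u x) / (1 + x ^ 2) ^ 3 - 384 * (x * Psi x) / (1 + x ^ 2) ^ 4 - 16 * b x / (1 + x ^ 2) ^ 2.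

Lemma core_Lprime' x :
  is_derive (fun x => x * - pert u Psi x) x (- pert u Psi x + x * - dpert x).
Proof.
unfold pert, dpert.
cderive x; [exact (one_plus_sq_pow_neq x 3)|exact (one_plus_sq_pow_neq x 2)|].
field. exact (one_plus_sq_neq x).
Qed.

Lemma core_Lprime_cont x : continuous (fun x => - pert u Psi x + x * - dpert x) x.
Proof. unfold pert, dpert. rcont. Qed.

Lemma core_Psi_integral x : is_RInt (fun s => s * u s) 0 x (Psi x).
Proof.
replace (Psi x) with (minus (Psi x) (Psi 0)).
- apply (is_RInt_derive (V := R_CompleteNormedModule)); intros; [apply HPsi|rcont].
- rewrite (wd_Psi0 _ _ _ _ _ _ Hw). exact (Rminus_0_r _).
Qed.

End Core.

(** The condition [P2 0 = 0] is what yields [a 0 = 0], as [a 0] is the derivative of [P1] at [0]. *)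
Lemma core_data_of_jets (P P1 P2 P3 Q Q1 Q2 Q3 : R -> R) :
  (forall x, is_derive P x (P1 x)) -> (forall x, is_derive P1 x (P2 x)) ->
  (forall x, is_derive P2 x (P3 x)) -> (forall x, continuous P3 x) ->
  (forall x, is_derive Q x (Q1 x)) -> (forall x, is_derive Q1 x (Q2 x)) ->
  (forall x, is_derive Q2 x (Q3 x)) -> (forall x, continuous Q3 x) ->
  P 0 = 0 -> P1 0 = 0 -> P2 0 = 0 -> Q 0 = 0 ->
  exists a da Psi, core_data P a da P3 Q1 Q2 Q3 Q Psi.
Proof.
intros HP HP1 HP2 CP HQ HQ1 HQ2 CQ P0 P10 P20 Q0.
assert (CP2 : forall x, continuous P2 x) by (intros x; rcont).
destruct (hadamard_C1 P1 P2 P3 HP1 HP2 CP P10) as (a & da & Ha & Cda & Ea & Ea0).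
exists a, da, (fun x => 0 + RInt (fun s => s * Q s) 0 x).
assert (E2 : forall x, P2 x = a x + x * da x).
{ intros x. rewrite <- (is_derive_unique P1 x _ (HP1 x)). apply is_derive_unique.
  apply (is_derive_ext (fun x => x * a x)); [intros t; symmetry; apply Ea|].
  auto_derive; [exact (ex_intro _ _ (Ha x))|].
  rewrite (is_derive_unique (fun y : R => a y) x _ (Ha x)). ring. }
constructor; [constructor|..]; try assumption.
- intros x. rcont.
- intros x. apply (is_derive_primitive (fun s => s * Q s)). intros y. rcont.
- now rewrite Ea0.
- assert (E : RInt (fun s => s * Q s) 0 0 = 0) by exact (RInt_point 0 _).
  rewrite E. ring.
- intros x. rewrite <- Ea. apply HP.
- intros x. apply (is_derive_ext P2); [exact E2|apply HP2].
Qed.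

Lemma domL0_core_data (u1 u2 : R -> C) : domL0_1 u1 -> domL0_2 u2 ->
  exists P a da d2P b db d2b u Psi P' a' da' d2P' b' db' d2b' u' Psi',
    core_data P a da d2P b db d2b u Psi /\
    core_data P' a' da' d2P' b' db' d2b' u' Psi' /\
    components u1 P P' /\ components u2 u u'.
Proof.
intros [Hk1 [u10 [u11 u12]]] [Hk2 u20].
destruct (Ck01_0_elim _ (proj2 (proj2 (proj2 Hk1)))) as (p3 & q3 & D3 & Cp3 & Cq3).
destruct (Ck01_S_elim 0 _ _ _ (proj2 (proj2 Hk1)) D3 Cp3 Cq3) as (p2 & q2 & D2 & Hp2 & Hq2).
destruct (Ck01_S_elim 1 _ p2 q2 (proj2 Hk1) D2) as (p1 & q1 & D1 & Hp1 & Hq1);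
  [intros x; rcont|intros x; rcont|].
destruct (Ck01_S_elim 2 u1 p1 q1 Hk1 D1) as (p & q & D0 & Hp & Hq);
  [intros x; rcont|intros x; rcont|].
destruct (Ck01_0_elim _ (proj2 (proj2 (proj2 Hk2)))) as (r3 & s3 & F3 & Cr3 & Cs3).
destruct (Ck01_S_elim 0 _ _ _ (proj2 (proj2 Hk2)) F3 Cr3 Cs3) as (r2 & s2 & F2 & Hr2 & Hs2).
destruct (Ck01_S_elim 1 _ r2 s2 (proj2 Hk2) F2) as (r1 & s1 & F1 & Hr1 & Hs1);
  [intros x; rcont|intros x; rcont|].
destruct (Ck01_S_elim 2 u2 r1 s1 Hk2 F1) as (r & s & F0 & Hr & Hs);
  [intros x; rcont|intros x; rcont|].
rewrite D0 in u10 by lra. rewrite D1 in u11 by lra. rewrite D2 in u12 by lra.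
rewrite F0 in u20 by lra.
injection u10 as E1 E2. injection u11 as E3 E4. injection u12 as E5 E6. injection u20 as E7 E8.
destruct (core_data_of_jets p p1 p2 p3 r r1 r2 r3) as (a & da & Psi & H); try assumption.
destruct (core_data_of_jets q q1 q2 q3 s s1 s2 s3) as (a' & da' & Psi' & H'); try assumption.
do 18 eexists. split; [exact H|]. split; [exact H'|]. now split.
Qed.

Lemma preH2_zero : preH2 (fun _ => RtoC 0).
Proof.
apply (preH2_intro _ (fun _ => 0) (fun _ => 0) (fun _ => 0) (fun _ => 0)); try reflexivity.
- intros x _. reflexivity.
- intros x. apply (is_derive_const (V := R_NormedModule)).
- intros x. apply (is_derive_const (V := R_NormedModule)).
- intros x. apply Rcontinuous_const.
- intros x. apply Rcontinuous_const.
Qed.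

(** The entries of [(1 - L) u]. The factor [RtoC (-1)] and, in [residual2], the summand [RtoC 0]
    give them exactly the shape that [embed_plus] and [embed_scal] produce. *)
Definition residual1 (u1 u2 : R -> C) (x : R) : C := (u1 x + RtoC (-1) * (L0_1 u1 u2 x + Lprime_1 u2 x))%C.
Definition residual2 (u1 u2 : R -> C) (x : R) : C := (u2 x + RtoC (-1) * (L0_2 u1 u2 x + RtoC 0))%C.

Section CorePair.
Context {P a da d2P b db d2b u Psi P' a' da' d2P' b' db' d2b' u' Psi' : R -> R}.
Hypothesis H : core_data P a da d2P b db d2b u Psi.
Hypothesis H' : core_data P' a' da' d2P' b' db' d2b' u' Psi'.
Context {u1 u2 : R -> C}.
Hypothesis E1 : components u1 P P'.
Hypothesis E2 : components u2 u u'.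

Let W := cd_wave _ _ _ _ _ _ _ _ _ H.
Let W' := cd_wave _ _ _ _ _ _ _ _ _ H'.
Let D1 := components_deriv01 _ _ _ _ _ E1
  (cd_P _ _ _ _ _ _ _ _ _ H) (cd_P _ _ _ _ _ _ _ _ _ H').
Let D2 := components_deriv01 _ _ _ _ _ E2 (wd_u _ _ _ _ _ _ W) (wd_u _ _ _ _ _ _ W').
Let DD1 := components_deriv01 _ _ _ _ _ D1 (core_dP H) (core_dP H').
Let DD2 := components_deriv01 _ _ _ _ _ D2 (wd_b _ _ _ _ _ _ W) (wd_b _ _ _ _ _ _ W').

Lemma core_pair_domL0 : domL0_1 u1 /\ domL0_2 u2.
Proof.
pose proof (wd_a0 _ _ _ _ _ _ W) as a0. pose proof (wd_a0 _ _ _ _ _ _ W') as a0'.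
split; split.
- apply (Ck01_S_intro 2 _ _ _ _ _ E1 (cd_P _ _ _ _ _ _ _ _ _ H) (cd_P _ _ _ _ _ _ _ _ _ H')).
  apply (Ck01_S_intro 1 _ _ _ _ _ D1 (core_dP H) (core_dP H')).
  apply (Ck01_S_intro 0 _ _ _ _ _ DD1
    (cd_d2P _ _ _ _ _ _ _ _ _ H) (cd_d2P _ _ _ _ _ _ _ _ _ H')).
  apply (Ck01_0_intro _ d2P d2P').
  + apply (components_deriv01 _ _ _ _ _ DD1);
      [exact (cd_d2P _ _ _ _ _ _ _ _ _ H)|exact (cd_d2P _ _ _ _ _ _ _ _ _ H')].
  + exact (cd_d2P_cont _ _ _ _ _ _ _ _ _ H).
  + exact (cd_d2P_cont _ _ _ _ _ _ _ _ _ H').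
- rewrite E1, D1, DD1, (cd_P0 _ _ _ _ _ _ _ _ _ H), (cd_P0 _ _ _ _ _ _ _ _ _ H'), a0, a0' by lra.
  repeat split; apply injective_projections; simpl; ring.
- apply (Ck01_S_intro 2 _ _ _ _ _ E2 (wd_u _ _ _ _ _ _ W) (wd_u _ _ _ _ _ _ W')).
  apply (Ck01_S_intro 1 _ _ _ _ _ D2 (wd_b _ _ _ _ _ _ W) (wd_b _ _ _ _ _ _ W')).
  apply (Ck01_S_intro 0 _ _ _ _ _ DD2
    (cd_d2b _ _ _ _ _ _ _ _ _ H) (cd_d2b _ _ _ _ _ _ _ _ _ H')).
  apply (Ck01_0_intro _ d2b d2b').
  + apply (components_deriv01 _ _ _ _ _ DD2);
      [exact (cd_d2b _ _ _ _ _ _ _ _ _ H)|exact (cd_d2b _ _ _ _ _ _ _ _ _ H')].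
  + exact (cd_d2b_cont _ _ _ _ _ _ _ _ _ H).
  + exact (cd_d2b_cont _ _ _ _ _ _ _ _ _ H').
- rewrite E2, (wd_u0 _ _ _ _ _ _ W), (wd_u0 _ _ _ _ _ _ W') by lra. reflexivity.
Qed.

Lemma core_pair_preH : preH1 u1 /\ preH2 u2.
Proof.
split.
- apply (preH1_intro u1 P P' a a' _ _ E1 (cd_P _ _ _ _ _ _ _ _ _ H) (cd_P _ _ _ _ _ _ _ _ _ H')
   (core_dP H) (core_dP H') (core_dP_cont H) (core_dP_cont H')
   (cd_P0 _ _ _ _ _ _ _ _ _ H) (cd_P0 _ _ _ _ _ _ _ _ _ H')).
- pose proof (wd_b _ _ _ _ _ _ W). pose proof (wd_b _ _ _ _ _ _ W').
  apply (preH2_intro u2 u u' b b' E2 (wd_u _ _ _ _ _ _ W) (wd_u _ _ _ _ _ _ W'));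
    [intros x; rcont|intros x; rcont|exact (wd_u0 _ _ _ _ _ _ W)|exact (wd_u0 _ _ _ _ _ _ W')].
Qed.

Lemma L0_1_components : components (L0_1 u1 u2)
  (fun x => P x - x ^ 2 * a x + x * b x - u x)
  (fun x => P' x - x ^ 2 * a' x + x * b' x - u' x).
Proof.
intros x Hx. unfold L0_1. rewrite (E1 x Hx), (E2 x Hx), (D1 x Hx), (D2 x Hx).
apply injective_projections; simpl; ring.
Qed.

Lemma preH1_L0_1 : preH1 (L0_1 u1 u2).
Proof.
apply (preH1_intro _ _ _ _ _ _ _ L0_1_components (core_L0_1 H) (core_L0_1 H')
  (core_L0_1' H) (core_L0_1' H') (core_L0_1_cont H) (core_L0_1_cont H')).
- rewrite (cd_P0 _ _ _ _ _ _ _ _ _ H), (wd_u0 _ _ _ _ _ _ W). ring.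
- rewrite (cd_P0 _ _ _ _ _ _ _ _ _ H'), (wd_u0 _ _ _ _ _ _ W'). ring.
Qed.

Lemma L0_2_components : components (L0_2 u1 u2) (fun x => a x - x * b x) (fun x => a' x - x * b' x).
Proof.
intros x Hx. unfold L0_2. rewrite (D1 x Hx), (D2 x Hx).
destruct (Req_EM_T x 0) as [->|Hx0].
(* At [0] the product with [/ RtoC 0] is [0], because the derivative of [u1] vanishes there. *)
- rewrite (wd_a0 _ _ _ _ _ _ W), (wd_a0 _ _ _ _ _ _ W').
  apply injective_projections; simpl; ring.
- assert (Hc : RtoC x <> RtoC 0) by (intros E; injection E; exact Hx0).
  replace (x * a x, x * a' x) with (RtoC x * (a x, a' x))%C
    by (apply injective_projections; simpl; ring).
  rewrite Cmult_assoc, Cinv_l by exact Hc.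
  apply injective_projections; simpl; ring.
Qed.

Lemma preH2_L0_2 : preH2 (L0_2 u1 u2).
Proof.
pose proof (wd_b _ _ _ _ _ _ W). pose proof (wd_b _ _ _ _ _ _ W').
pose proof (wd_da _ _ _ _ _ _ W). pose proof (wd_da _ _ _ _ _ _ W').
pose proof (wd_db _ _ _ _ _ _ W). pose proof (wd_db _ _ _ _ _ _ W').
apply (preH2_intro _ _ _ _ _ L0_2_components (core_L0_2 H) (core_L0_2 H'));
  [intros x; rcont|intros x; rcont|..].
- rewrite (wd_a0 _ _ _ _ _ _ W). ring.
- rewrite (wd_a0 _ _ _ _ _ _ W'). ring.
Qed.

Lemma Lprime_1_components : components (Lprime_1 u2)
  (fun x => 16 * Psi x / (1 + x ^ 2) ^ 2) (fun x => 16 * Psi' x / (1 + x ^ 2) ^ 2).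
Proof.
intros x Hx. unfold Lprime_1.
rewrite (CRInt_pair _ (fun s => s * u s) (fun s => s * u' s) 0 x (Psi x) (Psi' x));
  [|lra| |exact (core_Psi_integral H x)|exact (core_Psi_integral H' x)].
- unfold V1. apply injective_projections; simpl; field; nra.
- intros t Ht. rewrite (E2 t) by lra. apply injective_projections; simpl; ring.
Qed.

Lemma preH1_Lprime_1 : preH1 (Lprime_1 u2).
Proof.
apply (preH1_intro _ _ _ _ _ _ _ Lprime_1_components (core_Lprime H) (core_Lprime H')
  (core_Lprime' H) (core_Lprime' H') (core_Lprime_cont H) (core_Lprime_cont H')).
- rewrite (wd_Psi0 _ _ _ _ _ _ W). field.
- rewrite (wd_Psi0 _ _ _ _ _ _ W'). field.
Qed.

Lemma residual1_components : components (residual1 u1 u2) (source_1 a b u Psi) (source_1 a' b' u' Psi').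
Proof.
intros x Hx. unfold residual1, source_1.
rewrite (E1 x Hx), (L0_1_components x Hx), (Lprime_1_components x Hx).
apply injective_projections; simpl; field; nra.
Qed.

Lemma residual2_components : components (residual2 u1 u2) (source_2 a b u) (source_2 a' b' u').
Proof.
intros x Hx. unfold residual2, source_2. rewrite (E2 x Hx), (L0_2_components x Hx).
apply injective_projections; simpl; ring.
Qed.

Lemma residual_preH : preH1 (residual1 u1 u2) /\ preH2 (residual2 u1 u2).
Proof.
destruct core_pair_preH. split.
- apply (preH1_plus u1); [assumption|].
  apply (preH1_scal (RtoC (-1)) (fun x => (L0_1 u1 u2 x + Lprime_1 u2 x)%C)).
  apply preH1_plus; [exact preH1_L0_1|exact preH1_Lprime_1].
- apply (preH2_plus u2); [assumption|].
  apply (preH2_scal (RtoC (-1)) (fun x => (L0_2 u1 u2 x + RtoC 0)%C)).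
  apply (preH2_plus (L0_2 u1 u2)); [exact preH2_L0_2|exact preH2_zero].
Qed.

End CorePair.

(** The right-hand side of the Sturm-Liouville equation paired with its homogeneous solution
    [x^3 / (1 + x^2)]. It is defined on pairs of functions and reaches the completion by
    continuity. *)
Definition annihilator (u : (R -> C) * (R -> C)) : C :=
  CRInt (fun x => ((fst u x + RtoC (x ^ 2) * snd u x) * RtoC (x / (1 + x ^ 2)))%C) 0 1.

Lemma annihilator_components (u1 u2 : R -> C) (p1 q1 p2 q2 : R -> R) :
  components u1 p1 q1 -> components u2 p2 q2 ->
  (forall x, continuous p1 x) -> (forall x, continuous q1 x) ->
  (forall x, continuous p2 x) -> (forall x, continuous q2 x) ->
  annihilator (u1, u2) =
    (RInt (fun x => (p1 x + x ^ 2 * p2 x) * (x / (1 + x ^ 2))) 0 1,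
     RInt (fun x => (q1 x + x ^ 2 * q2 x) * (x / (1 + x ^ 2))) 0 1).
Proof.
intros E1 E2 Cp1 Cq1 Cp2 Cq2. unfold annihilator.
apply (CRInt_pair _ (fun x => (p1 x + x ^ 2 * p2 x) * (x / (1 + x ^ 2)))
  (fun x => (q1 x + x ^ 2 * q2 x) * (x / (1 + x ^ 2)))); [lra| | |].
- intros t Ht. simpl fst. simpl snd. rewrite (E1 t), (E2 t) by lra.
  apply injective_projections; simpl; field; nra.
- apply is_RInt_of_continuous. intros x. rcont.
- apply is_RInt_of_continuous. intros x. rcont.
Qed.

Lemma moment_lincomb (k k' : R) (p q p' q' : R -> R) :
  (forall x, continuous p x) -> (forall x, continuous q x) ->
  (forall x, continuous p' x) -> (forall x, continuous q' x) ->
  RInt (fun x => ((k * p x + k' * p' x) + x ^ 2 * (k * q x + k' * q' x)) * (x / (1 + x ^ 2))) 0 1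
  = k * RInt (fun x => (p x + x ^ 2 * q x) * (x / (1 + x ^ 2))) 0 1
    + k' * RInt (fun x => (p' x + x ^ 2 * q' x) * (x / (1 + x ^ 2))) 0 1.
Proof.
intros. apply is_RInt_unique.
apply (is_RInt_ext (fun x => k * ((p x + x ^ 2 * q x) * (x / (1 + x ^ 2)))
  + k' * ((p' x + x ^ 2 * q' x) * (x / (1 + x ^ 2))))).
- intros x _.
  change (@eq R (k * ((p x + x ^ 2 * q x) * (x / (1 + x ^ 2)))
  + k' * ((p' x + x ^ 2 * q' x) * (x / (1 + x ^ 2))))
   (((k * p x + k' * p' x) + x ^ 2 * (k * q x + k' * q' x)) * (x / (1 + x ^ 2)))).
  ring.
- apply (is_RInt_plus (V := R_NormedModule)); apply (is_RInt_scal (V := R_NormedModule));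
    apply is_RInt_of_continuous; intros x; rcont.
Qed.

Lemma preH1_continuous_components (u : R -> C) : preH1 u ->
  exists p q, components u p q /\ (forall x, continuous p x) /\ (forall x, continuous q x).
Proof.
intros Hu. destruct (preH1_elim u Hu) as (p & q & a & b & p2 & q2 & E & Hp & Hq & _).
exists p, q. split; [exact E|]. split; intros x; rcont.
Qed.

Lemma preH2_continuous_components (u : R -> C) : preH2 u ->
  exists p q, components u p q /\ (forall x, continuous p x) /\ (forall x, continuous q x).
Proof.
intros Hu. destruct (preH2_elim u Hu) as (p & q & a & b & E & Hp & Hq & _).
exists p, q. split; [exact E|]. split; intros x; rcont.
Qed.

Lemma annihilator_plus (u1 u2 v1 v2 : R -> C) : preH1 u1 -> preH2 u2 -> preH1 v1 -> preH2 v2 ->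
  annihilator (fun x => (u1 x + v1 x)%C, fun x => (u2 x + v2 x)%C) =
    (annihilator (u1, u2) + annihilator (v1, v2))%C.
Proof.
intros Hu1 Hu2 Hv1 Hv2.
destruct (preH1_continuous_components u1 Hu1) as (p1 & q1 & E1 & Cp1 & Cq1).
destruct (preH2_continuous_components u2 Hu2) as (p2 & q2 & E2 & Cp2 & Cq2).
destruct (preH1_continuous_components v1 Hv1) as (p3 & q3 & E3 & Cp3 & Cq3).
destruct (preH2_continuous_components v2 Hv2) as (p4 & q4 & E4 & Cp4 & Cq4).
rewrite (annihilator_components u1 u2 p1 q1 p2 q2), (annihilator_components v1 v2 p3 q3 p4 q4),
  (annihilator_components _ _ (fun x => 1 * p1 x + 1 * p3 x) (fun x => 1 * q1 x + 1 * q3 x)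
     (fun x => 1 * p2 x + 1 * p4 x) (fun x => 1 * q2 x + 1 * q4 x)); try assumption;
  try (intros x; rcont).
- rewrite !moment_lincomb by assumption. apply injective_projections; simpl; ring.
- intros x Hx. rewrite (components_plus _ _ _ _ _ _ E1 E3 x Hx). f_equal; ring.
- intros x Hx. rewrite (components_plus _ _ _ _ _ _ E2 E4 x Hx). f_equal; ring.
Qed.

Lemma annihilator_scal (k : C) (u1 u2 : R -> C) : preH1 u1 -> preH2 u2 ->
  annihilator (fun x => (k * u1 x)%C, fun x => (k * u2 x)%C) = (k * annihilator (u1, u2))%C.
Proof.
intros Hu1 Hu2.
destruct (preH1_continuous_components u1 Hu1) as (p1 & q1 & E1 & Cp1 & Cq1).
destruct (preH2_continuous_components u2 Hu2) as (p2 & q2 & E2 & Cp2 & Cq2).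
rewrite (annihilator_components u1 u2 p1 q1 p2 q2),
  (annihilator_components _ _
     (fun x => fst k * p1 x + - snd k * q1 x) (fun x => fst k * q1 x + snd k * p1 x)
     (fun x => fst k * p2 x + - snd k * q2 x) (fun x => fst k * q2 x + snd k * p2 x));
  try assumption; try (intros x; rcont).
- rewrite !moment_lincomb by assumption. apply injective_projections; simpl; ring.
- intros x Hx. rewrite (components_scal k _ _ _ E1 x Hx). f_equal; ring.
- intros x Hx. rewrite (components_scal k _ _ _ E2 x Hx). f_equal; ring.
Qed.

Lemma moment_bound (p a q b : R -> R) (M : R) : 0 < M ->
  (forall x, is_derive p x (x * a x)) -> (forall x, is_derive q x (b x)) ->
  (forall x, continuous a x) -> (forall x, continuous b x) -> p 0 = 0 -> q 0 = 0 ->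
  RInt (fun x => a x ^ 2 + b x ^ 2) 0 1 <= M ^ 2 ->
  Rabs (RInt (fun x => (p x + x ^ 2 * q x) * (x / (1 + x ^ 2))) 0 1) <= 2 * M.
Proof.
intros HM Hp Hq Ca Cb p0 q0 HN.
assert (Ba : RInt (fun x => a x ^ 2) 0 1 <= M ^ 2).
{ eapply Rle_trans; [|exact HN]. apply RInt_le; try lra;
    try (apply ex_RInt_of_continuous; intros; rcont).
  intros x _. pose proof (pow2_ge_0 (b x)). lra. }
assert (Bb : RInt (fun x => b x ^ 2) 0 1 <= M ^ 2).
{ eapply Rle_trans; [|exact HN]. apply RInt_le; try lra;
    try (apply ex_RInt_of_continuous; intros; rcont).
  intros x _. pose proof (pow2_ge_0 (a x)). lra. }
replace (2 * M) with ((1 - 0) * (2 * M)) by ring.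
apply abs_RInt_le_const; [lra|apply ex_RInt_of_continuous; intros; rcont|].
intros x Hx.
assert (B1 : Rabs (p x) <= 1 * M).
{ apply (primitive_sq_bound p a (fun y => y)); try assumption; try (intros; rcont).
  intros y Hy. rewrite Rabs_right; lra. }
assert (B2 : Rabs (q x) <= 1 * M).
{ apply (primitive_sq_bound q b (fun _ => 1)); try assumption; try (intros; rcont).
  - intros y. rewrite Rmult_1_l. apply Hq.
  - intros y Hy. rewrite Rabs_right; lra. }
assert (Hw : 0 <= x / (1 + x ^ 2) <= 1).
{ split; [apply Rdiv_le_0_compat; [lra|apply one_plus_sq_pos]|].
  apply Rle_div_l; [apply one_plus_sq_pos|nra]. }
rewrite Rabs_mult, (Rabs_right (x / _)) by lra.
replace (2 * M) with (2 * M * 1) by ring.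
apply Rmult_le_compat; [apply Rabs_pos|lra| |lra].
eapply Rle_trans; [apply Rabs_triang|]. rewrite Rabs_mult, (Rabs_right (x ^ 2)) by nra.
assert (x ^ 2 <= 1) by nra. pose proof (Rabs_pos (q x)). nra.
Qed.

Section AnnihilatorBound.
Context {H1 H2 : CompleteNormedModule C_AbsRing} (i1 : (R -> C) -> H1) (i2 : (R -> C) -> H2).
Hypothesis hH1 : is_completion preH1 ip1 i1.
Hypothesis hH2 : is_completion preH2 ip2 i2.

Lemma annihilator_bound (u1 u2 : R -> C) : preH1 u1 -> preH2 u2 ->
  Cmod (annihilator (u1, u2)) <= 4 * norm (embed i1 i2 u1 u2).
Proof.
intros Hu1 Hu2.
destruct (preH1_elim u1 Hu1) as (p & q & a & b & p' & q' & E & Hp & Hq & _ & _ & _ & _ & Ca & Cb & p0 & q0).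
destruct (preH2_elim u2 Hu2) as (r & s & c & d & F & Hr & Hs & Cc & Cd & r0 & s0).
pose proof (norm_embed i1 i2 hH1 hH2 u1 u2 p q a b r s c d Hu1 Hu2 E Hp Hq Ca Cb F Hr Hs Cc Cd) as N.
set (n := norm (embed i1 i2 u1 u2)) in *.
assert (Hn : 0 <= n) by apply norm_ge_0.
rewrite (annihilator_components u1 u2 p q r s E F); try (intros x; rcont).
(* [moment_bound] requires a positive bound, which [n + eps / 4] is even for [n = 0]. The factor [4]
   is [2] for each of the two real components. *)
apply le_epsilon. intros eps Heps.
assert (Pos : forall f g : R -> R, (forall x, continuous f x) -> (forall x, continuous g x) ->
  0 <= RInt (fun x => f x ^ 2 + g x ^ 2) 0 1).
{ intros f g Cf Cg. apply RInt_ge_0; [lra|apply ex_RInt_of_continuous; intros; rcont|].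
  intros x _. pose proof (pow2_ge_0 (f x)). pose proof (pow2_ge_0 (g x)). lra. }
pose proof (Pos a c Ca Cc). pose proof (Pos b d Cb Cd).
assert (n ^ 2 <= (n + eps / 4) ^ 2) by nra.
eapply Rle_trans; [apply Cmod_pair_le|].
assert (B1 : Rabs (RInt (fun x => (p x + x ^ 2 * r x) * (x / (1 + x ^ 2))) 0 1)
  <= 2 * (n + eps / 4)).
{ apply (moment_bound p a r c); try assumption; lra. }
assert (B2 : Rabs (RInt (fun x => (q x + x ^ 2 * s x) * (x / (1 + x ^ 2))) 0 1)
  <= 2 * (n + eps / 4)).
{ apply (moment_bound q b s d); try assumption; lra. }
lra.
Qed.

End AnnihilatorBound.

(** * Extension to the completion *)

(** A [ball] need not be a ball of the norm: in the product it is componentwise while the norm is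
    Euclidean. [norm_factor] pays for the difference. *)
Lemma ball_norm {V : CompleteNormedModule C_AbsRing} (eps : R) : 0 < eps ->
  exists d : posreal, forall x y : V, ball x d y -> norm (minus x y) < eps.
Proof.
intros Heps. pose proof (norm_factor_gt_0 (V := V)) as Hf.
exists (mkposreal _ (Rdiv_lt_0_compat _ _ Heps Hf)). intros x y Hxy.
assert (E : norm (minus x y) = norm (minus y x)).
{ transitivity (norm (opp (minus y x))); [f_equal; vring V|exact (norm_opp (minus y x))]. }
rewrite E. pose proof (norm_compat2 (V := V) x y _ Hxy) as B. simpl in B.
replace (norm_factor * (eps / norm_factor)) with eps in B by (field; lra). exact B.
Qed.

Section ExtendFunctional.
Context {V : CompleteNormedModule C_AbsRing} {T : Type}.
Variables (D : T -> Prop) (add : T -> T -> T) (sc : C -> T -> T) (e : T -> V) (f : T -> C) (K : R).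
Hypothesis HK : 0 <= K.
Hypothesis D_add : forall s t, D s -> D t -> D (add s t).
Hypothesis D_sc : forall k t, D t -> D (sc k t).
Hypothesis e_add : forall s t, D s -> D t -> e (add s t) = plus (e s) (e t).
Hypothesis e_sc : forall k t, D t -> e (sc k t) = scal (k : C_AbsRing) (e t).
Hypothesis f_add : forall s t, D s -> D t -> f (add s t) = (f s + f t)%C.
Hypothesis f_sc : forall k t, D t -> f (sc k t) = (k * f t)%C.
Hypothesis f_bound : forall t, D t -> Cmod (f t) <= K * norm (e t).
Hypothesis dense : forall (x : V) eps, 0 < eps -> exists t, D t /\ norm (minus x (e t)) < eps.

(** One representative [t] for each [eps] suffices to determine [c], since nearby representatives
    have nearby values by [functional_near]. *)
Let extends (x : V) (c : C) : Prop :=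
  forall eps, 0 < eps -> exists t, D t /\ norm (minus x (e t)) < eps /\ Cmod (f t - c)%C < eps.

(** [e] may identify distinct representatives. Applying [f_bound] to their difference shows that [f]
    depends on [e t] only, and continuously so. *)
Lemma functional_lipschitz (s t : T) : D s -> D t ->
  Cmod (f s - f t)%C <= K * norm (minus (e s) (e t)).
Proof.
intros Hs Ht. set (d := add s (sc (RtoC (-1)) t)).
assert (Hd : D d) by (apply D_add; [exact Hs|now apply D_sc]).
replace (f s - f t)%C with (f d).
2:{ unfold d. rewrite f_add, f_sc by auto. ring. }
replace (minus (e s) (e t)) with (e d); [now apply f_bound|].
unfold d. rewrite e_add, e_sc by auto. vring V.
Qed.

Lemma functional_near (x : V) (eps eps' : R) (s t : T) : D s -> D t ->
  norm (minus x (e s)) <= eps -> norm (minus x (e t)) <= eps' ->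
  Cmod (f s - f t)%C <= K * (eps + eps').
Proof.
intros Hs Ht Bs Bt. refine (Rle_trans _ _ _ (functional_lipschitz s t Hs Ht) _).
apply Rmult_le_compat_l; [exact HK|].
replace (minus (e s) (e t)) with (minus (minus x (e t)) (minus x (e s))) by vring V.
refine (Rle_trans _ _ _ (norm_minus_le _ _) _). lra.
Qed.

(** The values of [f] on representatives close to [x] form a Cauchy filter in the plane, and [c] is
    its limit. *)
Lemma extends_exists (x : V) : exists c, extends x c.
Proof.
set (F := fun P : C -> Prop =>
  exists eps, 0 < eps /\ forall t, D t -> norm (minus x (e t)) < eps -> P (f t)).
assert (HF : ProperFilter F).
{ constructor.
  - intros P [eps [Heps HP]]. destruct (dense x eps Heps) as [t [Ht Hx]]. exists (f t). auto.
  - constructor.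
    + exists 1. split; [lra|auto].
    + intros P Q [eps [Heps HP]] [eps' [Heps' HQ]].
      exists (Rmin eps eps'). split; [now apply Rmin_glb_lt|]. intros t Ht Hx. split.
      * apply HP; [exact Ht|]. exact (Rlt_le_trans _ _ _ Hx (Rmin_l _ _)).
      * apply HQ; [exact Ht|]. exact (Rlt_le_trans _ _ _ Hx (Rmin_r _ _)).
    + intros P Q HPQ [eps [Heps HP]]. exists eps. split; [exact Heps|auto]. }
assert (HC : cauchy (T := C_R_CompleteNormedModule) F).
{ intros eps. set (d := eps / (2 * K + 1)).
  assert (Hd : 0 < d) by (apply Rdiv_lt_0_compat; [apply cond_pos|lra]).
  destruct (dense x d Hd) as [s [Hs Hsx]]. exists (f s), d. split; [exact Hd|].
  intros t Ht Htx.
  pose proof (functional_near x d d t s Ht Hs (Rlt_le _ _ Htx) (Rlt_le _ _ Hsx)) as B.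
  assert (B' : K * (d + d) < eps).
  { assert (E : pos eps = (2 * K + 1) * d) by (unfold d; field; lra).
    rewrite E. lra. }
  split.
  - eapply Rle_lt_trans; [exact (Rabs_fst_le_Cmod (f t - f s)%C)|lra].
  - eapply Rle_lt_trans; [exact (Rabs_snd_le_Cmod (f t - f s)%C)|lra]. }
set (c := lim (T := C_R_CompleteNormedModule) F). exists c. intros eps Heps.
assert (Heps2 : 0 < eps / 2) by lra.
destruct (complete_cauchy (T := C_R_CompleteNormedModule) F HF HC (mkposreal _ Heps2)) as [d [Hd HB]].
destruct (dense x (Rmin d eps)) as [t [Ht Htx]]; [now apply Rmin_glb_lt|].
exists t. split; [exact Ht|]. split; [exact (Rlt_le_trans _ _ _ Htx (Rmin_r _ _))|].
destruct (HB t Ht (Rlt_le_trans _ _ _ Htx (Rmin_l _ _))) as [B1 B2].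
change (Rabs (fst (f t) - fst c) < eps / 2) in B1.
change (Rabs (snd (f t) - snd c) < eps / 2) in B2.
eapply Rle_lt_trans; [apply Cmod_le_Rabs|].
change (Rabs (fst (f t) - fst c) + Rabs (snd (f t) - snd c) < eps). lra.
Qed.

Lemma extends_unique (x : V) (c c' : C) : extends x c -> extends x c' -> c = c'.
Proof.
intros Hc Hc'. assert (E : Cmod (c - c')%C = 0).
{ apply Rle_antisym; [|apply Cmod_ge_0]. apply le_epsilon. intros eps Heps.
  set (d := eps / (2 * K + 2)). assert (Hd : 0 < d) by (apply Rdiv_lt_0_compat; lra).
  destruct (Hc d Hd) as (s & Hs & Hsx & Bs). destruct (Hc' d Hd) as (t & Ht & Htx & Bt).
  pose proof (functional_near x d d s t Hs Ht (Rlt_le _ _ Hsx) (Rlt_le _ _ Htx)) as B.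
  replace (c - c')%C with ((f s - f t) + (- (f s - c)) + (f t - c'))%C by ring.
  eapply Rle_trans; [apply Cmod_triangle|].
  eapply Rle_trans; [apply Rplus_le_compat_r, Cmod_triangle|]. rewrite Cmod_opp.
  assert (E : eps = (2 * K + 2) * d) by (unfold d; field; lra). lra. }
apply Cmod_eq_0 in E. replace c with (c - c' + c')%C by ring. rewrite E. ring.
Qed.

Lemma extend_bounded_functional : exists l : V -> C,
  is_linear (V := C_NormedModule) l /\ forall t, D t -> l (e t) = f t.
Proof.
set (l := fun x => proj1_sig (constructive_indefinite_description _ (extends_exists x))).
assert (Hl : forall x, extends x (l x))
  by (intros x; apply (proj2_sig (constructive_indefinite_description _ (extends_exists x)))).
assert (Hadd : forall x y : V, l (plus x y) = (l x + l y)%C).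
{ intros x y. apply (extends_unique (plus x y)); [apply Hl|]. intros eps Heps.
    destruct (Hl x (eps / 2)) as (s & Hs & Hsx & Bs); [lra|].
    destruct (Hl y (eps / 2)) as (t & Ht & Htx & Bt); [lra|].
    exists (add s t). split; [auto|]. rewrite e_add, f_add by auto. split.
  - replace (minus (plus x y) (plus (e s) (e t)))
      with (plus (minus x (e s)) (minus y (e t))) by vring V.
    refine (Rle_lt_trans _ _ _ (norm_plus_le _ _) _). lra.
  - change (Cmod (f s + f t - (l x + l y))%C < eps).
    replace (f s + f t - (l x + l y))%C with ((f s - l x) + (f t - l y))%C by ring.
    eapply Rle_lt_trans; [apply Cmod_triangle|]. lra. }
assert (Hsc : forall (k : C) (x : V), l (scal (k : C_AbsRing) x) = (k * l x)%C).
{ intros k x. apply (extends_unique (scal (k : C_AbsRing) x)); [apply Hl|]. intros eps Heps.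
    pose proof (Cmod_ge_0 k) as Hk.
    set (d := eps / (Cmod k + 1)). assert (Hd : 0 < d) by (apply Rdiv_lt_0_compat; lra).
    assert (E : Cmod k * d < eps).
    { assert (E : eps = (Cmod k + 1) * d) by (unfold d; field; lra). rewrite E. lra. }
    destruct (Hl x d Hd) as (t & Ht & Htx & Bt).
    exists (sc k t). split; [auto|]. rewrite e_sc, f_sc by auto. split.
  - replace (minus (scal (k : C_AbsRing) x : V) (scal (k : C_AbsRing) (e t) : V))
      with (scal (k : C_AbsRing) (minus x (e t))) by vring V.
    refine (Rle_lt_trans _ _ _ (Cnorm_scal _ _) _).
    eapply Rle_lt_trans; [|exact E]. apply Rmult_le_compat_l; lra.
  - change (Cmod (k * f t - k * l x)%C < eps).
    replace (k * f t - k * l x)%C with (k * (f t - l x))%C by ring.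
    rewrite Cmod_mult. eapply Rle_lt_trans; [|exact E]. apply Rmult_le_compat_l; lra. }
assert (Hbd : forall x : V, Cmod (l x) <= (K + 1) * norm x).
{ intros x.
    apply Rle_trans with (K * norm x); [|pose proof (norm_ge_0 x); lra].
    apply le_epsilon. intros eps Heps. set (d := eps / (K + 1)).
    assert (Hd : 0 < d) by (apply Rdiv_lt_0_compat; lra).
    destruct (Hl x d Hd) as (t & Ht & Htx & Bt).
    replace (l x) with (- (f t - l x) + f t)%C by ring.
    eapply Rle_trans; [apply Cmod_triangle|]. rewrite Cmod_opp.
    pose proof (f_bound t Ht) as B.
    assert (B2 : norm (e t) <= norm x + d).
    { replace (e t) with (minus x (minus x (e t))) by vring V.
      refine (Rle_trans _ _ _ (norm_minus_le _ _) _). lra. }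
    assert (K * norm (e t) <= K * (norm x + d)) by (apply Rmult_le_compat_l; lra).
    assert (E : eps = (K + 1) * d) by (unfold d; field; lra). lra. }
exists l. split.
- split.
  + exact Hadd.
  + exact Hsc.
  + exists (K + 1). split; [lra|exact Hbd].
- intros t Ht. apply (extends_unique (e t)); [apply Hl|]. intros eps Heps.
  exists t. split; [exact Ht|].
  replace (minus (e t) (e t)) with (zero : V) by vring V.
  replace (f t - f t)%C with (RtoC 0) by ring. assert (Z : norm (zero : V) = 0) by exact norm_zero.
  rewrite Cmod_0, Z. lra.
Qed.

End ExtendFunctional.

(** * From the core to the closure *)

Section PerturbedClosure.
Context {V : CompleteNormedModule C_AbsRing}.
Variables (A0 : operator V) (B : V -> V) (l : V -> C) (g : V) (K : R).
Hypothesis HB : is_linear B.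
Hypothesis Hl : is_linear (V := C_NormedModule) l.
Hypothesis Hlg : l g <> RtoC 0.
Hypothesis HK : 0 <= K.
Hypothesis core_annihilated : forall x y, A0 x y -> l (minus x (plus y (B x))) = RtoC 0.
Hypothesis core_estimate : forall x y, A0 x y ->
  exists k : C, norm (minus x (scal (k : C_AbsRing) g)) <= K * norm (minus x (plus y (B x))).

(** Both [x] and [(1 - A) x] are approximated by the same core element; boundedness of [B] is what
    carries the graph approximation over to the perturbed operator. *)
Lemma perturbed_closure_approx (x y : V) (eps : R) : op_perturb (op_closure A0) B x y -> 0 < eps ->
  exists x' y', A0 x' y' /\ norm (minus x x') < eps /\
    norm (minus (minus x y) (minus x' (plus y' (B x')))) < eps.
Proof.
intros [z [Hz ->]] Heps. destruct (linear_norm B HB) as [M [HM HMb]].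
set (d := eps / (2 + M)). assert (Hd : 0 < d) by (apply Rdiv_lt_0_compat; lra).
assert (E : eps = (2 + M) * d) by (unfold d; field; lra).
destruct (ball_norm (V := V) d Hd) as [del Hdel].
destruct (Hz del) as (x' & y' & HA & Bx & By).
apply Hdel in Bx. apply Hdel in By. exists x', y'. split; [exact HA|]. split.
- rewrite E. nra.
- replace (minus (minus x (plus z (B x))) (minus x' (plus y' (B x'))))
    with (minus (minus (minus x x') (minus z y')) (B (minus x x'))).
  2:{ replace (B (minus x x')) with (minus (B x) (B x')).
      - vring V.
      - replace (minus x x') with (plus x (scal (RtoC (-1) : C_AbsRing) x')) by vring V.
        rewrite (linear_plus B HB), (linear_scal B HB). vring V. }
  refine (Rle_lt_trans _ _ _ (norm_minus_le _ _) _).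
  pose proof (norm_minus_le (minus x x') (minus z y')) as N.
  pose proof (HMb (minus x x')) as N2.
  assert (M * norm (minus x x') <= M * d) by (apply Rmult_le_compat_l; lra).
  change (norm (B (minus x x')) <= M * norm (minus x x')) in N2.
  rewrite E. lra.
Qed.

Lemma perturbed_closure_annihilated (x y : V) : op_perturb (op_closure A0) B x y -> l y = l x.
Proof.
intros Hxy. destruct (linear_norm l Hl) as [M [HM HMb]].
assert (E : Cmod (l (minus x y)) = 0).
{ apply Rle_antisym; [|apply Cmod_ge_0]. apply le_epsilon. intros eps Heps.
  destruct (perturbed_closure_approx x y (eps / M) Hxy) as (x' & y' & HA & _ & N).
  { now apply Rdiv_lt_0_compat. }
  set (w := minus x' (plus y' (B x'))) in *.
  replace (minus x y) with (plus (minus (minus x y) w) w) by vring V.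
  rewrite (linear_plus l Hl). unfold w at 2. rewrite (core_annihilated x' y' HA).
  assert (Z : plus (l (minus (minus x y) w) : C_NormedModule) (RtoC 0) = l (minus (minus x y) w))
    by exact (Cplus_0_r _).
  rewrite Z. refine (Rle_trans _ _ _ (HMb _) _).
  apply Rle_trans with (M * (eps / M)); [apply Rmult_le_compat_l; lra|].
  apply Req_le. field. lra. }
apply Cmod_eq_0 in E.
assert (E' : l (minus x y) = (l x - l y)%C).
{ replace (minus x y) with (plus x (scal (RtoC (-1) : C_AbsRing) y)) by vring V.
  rewrite (linear_plus l Hl), (linear_scal l Hl).
  change (l x + RtoC (-1) * l y = l x - l y)%C. ring. }
rewrite E in E'. replace (l x) with (l x - l y + l y)%C by ring. rewrite <- E'. ring.
Qed.

(** On the core the estimate holds only modulo a multiple [k g] that depends on the approximant, and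
    these multiples need not be shown to converge. For [l x = 0], applying [l] to [v = x - k g]
    gives [k * l g = - l v], so [k g] is itself bounded by [v]. *)
Lemma perturbed_closure_estimate : exists K', forall x y, op_perturb (op_closure A0) B x y ->
  l x = RtoC 0 -> norm x <= K' * norm (minus x y).
Proof.
destruct (linear_norm l Hl) as [M [HM HMb]].
assert (Hg : 0 < Cmod (l g)) by (now apply Cmod_gt_0).
set (q := M * norm g / Cmod (l g)).
assert (Hq : 0 <= q).
{ apply Rdiv_le_0_compat; [|exact Hg]. apply Rmult_le_pos; [lra|apply norm_ge_0]. }
exists ((1 + q) * K). intros x y Hxy Hx.
assert (S : forall eps, 0 < eps -> norm x <= (1 + q) * (K * (norm (minus x y) + eps) + eps)).
{ intros eps Heps.
  destruct (perturbed_closure_approx x y eps Hxy Heps) as (x' & y' & HA & N1 & N2).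
  destruct (core_estimate x' y' HA) as [k Hk].
  set (w := minus x' (plus y' (B x'))) in *.
  assert (Nw : norm w <= norm (minus x y) + eps).
  { replace w with (minus (minus x y) (minus (minus x y) w)) by vring V.
    refine (Rle_trans _ _ _ (norm_minus_le _ _) _). lra. }
  set (v := minus x (scal (k : C_AbsRing) g)).
  assert (Nv : norm v <= K * (norm (minus x y) + eps) + eps).
  { replace v with (plus (minus x' (scal (k : C_AbsRing) g)) (minus x x'))
      by (unfold v; vring V).
    refine (Rle_trans _ _ _ (norm_plus_le _ _) _).
    assert (K * norm w <= K * (norm (minus x y) + eps)) by (apply Rmult_le_compat_l; lra). lra. }
  assert (Ek : (k * l g)%C = (- l v)%C).
  { assert (Ev : l v = (l x - k * l g)%C).
    { replace v with (plus x (scal ((- k)%C : C_AbsRing) g)) by (unfold v; vring V).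
      rewrite (linear_plus l Hl), (linear_scal l Hl).
      change (l x + - k * l g = l x - k * l g)%C. ring. }
    rewrite Ev, Hx. ring. }
  assert (Nk : Cmod k * Cmod (l g) <= M * norm v).
  { rewrite <- Cmod_mult, Ek, Cmod_opp. apply HMb. }
  assert (Nkg : Cmod k * norm g <= q * norm v).
  { unfold q. apply Rmult_le_reg_r with (Cmod (l g)); [exact Hg|].
    replace (M * norm g / Cmod (l g) * norm v * Cmod (l g)) with (M * norm v * norm g)
      by (field; lra).
    replace (Cmod k * norm g * Cmod (l g)) with (Cmod k * Cmod (l g) * norm g) by ring.
    apply Rmult_le_compat_r; [apply norm_ge_0|exact Nk]. }
  assert (Ex : x = plus v (scal (k : C_AbsRing) g)) by (unfold v; vring V).
  apply Rle_trans with ((1 + q) * norm v).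
  { clearbody v. rewrite Ex. refine (Rle_trans _ _ _ (norm_plus_le _ _) _).
    pose proof (Cnorm_scal k g) as Nc. lra. } apply Rmult_le_compat_l; lra. }
apply le_epsilon. intros eps Heps.
set (d := eps / ((1 + q) * (K + 1))).
assert (Hden : 0 < (1 + q) * (K + 1)) by (apply Rmult_lt_0_compat; lra).
assert (Hd : 0 < d) by (apply Rdiv_lt_0_compat; lra).
eapply Rle_trans; [apply (S d Hd)|]. apply Req_le. unfold d. field. split; lra.
Qed.

End PerturbedClosure.

(** * The operator [L]: solvability functional, gauge mode and estimate *)

Section Spectral.
Context {H1 H2 : CompleteNormedModule C_AbsRing} (i1 : (R -> C) -> H1) (i2 : (R -> C) -> H2).
Hypothesis hH1 : is_completion preH1 ip1 i1.
Hypothesis hH2 : is_completion preH2 ip2 i2.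
Let HH := prod_CompleteNormedModule H1 H2.
Variable L' : HH -> HH.
Hypothesis hL' : is_Lprime i1 i2 L'.

Let emb (t : (R -> C) * (R -> C)) : HH := embed i1 i2 (fst t) (snd t).
Let preH (t : (R -> C) * (R -> C)) : Prop := preH1 (fst t) /\ preH2 (snd t).

Lemma embed_dense (x : HH) (eps : R) : 0 < eps -> exists t, preH t /\ norm (minus x (emb t)) < eps.
Proof.
intros Heps. destruct (ball_norm (V := HH) eps Heps) as [d Hd].
destruct (completion_dense _ _ _ _ hH1 (fst x) d) as (u1 & Hu1 & B1).
destruct (completion_dense _ _ _ _ hH2 (snd x) d) as (u2 & Hu2 & B2).
exists (u1, u2). split; [split; assumption|]. apply Hd. split; assumption.
Qed.

Lemma annihilator_extends : exists l : HH -> C, is_linear (V := C_NormedModule) l /\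
  forall u1 u2, preH1 u1 -> preH2 u2 -> l (embed i1 i2 u1 u2) = annihilator (u1, u2).
Proof.
destruct (extend_bounded_functional (V := HH) preH
  (fun s t => (fun x => (fst s x + fst t x)%C, fun x => (snd s x + snd t x)%C))
  (fun k t => (fun x => (k * fst t x)%C, fun x => (k * snd t x)%C))
  emb annihilator 4) as [l [Hl E]].
- lra.
- intros [s1 s2] [t1 t2] [Hs1 Hs2] [Ht1 Ht2]. split; [now apply preH1_plus|now apply preH2_plus].
- intros k [t1 t2] [Ht1 Ht2]. split; [now apply preH1_scal|now apply preH2_scal].
- intros [s1 s2] [t1 t2] [Hs1 Hs2] [Ht1 Ht2]. now apply embed_plus.
- intros k [t1 t2] [Ht1 Ht2]. now apply embed_scal.
- intros [s1 s2] [t1 t2] [Hs1 Hs2] [Ht1 Ht2]. now apply annihilator_plus.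
- intros k [t1 t2] [Ht1 Ht2]. now apply annihilator_scal.
- intros [t1 t2] [Ht1 Ht2]. now apply annihilator_bound.
- exact embed_dense.
- exists l. split; [exact Hl|]. intros u1 u2 Hu1 Hu2. exact (E (u1, u2) (conj Hu1 Hu2)).
Qed.

Section CoreElement.
Context {P a da d2P b db d2b u Psi P' a' da' d2P' b' db' d2b' u' Psi' : R -> R}.
Hypothesis Hp : core_data P a da d2P b db d2b u Psi.
Hypothesis Hq : core_data P' a' da' d2P' b' db' d2b' u' Psi'.
Context {u1 u2 : R -> C}.
Hypothesis E1 : components u1 P P'.
Hypothesis E2 : components u2 u u'.

Let W := cd_wave _ _ _ _ _ _ _ _ _ Hp.
Let W' := cd_wave _ _ _ _ _ _ _ _ _ Hq.

Lemma residual_embed :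
  minus (embed i1 i2 u1 u2)
    (plus (embed i1 i2 (L0_1 u1 u2) (L0_2 u1 u2)) (L' (embed i1 i2 u1 u2))) =
  embed i1 i2 (residual1 u1 u2) (residual2 u1 u2).
Proof.
destruct (core_pair_preH Hp Hq E1 E2) as [Hu1 Hu2].
pose proof (preH1_plus _ _ (preH1_L0_1 Hp Hq E1 E2) (preH1_Lprime_1 Hp Hq E2)) as S1.
pose proof (preH2_plus _ _ (preH2_L0_2 Hp Hq E1 E2) preH2_zero) as S2.
rewrite (proj2 hL' u1 u2 Hu1 Hu2).
rewrite <- (embed_plus i1 i2 hH1 hH2 _ _ _ _ (preH1_L0_1 Hp Hq E1 E2) (preH2_L0_2 Hp Hq E1 E2)
  (preH1_Lprime_1 Hp Hq E2) preH2_zero).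
unfold residual1, residual2.
rewrite (embed_plus i1 i2 hH1 hH2 u1 u2 _ _ Hu1 Hu2
  (preH1_scal (RtoC (-1)) _ S1) (preH2_scal (RtoC (-1)) _ S2)),
  (embed_scal i1 i2 hH1 hH2 (RtoC (-1)) _ _ S1 S2).
vring HH.
Qed.

Lemma residual_norm :
  norm (embed i1 i2 (residual1 u1 u2) (residual2 u1 u2)) ^ 2 =
    RInt (fun x => source_a a da db u Psi x ^ 2 + source_b da b db x ^ 2) 0 1 +
    RInt (fun x => source_a a' da' db' u' Psi' x ^ 2 + source_b da' b' db' x ^ 2) 0 1.
Proof.
destruct (residual_preH Hp Hq E1 E2) as [R1 R2].
apply (norm_embed i1 i2 hH1 hH2 _ _ (source_1 a b u Psi) (source_1 a' b' u' Psi') _ _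
  (source_2 a b u) (source_2 a' b' u')); try assumption.
- exact (residual1_components Hp Hq E1 E2).
- exact (is_derive_source_1 W).
- exact (is_derive_source_1 W').
- exact (continuous_source_a W).
- exact (continuous_source_a W').
- exact (residual2_components Hp Hq E1 E2).
- exact (is_derive_source_2 W).
- exact (is_derive_source_2 W').
- exact (continuous_source_b W).
- exact (continuous_source_b W').
Qed.

Lemma annihilator_residual : annihilator (residual1 u1 u2, residual2 u1 u2) = RtoC 0.
Proof.
rewrite (annihilator_components _ _ _ _ _ _
  (residual1_components Hp Hq E1 E2) (residual2_components Hp Hq E1 E2)).
- now rewrite (solvability W), (solvability W').
- intros x. exact (is_derive_continuous _ _ _ (is_derive_source_1 W x)).
- intros x. exact (is_derive_continuous _ _ _ (is_derive_source_1 W' x)).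
- intros x. exact (is_derive_continuous _ _ _ (is_derive_source_2 W x)).
- intros x. exact (is_derive_continuous _ _ _ (is_derive_source_2 W' x)).
Qed.

End CoreElement.

Lemma g1_components (k : C) :
  components (fun x => (k * g1 x)%C) (fun x => fst k * gu1 x) (fun x => snd k * gu1 x).
Proof.
intros x _. unfold g1. fold (gu1 x). apply injective_projections; simpl; ring.
Qed.

Lemma g2_components (k : C) :
  components (fun x => (k * g2 x)%C) (fun x => fst k * gu x) (fun x => snd k * gu x).
Proof.
intros x _. unfold g2. fold (gu x). apply injective_projections; simpl; ring.
Qed.

Lemma preH_gauge : preH1 g1 /\ preH2 g2.
Proof.
apply (core_pair_preH (core_data_gauge 1) (core_data_gauge 0)).
- intros x _. unfold g1. fold (gu1 x). apply injective_projections; simpl; ring.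
- intros x _. unfold g2. fold (gu x). apply injective_projections; simpl; ring.
Qed.

Lemma embed_gauge (k : C) : embed i1 i2 (fun x => (k * g1 x)%C) (fun x => (k * g2 x)%C)
  = scal (k : C_AbsRing) (gauge_mode i1 i2).
Proof. destruct preH_gauge. now apply embed_scal. Qed.

(** The residual of a multiple of the gauge mode has zero norm because its coordinates [source_a]
    and [source_b] vanish. Its real and imaginary parts are the multiples of the real mode by
    [fst k] and [snd k]. *)
Lemma L_gauge (k : C) : L_op i1 i2 L' (scal (k : C_AbsRing) (gauge_mode i1 i2))
  (scal (k : C_AbsRing) (gauge_mode i1 i2)).
Proof.
rewrite <- embed_gauge.
set (u1 := fun x => (k * g1 x)%C). set (u2 := fun x => (k * g2 x)%C).
pose proof (core_data_gauge (fst k)) as Hp. pose proof (core_data_gauge (snd k)) as Hq.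
pose proof (g1_components k) as E1. pose proof (g2_components k) as E2.
exists (embed i1 i2 (L0_1 u1 u2) (L0_2 u1 u2)). split.
- intros eps. destruct (core_pair_domL0 Hp Hq E1 E2) as [D1 D2].
  exists (embed i1 i2 u1 u2), (embed i1 i2 (L0_1 u1 u2) (L0_2 u1 u2)).
  split; [exists u1, u2; auto|]. split; apply ball_center.
- pose proof (residual_norm Hp Hq E1 E2) as N.
  assert (Z : forall k0 : R,
    RInt (fun x => source_a (fun x => k0 * ga x) (fun x => k0 * dga x) (fun x => k0 * dgb x)
       (fun x => k0 * gu x) (fun x => k0 * gPsi x) x ^ 2 +
     source_b (fun x => k0 * dga x) (fun x => k0 * gb x) (fun x => k0 * dgb x) x ^ 2) 0 1 = 0).
  { intros k0. rewrite (RInt_ext _ (fun _ => 0)).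
    - rewrite RInt_const. exact (Rmult_0_r (1 - 0)).
    - intros x _.
      assert (Ea : source_a (fun x => k0 * ga x) (fun x => k0 * dga x) (fun x => k0 * dgb x)
         (fun x => k0 * gu x) (fun x => k0 * gPsi x) x = k0 * source_a ga dga dgb gu gPsi x).
      { unfold source_a, pert. field. exact (one_plus_sq_neq x). }
      assert (Eb : source_b (fun x => k0 * dga x) (fun x => k0 * gb x) (fun x => k0 * dgb x) x
         = k0 * source_b dga gb dgb x) by (unfold source_b; ring).
      rewrite Ea, Eb, source_a_gauge, source_b_gauge.
      change (@eq R ((k0 * 0) ^ 2 + (k0 * 0) ^ 2) 0). ring. }
  rewrite !Z, Rplus_0_r in N.
  rewrite <- (residual_embed Hp Hq E1 E2) in N.
  fold u1 u2 in N.
  set (x := embed i1 i2 u1 u2) in *. set (y := embed i1 i2 (L0_1 u1 u2) (L0_2 u1 u2)) in *.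
  assert (N0 : norm (minus x (plus y (L' x))) = 0).
  { destruct (Req_dec (norm (minus x (plus y (L' x)))) 0) as [|Hn]; [assumption|].
    exfalso. revert N. now apply pow_nonzero. }
  apply (norm_eq_zero (V := HH)) in N0.
  change (x = plus y (L' x)).
  replace x with (plus (minus x (plus y (L' x))) (plus y (L' x))) at 1 by vring HH.
  rewrite N0. apply plus_zero_l.
Qed.

Lemma annihilator_gauge : annihilator (g1, g2) <> RtoC 0.
Proof.
assert (C1 : forall x, continuous gu1 x) by (intros x; exact (is_derive_continuous _ _ _ (is_derive_gu1 x))).
assert (C2 : forall x, continuous gu x) by (intros x; exact (is_derive_continuous _ _ _ (is_derive_gu x))).
rewrite (annihilator_components g1 g2 gu1 (fun _ => 0) gu (fun _ => 0));
  try assumption; try (intros x; apply Rcontinuous_const);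
  try (intros x _; reflexivity).
intros E. apply (f_equal fst) in E. revert E.
change (RInt (fun x => (gu1 x + x ^ 2 * gu x) * (x / (1 + x ^ 2))) 0 1 <> 0).
apply Rgt_not_eq.
apply RInt_gt_0; [lra| |intros x _; rcont].
intros x Hx. pose proof (one_plus_sq_pos x).
assert (0 < gu1 x).
{ unfold gu1. apply Rdiv_lt_0_compat; [|now apply pow_lt].
  apply Rmult_lt_0_compat; [lra|apply pow_lt; lra]. }
assert (0 < gu x).
{ unfold gu. apply Rdiv_lt_0_compat; [|now apply pow_lt].
  apply Rmult_lt_0_compat; [lra|]. pose proof (pow2_ge_0 x). lra. }
apply Rmult_lt_0_compat.
- assert (0 < x ^ 2) by (apply pow_lt; lra).
  assert (0 < x ^ 2 * gu x) by (now apply Rmult_lt_0_compat). lra.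
- apply Rdiv_lt_0_compat; lra.
Qed.

Lemma core_estimate (x y : HH) : L0_tilde i1 i2 x y -> exists k : C,
  norm (minus x (scal (k : C_AbsRing) (gauge_mode i1 i2)))
    <= 17410 * norm (minus x (plus y (L' x))).
Proof.
intros (u1 & u2 & D1 & D2 & -> & ->).
destruct (domL0_core_data u1 u2 D1 D2) as (P & a & da & d2P & b & db & d2b & u & Psi &
  P' & a' & da' & d2P' & b' & db' & d2b' & u' & Psi' & Hp & Hq & E1 & E2).
pose proof (cd_wave _ _ _ _ _ _ _ _ _ Hp) as W. pose proof (cd_wave _ _ _ _ _ _ _ _ _ Hq) as W'.
destruct (core_pair_preH Hp Hq E1 E2) as [Hu1 Hu2]. destruct preH_gauge as [Hg1 Hg2].
(* Since [gPsi 1 = 1/2], subtracting [k g] makes both components of [Psi] vanish at [1]. *)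
pose (k := (2 * Psi 1, 2 * Psi' 1) : C). exists k.
refine (eq_ind_r (fun w : HH => _ <= 17410 * norm w) _ (residual_embed Hp Hq E1 E2)).
pose proof (residual_norm Hp Hq E1 E2) as N.
set (n := norm (embed i1 i2 (residual1 u1 u2) (residual2 u1 u2))) in *.
assert (Hn : 0 <= n) by apply norm_ge_0.
assert (Ex : minus (embed i1 i2 u1 u2) (scal (k : C_AbsRing) (gauge_mode i1 i2)) =
  embed i1 i2 (fun x => (u1 x + (- k) * g1 x)%C) (fun x => (u2 x + (- k) * g2 x)%C)).
{ rewrite (embed_plus i1 i2 hH1 hH2 u1 u2 _ _ Hu1 Hu2
    (preH1_scal (- k)%C _ Hg1) (preH2_scal (- k)%C _ Hg2)), embed_gauge.
  vring HH. }
refine (eq_ind_r (fun w : HH => norm w <= _) _ Ex).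
pose proof (wave_data_sub_gauge _ _ _ _ _ _ (2 * Psi 1) W) as V.
pose proof (wave_data_sub_gauge _ _ _ _ _ _ (2 * Psi' 1) W') as V'.
assert (HP : forall x, is_derive (fun x => 1 * P x + - (2 * Psi 1) * gu1 x) x
  (x * (1 * a x + - (2 * Psi 1) * ga x))).
{ intros x. apply (is_derive_value _ _ (1 * (x * a x) + - (2 * Psi 1) * (x * ga x))); [|ring].
  apply is_derive_lincomb; [exact (cd_P _ _ _ _ _ _ _ _ _ Hp x)|exact (is_derive_gu1 x)]. }
assert (HP' : forall x, is_derive (fun x => 1 * P' x + - (2 * Psi' 1) * gu1 x) x
  (x * (1 * a' x + - (2 * Psi' 1) * ga x))).
{ intros x. apply (is_derive_value _ _ (1 * (x * a' x) + - (2 * Psi' 1) * (x * ga x))); [|ring].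
  apply is_derive_lincomb; [exact (cd_P _ _ _ _ _ _ _ _ _ Hq x)|exact (is_derive_gu1 x)]. }
assert (N2 : norm (embed i1 i2 (fun x => (u1 x + (- k) * g1 x)%C) (fun x => (u2 x + (- k) * g2 x)%C)) ^ 2
 = RInt (fun x => (1 * a x + - (2 * Psi 1) * ga x) ^ 2 + (1 * b x + - (2 * Psi 1) * gb x) ^ 2) 0 1
 + RInt (fun x => (1 * a' x + - (2 * Psi' 1) * ga x) ^ 2 + (1 * b' x + - (2 * Psi' 1) * gb x) ^ 2) 0 1).
{ apply (norm_embed i1 i2 hH1 hH2 _ _
    (fun x => 1 * P x + - (2 * Psi 1) * gu1 x) (fun x => 1 * P' x + - (2 * Psi' 1) * gu1 x)
    (fun x => 1 * a x + - (2 * Psi 1) * ga x) (fun x => 1 * a' x + - (2 * Psi' 1) * ga x)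
    (fun x => 1 * u x + - (2 * Psi 1) * gu x) (fun x => 1 * u' x + - (2 * Psi' 1) * gu x)
    (fun x => 1 * b x + - (2 * Psi 1) * gb x) (fun x => 1 * b' x + - (2 * Psi' 1) * gb x)).
  - apply (preH1_plus u1); [exact Hu1|now apply (preH1_scal (- k)%C)].
  - apply (preH2_plus u2); [exact Hu2|now apply (preH2_scal (- k)%C)].
  - intros x Hx. rewrite (E1 x Hx), (g1_components (- k)%C x Hx).
    unfold k. apply injective_projections; simpl; ring.
  - exact HP.
  - exact HP'.
  - intros x. exact (is_derive_continuous _ _ _ (wd_a _ _ _ _ _ _ V x)).
  - intros x. exact (is_derive_continuous _ _ _ (wd_a _ _ _ _ _ _ V' x)).
  - intros x Hx. rewrite (E2 x Hx), (g2_components (- k)%C x Hx).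
    unfold k. apply injective_projections; simpl; ring.
  - exact (wd_u _ _ _ _ _ _ V).
  - exact (wd_u _ _ _ _ _ _ V').
  - intros x. exact (is_derive_continuous _ _ _ (wd_b _ _ _ _ _ _ V x)).
  - intros x. exact (is_derive_continuous _ _ _ (wd_b _ _ _ _ _ _ V' x)). }
set (m := norm (embed i1 i2 (fun x => (u1 x + (- k) * g1 x)%C) _)) in *.
assert (Hm : 0 <= m) by apply norm_ge_0.
change (m <= 17410 * n). apply le_epsilon. intros eps Heps.
(* Each real component of the residual has norm at most [n <= M], so the two energies sum to at most
   [2 (8705 M)^2]; the factor [sqrt 2] is rounded up to [2], giving [17410]. *)
set (M := n + eps / 17410). assert (HM : 0 < M) by (unfold M; lra).
assert (Pos : forall f h : R -> R, (forall x, continuous f x) -> (forall x, continuous h x) ->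
  0 <= RInt (fun x => f x ^ 2 + h x ^ 2) 0 1).
{ intros f h Cf Ch. apply RInt_ge_0; [lra|apply ex_RInt_of_continuous; intros; rcont|].
  intros x _. pose proof (pow2_ge_0 (f x)). pose proof (pow2_ge_0 (h x)). lra. }
pose proof (Pos _ _ (continuous_source_a W) (continuous_source_b W)).
pose proof (Pos _ _ (continuous_source_a W') (continuous_source_b W')).
assert (HnM : n ^ 2 <= M ^ 2) by (apply pow_incr; unfold M; lra).
assert (S : RInt (fun x => source_a a da db u Psi x ^ 2 + source_b da b db x ^ 2) 0 1 <= M ^ 2) by lra.
assert (S' : RInt (fun x => source_a a' da' db' u' Psi' x ^ 2 + source_b da' b' db' x ^ 2) 0 1 <= M ^ 2)
  by lra.
pose proof (energy_estimate_mod_gauge _ _ _ _ _ _ M W HM S) as B.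
pose proof (energy_estimate_mod_gauge _ _ _ _ _ _ M W' HM S') as B'.
replace (17410 * n + eps) with (17410 * M) by (unfold M; field).
apply Rsqr_incr_0; [|exact Hm|lra]. unfold Rsqr.
assert (0 <= M ^ 2) by (apply pow2_ge_0). nra.
Qed.

Lemma core_annihilated (l : HH -> C) :
  (forall u1 u2, preH1 u1 -> preH2 u2 -> l (embed i1 i2 u1 u2) = annihilator (u1, u2)) ->
  forall x y, L0_tilde i1 i2 x y -> l (minus x (plus y (L' x))) = RtoC 0.
Proof.
intros El x y (u1 & u2 & D1 & D2 & -> & ->).
destruct (domL0_core_data u1 u2 D1 D2) as (P & a & da & d2P & b & db & d2b & u & Psi &
  P' & a' & da' & d2P' & b' & db' & d2b' & u' & Psi' & Hp & Hq & E1 & E2).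
destruct (residual_preH Hp Hq E1 E2).
transitivity (l (embed i1 i2 (residual1 u1 u2) (residual2 u1 u2))).
- exact (f_equal l (residual_embed Hp Hq E1 E2)).
- rewrite El by assumption. exact (annihilator_residual Hp Hq E1 E2).
Qed.

End Spectral.

(** * The Riesz projection of [L] and its range *)

Theorem lemma4p21
  (H1 H2 : CompleteNormedModule C_AbsRing)
  (i1 : (R -> C) -> H1) (i2 : (R -> C) -> H2)
  (hH1 : is_completion preH1 ip1 i1)
  (hH2 : is_completion preH2 ip2 i2)
  (L' : prod_CompleteNormedModule H1 H2 -> prod_CompleteNormedModule H1 H2)
  (hL' : is_Lprime i1 i2 L')
  (r : R) (hr : 0 < r)
  (hGamma : forall lambda : C,
      Cmod (lambda - RtoC 1)%C <= r -> lambda <> RtoC 1 ->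
      resolvent_set (L_op i1 i2 L') lambda) :
  let L := L_op i1 i2 L' in
  let M := range (riesz_projection L (RtoC 1) r) in
  let L_M := op_restrict L M in
  (forall m : nat, (1 <= m)%nat ->
     forall u, op_ker (op_pow (op_shift (RtoC 1) L_M) m) u <->
               op_ker (op_shift (RtoC 1) L_M) u) /\
  (forall u, M u <-> span1 (gauge_mode i1 i2) u) /\
  eigenvalue L (RtoC 1) /\
  has_dim M 1.
Proof.
intros L M L_M.
set (HH := prod_CompleteNormedModule H1 H2) in *.
set (g := gauge_mode i1 i2 : HH).
destruct (annihilator_extends i1 i2 hH1 hH2) as [l [Hl El]].
destruct preH_gauge as [Hg1 Hg2].
assert (Hlg : l g <> RtoC 0).
{ unfold g, gauge_mode. rewrite El by assumption. exact annihilator_gauge. }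
assert (Lg : forall k : C, L (scal (k : C_AbsRing) g) (scal (k : C_AbsRing) g))
  by exact (L_gauge i1 i2 hH1 hH2 L' hL').
assert (Hann : forall x y, L x y -> l y = l x).
{ exact (perturbed_closure_annihilated (L0_tilde i1 i2) L' l (proj1 hL') Hl
    (core_annihilated i1 i2 hH1 hH2 L' hL' l El)). }
destruct (perturbed_closure_estimate (L0_tilde i1 i2) L' l g 17410 (proj1 hL') Hl Hlg
  ltac:(lra) (core_estimate i1 i2 hH1 hH2 L' hL')) as [K HK].
assert (one_g : scal (RtoC 1 : C_AbsRing) g = g) by exact (scal_one g).
assert (HP : forall f, riesz_projection L (RtoC 1) r f = scal ((l f / l g)%C : C_AbsRing) g).
{ apply (riesz_projection_rank_one L (RtoC 1) r hGamma l g K hr Hl Hlg).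
  - pose proof (Lg (RtoC 1)) as E. rewrite one_g in E |- *. exact E.
  - intros x y Hxy. rewrite (Hann x y Hxy). ring.
  - intros x y Hxy Hx. refine (Rle_trans _ _ _ (HK x y Hxy Hx) (Req_le _ _ _)).
    do 2 f_equal. exact (eq_sym (f_equal (fun w : HH => minus w y) (scal_one x))). }
assert (HM : forall u, M u <-> span1 g u).
{ intros u. split.
  - intros [f ->]. rewrite HP. now exists (l f / l g)%C.
  - intros [k ->]. exists (scal (k : C_AbsRing) g). rewrite HP, (linear_scal l Hl).
    f_equal. change (k = k * l g / l g)%C. field. exact Hlg. }
assert (M0 : M zero).
{ apply HM. exists (RtoC 0). symmetry. exact (scal_zero_l g). }
assert (L0 : op_shift (RtoC 1) L_M zero zero).
{ exists zero. split.
  - split; [exact M0|]. pose proof (Lg (RtoC 0)) as E.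
    replace (scal (RtoC 0 : C_AbsRing) g) with (zero : HH) in E
      by (symmetry; exact (scal_zero_l g)). exact E.
  - vring HH. }
assert (g0 : g <> zero).
{ intros E. apply Hlg. rewrite E. exact (linear_zero l Hl). }
split; [|split; [exact HM|split]].
- intros m Hm u. destruct m as [|m]; [lia|]. split.
  + intros [y [Hy Hk]]. destruct m as [|m].
    { simpl in Hk. subst y. exact Hy. }
    (* For exponents of at least [2], [y = (1 - L) u] must itself lie in the domain of [L_M], hence
       in [M], so [y = k g]. As [l] vanishes on the range of [1 - L] and not at [g], [k = 0]. All
       exponents are treated at once, without induction. *)
    destruct Hk as [y2 [[z [[My _] _]] _]].
    apply HM in My. destruct My as [k ->].
    destruct Hy as [z' [[Mu Lu] Ey]].
    assert (Ek : (k * l g)%C = RtoC 0).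
    { transitivity (l (scal (k : C_AbsRing) g)); [symmetry; exact (linear_scal l Hl k g)|].
      rewrite Ey. replace (minus (scal (RtoC 1 : C_AbsRing) u) z')
        with (plus u (scal (RtoC (-1) : C_AbsRing) z')) by vring HH.
      rewrite (linear_plus l Hl), (linear_scal l Hl), (Hann u z' Lu).
      change (l u + RtoC (-1) * l u = RtoC 0)%C. ring. }
    assert (k0 : k = RtoC 0).
    { destruct (Ceq_dec k (RtoC 0)) as [|Hk0]; [assumption|].
      exfalso. exact (Cmult_neq_0 _ _ Hk0 Hlg Ek). }
    exists z'. split; [now split|]. rewrite <- Ey, k0. symmetry. exact (scal_zero_l g).
  + intros Hu. exists zero. split; [exact Hu|].
    clear Hm Hu. induction m as [|m IH]; [reflexivity|]. now exists zero.
- exists g. split; [exact g0|]. pose proof (Lg (RtoC 1)) as E. rewrite one_g in E |- *. exact E.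
- exists (fun _ => g). split.
  + intros c Hc i Hi. replace i with 1%nat by lia. rewrite sum_n_n in Hc.
    destruct (Ceq_dec (c 1%nat) (RtoC 0)) as [|Hc0]; [assumption|].
    exfalso. apply g0.
    replace g with (scal ((/ c 1%nat)%C : C_AbsRing) (scal (c 1%nat : C_AbsRing) g)).
    * rewrite Hc. exact (scal_zero_r (V := CompleteNormedModule.ModuleSpace _ HH) _).
    * vring_with HH ltac:(field; exact Hc0).
  + intros x. rewrite HM. split.
    * intros [k ->]. exists (fun _ => k). now rewrite sum_n_n.
    * intros [c ->]. exists (c 1%nat). now rewrite sum_n_n.
Qed.
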